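(* Let $c,\varepsilon,d,s,n$ be parameters such that $c>0$ is fixed, $n$ is sufficiently large (in terms of $c$), $0<\varepsilon\le\frac{1}{(\log n)^4}$, $d\ge(\log n)^{10c+51}$ and $s\ge\frac{d}{4(\log n)^c}$. Let $F$ be a non-empty graph (that is, a graph with at least one edge) on at most $\frac{\sqrt d}{(\log n)^2}$ vertices, and let $H$ be an $n$-vertex $(\frac18,c,s)$-expander such that $\Delta(H)\le d$, $d(H)\ge d(1-\varepsilon)$ and $\delta(H)\ge\frac{d(H)}{2}$. Then $H$ contains a subdivision of $F$ covering all but at most $\frac{n}{\log n}$ vertices of $H$.
   Context: All graphs are finite and simple, and logarithms are base $2$. For a graph $G$, $d(G)$, $\delta(G)$, $\Delta(G)$ denote its average, minimum and maximum degree. For $X\subseteq V(G)$, $N_G(X)$ is the set of vertices outside $X$ adjacent to at least one vertex of $X$. For a set of edges $E'\subseteq E(H)$, $H-E'$ is $H$ with the edges of $E'$ deleted. A graph $H$ is an $(\varepsilon',c,s)$-expander if for every $U\subseteq V(H)$ and $E'\subseteq E(H)$ with $1\le|U|\le\frac23|V(H)|$ and $|E'|\le s|U|$ we have $|N_{H-E'}(U)|\ge\frac{\varepsilon'}{(\log|V(H)|)^c}\cdot|U|$. A subdivision of a graph $F$ is a graph obtained by replacing each edge $uv$ of $F$ with a path with ends $u$ and $v$ (possibly the edge itself), such that the internal vertex sets of these paths are pairwise disjoint and disjoint from the original vertices of $F$. *)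

(* Defs.v *)
From HB Require Import structures.
Set Warnings "-notation-overridden,-ambiguous-paths".
From mathcomp Require Import all_boot all_order all_algebra.
From mathcomp Require Import reals exp.
Set Implicit Arguments. Unset Strict Implicit. Unset Printing Implicit Defensive.
Import Order.TTheory GRing.Theory Num.Theory.
Local Open Scope ring_scope.

Record sgraph := SGraph {
  svertex :> finType;
  sedge : rel svertex;
  sedge_sym : symmetric sedge;
  sedge_irr : irreflexive sedge
}.

Section Graphs.
Variable G : sgraph.
Implicit Types (x y : G) (U : {set G}) (E : {set {set G}}).

Definition edges : {set {set G}} :=
  [set [set p.1; p.2] | p : G * G & sedge p.1 p.2].

Definition deg x : nat := #|[set y | sedge x y]|.
Definition max_deg : nat := (\max_(x : G) deg x)%N.
(* Every degree is smaller than #|G|, so the default value #|G| does not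
   matter as soon as G has a vertex. *)
Definition min_deg : nat := \big[minn/#|G|]_(x : G) deg x.
Definition avg_deg (R : realType) : R := (\sum_(x : G) deg x)%N%:R / #|G|%:R.

Definition nbhd U : {set G} := [set y | (y \notin U) && [exists x in U, sedge x y]].

Definition del_rel E : rel G := [rel x y | sedge x y && ([set x; y] \notin E)].

Lemma del_rel_sym E : symmetric (del_rel E).
Proof. by move=> x y; rewrite /del_rel /= sedge_sym setUC. Qed.

Lemma del_rel_irr E : irreflexive (del_rel E).
Proof. by move=> x; rewrite /del_rel /= sedge_irr. Qed.

Definition del_edges E : sgraph := SGraph (@del_rel_sym E) (@del_rel_irr E).

End Graphs.

Definition log2 (R : realType) (x : R) : R := ln x / ln 2.

Definition expander (R : realType) (eps c s : R) (H : sgraph) : Prop :=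
  forall (U : {set H}) (E : {set {set H}}),
    E \subset edges H ->
    (1 <= #|U|)%N -> #|U|%:R <= 2 / 3 * #|H|%:R :> R ->
    #|E|%:R <= s * #|U|%:R ->
    eps / (log2 (#|H|%:R : R) `^ c) * #|U|%:R
      <= #|@nbhd (del_edges E) U|%:R.

(* S is a subdivision of F: phi embeds the original vertices, and p u v lists
   the internal vertices, from u to v, of the path replacing the edge uv. An
   edge uv of F is met both as (u, v) and as (v, u); the two orientations
   describe the same path. The last two clauses say that S has no vertices or
   edges besides those of F's vertices and of these paths. *)
Definition is_subdivision (F S : sgraph) : Prop :=
  exists (phi : F -> S) (p : F -> F -> seq S),
    let full u v := phi u :: rcons (p u v) (phi v) in
    [/\ injective phi,
        forall u v, sedge u v ->
          [/\ path (@sedge S) (phi u) (rcons (p u v) (phi v)),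
              uniq (full u v),
              p v u = rev (p u v)
            & forall w, phi w \notin p u v],
        forall u v u' v', sedge u v -> sedge u' v' ->
          [set u; v] != [set u'; v'] ->
          forall x, x \in p u v -> x \notin p u' v',
        forall x : S, (exists u, x = phi u) \/
          (exists u v, sedge u v /\ x \in p u v)
      & forall x y : S, sedge x y ->
          exists u v, sedge u v /\ infix [:: x; y] (full u v)].

Definition subgraph_embedding (S H : sgraph) (f : S -> H) : Prop :=
  injective f /\ forall x y, sedge x y -> sedge (f x) (f y).

(* Main.v *)
(* The expansion is used only through its consequence that every set [U] with
   at most two thirds of the vertices sends at least [s * #|U|] edges outside.

   Connecting.  Choose sparse random sets one after the other. If [R] is the
   set reached so far from [X] while avoiding [Z], then [R] sends many edges
   outside, and by a Chernoff bound a proportional number of them start in the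
   next random set; as no vertex has many neighbours in a random set, many new
   vertices are reached. The failure probability is exponential in [#|R|], which
   allows a union bound over all pairs [(X, Z)] with [#|R|] much larger than
   [#|X| + #|Z|]. So, for the union [W] of these sets, among any family of pairs
   whose two sides have large neighbourhoods some pair can be linked through
   [W] minus any set of size proportional to the family, and Haxell's
   alternating trees yield disjoint links for all pairs.

   Small part.  Outside [W] a minimal dense set of vertices expands by a
   factor 1 + 1 / O(log n) and has large minimum degree; there all edges of [F]
   but one are embedded greedily by short paths.

   Large part.  Let [x v] be the degree of [v] inside the remaining vertices,
   divided by [d]. Keeping [v] with probability [x v] and giving an edge [uv]
   weight [1 / (d * x u * x v)] makes the remaining graph regular, since the
   expected weight at [v] is [1] (this is where the minimum degree is used).
   Split the kept vertices randomly into [K] layers: by Hall's theorem there are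
   almost perfect matchings between consecutive layers, which chain into long
   paths covering almost everything. Their ends lie in random sparse sets, so
   sets of ends have large neighbourhoods, and the paths can be joined through
   [W] into the path of the last edge of [F]. *)
Require Import Defs.
From HB Require Import structures.
From mathcomp Require Import all_boot all_order all_algebra.
From mathcomp Require Import reals sequences exp.
From mathcomp Require Import ring lra zify.
Set Implicit Arguments. Unset Strict Implicit. Unset Printing Implicit Defensive.
Import Order.TTheory GRing.Theory Num.Theory.
Local Open Scope ring_scope.

(** * Concentration *)

(** [expR x] is at most [1 / (1 - x)], and [(1 + x + 2 * x ^+ 2) * (1 - x)] exceeds 1 by
    [x ^+ 2 * (1 - 2 * x)]. Negative [x] is allowed, so both tails of a Chernoff bound can use
    this. *)
Lemma expR_quad (R : realType) (x : R) :
  x <= 1 / 2 -> expR x <= 1 + x + 2 * x ^+ 2.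
Proof.
move=> hx.
have h1 : 1 - x <= expR (- x) by have := expR_ge1Dx (- x); lra.
have hp : 0 < 1 - x by lra.
have : expR x * (1 - x) <= 1.
  have e1 : expR x * expR (- x) = 1 by rewrite -expRD subrr expR0.
  by rewrite -[leRHS]e1 ler_wpM2l // expR_ge0.
have : 1 <= (1 + x + 2 * x ^+ 2) * (1 - x).
  have : 0 <= x ^+ 2 * (1 - 2 * x) by rewrite mulr_ge0 ?sqr_ge0 //; lra.
  by nra.
move=> h2 h3; rewrite -(ler_pM2r hp); exact: le_trans h3 h2.
Qed.

(** Exponential Markov inequality and union bound in one step, written with finite sums: the
    products [\prod_v mu v (f v)] sum to 1 over all [f], and if every [f] violated some [t], the
    expanded sum would be at least 1. *)
Lemma exists_avoiding (R : realType) (V L T : finType) (P : pred T) (mu : V -> L -> R)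
    (g : T -> V -> L -> R) (b : T -> R) :
  (forall v l, 0 <= mu v l) -> (forall v, \sum_l mu v l = 1) ->
  \sum_(t | P t) expR (- b t) * \prod_v \sum_l mu v l * expR (g t v l) < 1 ->
  exists f : {ffun V -> L}, forall t, P t -> \sum_v g t v (f v) < b t.
Proof.
move=> mu0 mu1 hlt.
case: (boolP [exists f : {ffun V -> L}, [forall (t | P t), \sum_v g t v (f v) < b t]]).
  by case/existsP=> f /forall_inP h; exists f.
move=> /existsPn hf; exfalso.
suff : 1 <= \sum_(t | P t) expR (- b t) * \prod_v \sum_l mu v l * expR (g t v l).
  by rewrite leNgt hlt.
have E1 : \sum_(f : {ffun V -> L}) \prod_v mu v (f v) = 1.
  rewrite -(bigA_distr_bigA (fun v l => mu v l)).
  by rewrite (eq_bigr (fun _ => 1)) ?big1_eq // => v _; rewrite mu1.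
rewrite -[X in X <= _]E1.
under [X in _ <= X]eq_bigr => t _.
  rewrite (bigA_distr_bigA (fun v l => mu v l * expR (g t v l))) mulr_sumr.
  over.
rewrite exchange_big /= ler_sum // => f _.
have /forall_inPn [t Pt ht] := hf f.
have P0 : 0 <= \prod_v mu v (f v) by apply: prodr_ge0.
(* The term of the violated [t] alone dominates the weight of [f]. *)
rewrite (bigD1 t) //=.
apply: (@le_trans _ _ (expR (- b t) * \prod_v (mu v (f v) * expR (g t v (f v))))).
  rewrite big_split /= mulrCA ler_peMr // -expR_sum -expRD.
  by rewrite -expR0 ler_expR; move: ht; rewrite -leNgt; lra.
rewrite lerDl sumr_ge0 // => i _.
by rewrite mulr_ge0 ?expR_ge0 // prodr_ge0 // => v _; rewrite mulr_ge0 ?expR_ge0.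
Qed.

Lemma mgf_bound (R : realType) (V L : finType) (mu g : V -> L -> R) :
  (forall v l, 0 <= mu v l) -> (forall v, \sum_l mu v l = 1) ->
  (forall v l, g v l <= 1 / 2) ->
  \prod_v \sum_l mu v l * expR (g v l) <=
  expR (\sum_v \sum_l mu v l * (g v l + 2 * g v l ^+ 2)).
Proof.
move=> mu0 mu1 hg; rewrite expR_sum; apply: ler_prod => v _.
apply/andP; split; first by apply: sumr_ge0 => l _; rewrite mulr_ge0 ?expR_ge0.
apply: le_trans (expR_ge1Dx _); rewrite -[X in X + _](mu1 v) -big_split /= ler_sum // => l _.
have := ler_wpM2l (mu0 v l) (expR_quad (hg v l)); lra.
Qed.

(** Chernoff bounds for finitely many events at once: [up t] selects the tail, [M t] bounds one
    summand, and [m t] bounds the mean from the side that matters. All random choices below go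
    through this statement. *)
Lemma exists_concentrated (R : realType) (V L T : finType) (P : pred T)
    (mu : V -> L -> R) (up : T -> bool) (a : T -> V -> L -> R)
    (M m delta : T -> R) :
  (forall v l, 0 <= mu v l) -> (forall v, \sum_l mu v l = 1) ->
  (forall t, P t -> [/\ 0 < M t, 0 < delta t, delta t <= 1 &
     forall v l, 0 <= a t v l <= M t]) ->
  (forall t, P t -> if up t then \sum_v \sum_l mu v l * a t v l <= m t
                    else m t <= \sum_v \sum_l mu v l * a t v l) ->
  \sum_(t | P t) expR (- (delta t ^+ 2 * m t / (8 * M t))) < 1 ->
  exists f : {ffun V -> L}, forall t, P t ->
    if up t then \sum_v a t v (f v) < (1 + delta t) * m t
    else (1 - delta t) * m t < \sum_v a t v (f v).
Proof.
move=> mu0 mu1 hM hm hlt.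
pose sg t : R := if up t then 1 else -1.
(* With this exponent every [th t * a t v l] is at most [delta t / 4], so the quadratic term costs
   at most half of the gain [delta t]. *)
pose th t := delta t / (4 * M t).
pose g t v l := sg t * th t * a t v l.
pose b t := sg t * th t * ((1 + sg t * delta t) * m t).
have th0 t : P t -> 0 < th t.
  by move=> Pt; have [? ? _ _] := hM t Pt; rewrite divr_gt0 // mulr_gt0.
have [f hf] : exists f : {ffun V -> L}, forall t, P t -> \sum_v g t v (f v) < b t.
  apply: (@exists_avoiding R V L T P mu g b mu0 mu1).
  apply: le_lt_trans hlt; apply: ler_sum => t Pt.
  have [M0 d0 d1 ha] := hM t Pt.
  have thM : th t * M t = delta t / 4 by rewrite /th; field; lra.
  have t0 := th0 t Pt.
  have tha v l : 0 <= th t * a t v l <= delta t / 4.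
    have /andP[a0 aM] := ha v l.
    by rewrite -thM mulr_ge0 ?(ltW t0) //= ler_wpM2l // ltW.
  have hg v l : g t v l <= 1 / 2.
    rewrite /g /sg; case: (up t); have := tha v l; lra.
  apply: le_trans (ler_wpM2l (expR_ge0 _) (mgf_bound mu0 mu1 hg)) _.
  rewrite -expRD ler_expR.
  set s := \sum_v \sum_l mu v l * a t v l.
  have hs : \sum_v \sum_l mu v l * (g t v l + 2 * g t v l ^+ 2) <=
     (sg t + delta t / 2) * th t * s.
    rewrite /s mulr_sumr ler_sum // => v _; rewrite mulr_sumr ler_sum // => l _.
    rewrite [leRHS]mulrCA ler_wpM2l //.
    have := tha v l; rewrite /g /sg; set y := th t * a t v l => hy.
    have h2 : y * y <= y * (delta t / 4) by rewrite ler_wpM2l //; lra.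
    case: (up t).
    - have -> : 1 * th t * a t v l = y by rewrite /y; ring.
      have -> : (1 + delta t / 2) * th t * a t v l = (1 + delta t / 2) * y.
        by rewrite /y; ring.
      by nra.
    - have -> : -1 * th t * a t v l = - y by rewrite /y; ring.
      have -> : (-1 + delta t / 2) * th t * a t v l = (-1 + delta t / 2) * y.
        by rewrite /y; ring.
      by nra.
  have e1 : delta t ^+ 2 * m t / (8 * M t) = delta t * th t * m t / 2.
    by rewrite /th; field; lra.
  rewrite e1 /b; have := hm t Pt; rewrite -/s; move: hs; rewrite /sg.
  case: (up t) => hs hms.
  - have : (1 + delta t / 2) * th t * s <= (1 + delta t / 2) * th t * m t.
      by rewrite ler_wpM2l // mulr_ge0 // ?(ltW t0) //; lra.
    by nra.
  - have : (1 - delta t / 2) * th t * m t <= (1 - delta t / 2) * th t * s.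
      by rewrite ler_wpM2l // mulr_ge0 // ?(ltW t0) //; lra.
    by nra.
exists f => t Pt; have := hf t Pt; have t0 := th0 t Pt.
rewrite /g /b /sg -mulr_sumr; case: (up t).
- by rewrite !mul1r ltr_pM2l //.
- by rewrite !mulN1r !mulNr ltrN2 ltr_pM2l.
Qed.

(** * Matchings and disjoint representatives *)

Section Hall.
Local Open Scope nat_scope.

Definition rel_nbrs (T U : finType) (r : T -> U -> bool) (B : {set U}) (S : {set T}) :=
  [set b in B | [exists a in S, r a b]].

(** Induction on [#|A|], splitting at a tight set if there is one. The values lie in [option U]
    because [U] may be empty. *)
Lemma hall (T U : finType) (r : T -> U -> bool) (A : {set T}) (B : {set U}) :
  (forall S : {set T}, S \subset A -> #|S| <= #|rel_nbrs r B S|) ->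
  exists m : T -> option U,
    {in A &, injective m} /\
    forall a, a \in A -> exists b, [/\ m a = Some b, b \in B & r a b].
Proof.
have [k] := ubnP #|A|; elim: k A B => // k IH A B hk hall.
have [->|[a aA]] := set_0Vmem A.
  by exists (fun _ => None); split=> x; rewrite inE.
have nbrsU S1 S2 : rel_nbrs r B (S1 :|: S2) \subset rel_nbrs r B S1 :|: rel_nbrs r B S2.
  apply/subsetP=> b; rewrite !inE => /andP[-> /existsP[x /andP[]]].
  rewrite inE => /orP[] hx hr; apply/orP; [left|right];
    by apply/existsP; exists x; rewrite hx.
case: (boolP [exists S : {set T}, [&& S \subset A, S != A, S != set0 &
   #|rel_nbrs r B S| <= #|S|]]).
(* [S] is matched inside its own neighbourhood and [A :\: S] outside it; tightness of [S] preserves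
   Hall's condition for the second part. *)
- case/existsP=> S /and4P[SA SnA Sn0 tight].
  have SpA : S \proper A by rewrite properEneq SnA.
  have cS : #|S| < k by apply: leq_trans (proper_card SpA) _; rewrite -ltnS.
  have cD : #|A :\: S| < k.
    have := cardsID S A; rewrite (setIidPr SA) => e.
    have : 0 < #|S| by rewrite card_gt0.
    by move: hk; rewrite -e ltnS => h1 h2; apply: leq_trans h1; rewrite -addn1 addnC leq_add2r.
  have [m1 [inj1 h1]] : exists m : T -> option U,
    {in S &, injective m} /\
    forall a, a \in S -> exists b, [/\ m a = Some b, b \in rel_nbrs r B S & r a b].
    apply: IH => // S' S'S; apply: leq_trans (hall S' (subset_trans S'S SA)) _.
    apply/subset_leq_card/subsetP=> b; rewrite !inE => /andP[-> /existsP[x /andP[xS' hr]]] /=.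
    have e : [exists a0 in S', r a0 b] by apply/existsP; exists x; rewrite xS'.
    by rewrite e andbT; apply/existsP; exists x; rewrite (subsetP S'S).
  have [m2 [inj2 h2]] : exists m : T -> option U,
    {in A :\: S &, injective m} /\
    forall a, a \in A :\: S -> exists b, [/\ m a = Some b, b \in B :\: rel_nbrs r B S & r a b].
    apply: IH => // S' S'S.
    have dis : [disjoint S & S'].
      rewrite disjoint_sym; apply: disjointWl S'S _.
      by rewrite -setI_eq0; apply/eqP/setP=> x; rewrite !inE; case: (x \in S); rewrite ?andbF.
    have : #|S :|: S'| <= #|rel_nbrs r B (S :|: S')|.
      by apply: hall; rewrite subUset SA (subset_trans S'S (subsetDl _ _)).
    rewrite cardsU (disjoint_setI0 dis) cards0 subn0 => hh.
    rewrite -(leq_add2l #|S|); apply: leq_trans hh _.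
    have := subset_leq_card (nbrsU S S') => hh; apply: leq_trans hh _.
    apply: (@leq_trans #|rel_nbrs r B S :|: rel_nbrs r (B :\: rel_nbrs r B S) S'|).
      apply/subset_leq_card/subsetP=> b; rewrite !inE.
      by case: (b \in B) => //=; case: [exists a0 in S, r a0 b] => //=.
    by apply: leq_trans (leq_card_setU _ _) _; rewrite leq_add2r.
  exists (fun x => if x \in S then m1 x else m2 x); split.
  + move=> x y xA yA; case: ifP => xS; case: ifP => yS.
    * exact: inj1.
    * have [b [-> b1 _]] := h1 x xS.
      have yD : y \in A :\: S by rewrite inE yS.
      have [b' [-> b2 _]] := h2 y yD.
      by case=> e; move: b2; rewrite -e inE b1.
    * have [b [-> b1 _]] := h1 y yS.
      have xD : x \in A :\: S by rewrite inE xS.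
      have [b' [-> b2 _]] := h2 x xD.
      by case=> e; move: b2; rewrite e inE b1.
    * by apply: inj2; rewrite inE ?xS ?yS.
  + move=> x xA; case: ifP => xS.
    * have [b [-> b1 hr]] := h1 x xS; exists b; split=> //.
      by move: b1; rewrite inE => /andP[].
    * have xD : x \in A :\: S by rewrite inE xS.
      have [b [-> b1 hr]] := h2 x xD; exists b; split=> //.
      by move: b1; rewrite inE => /andP[].
(* Every nonempty proper subset has a neighbour to spare, so [a] may take any partner [b]: deleting
   [b] costs a set at most one neighbour. *)
- move=> /existsPn slack.
  have [b] : exists b, b \in rel_nbrs r B [set a].
    apply/set0Pn; rewrite -card_gt0; apply: leq_trans (hall [set a] _).
      by rewrite cards1.
    by rewrite sub1set.
  rewrite inE => /andP[bB /existsP[a' /andP[]]]; rewrite inE => /eqP-> rab.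
  have cA : #|A :\ a| < k by move: hk; rewrite (cardsD1 a A) aA ltnS.
  have [m [inj h]] : exists m : T -> option U,
    {in A :\ a &, injective m} /\
    forall x, x \in A :\ a -> exists b', [/\ m x = Some b', b' \in B :\ b & r x b'].
    apply: IH => // S SA.
    have [->|Sn0] := eqVneq S set0; first by rewrite cards0.
    have SA' := subset_trans SA (subsetDl _ _).
    have SnA : S != A.
      by apply/eqP=> e; move: SA; rewrite e => /subsetP/(_ _ aA); rewrite !inE eqxx.
    have := slack S; rewrite SA' SnA Sn0 /= -ltnNge => hh.
    rewrite -ltnS; apply: leq_trans hh _.
    apply: (@leq_trans #|b |: rel_nbrs r (B :\ b) S|); last first.
      by rewrite cardsU1; case: (_ \notin _) => //=; rewrite add0n.
    apply/subset_leq_card/subsetP=> c; rewrite !inE.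
    by case: eqP.
  exists (fun x => if x == a then Some b else m x); split.
  + move=> x y xA yA; case: eqP => [->|/eqP xa]; case: eqP => [->|/eqP ya] //.
    * have yD : y \in A :\ a by rewrite !inE ya.
      have [b' [-> b2 _]] := h y yD.
      by case=> e; move: b2; rewrite e !inE eqxx.
    * have xD : x \in A :\ a by rewrite !inE xa.
      have [b' [-> b2 _]] := h x xD.
      by case=> e; move: b2; rewrite e !inE eqxx.
    * by apply: inj; rewrite !inE ?xa ?ya.
  + move=> x xA; case: eqP => [->|/eqP xa]; first by exists b.
    have xD : x \in A :\ a by rewrite !inE xa.
    have [b' [-> b2 hr]] := h x xD; exists b'; split=> //.
    by move: b2; rewrite inE => /andP[].
Qed.

(** Add [k] dummy partners related to everything, apply [hall], and discard the elements matched to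
    dummies. *)
Lemma hall_deficient (T U : finType) (r : T -> U -> bool) (A : {set T})
    (B : {set U}) (k : nat) :
  (forall S : {set T}, S \subset A -> #|S| <= #|rel_nbrs r B S| + k) ->
  exists (D : {set T}) (m : T -> option U),
    [/\ D \subset A, #|A :\: D| <= k, {in D &, injective m} &
    forall a, a \in D -> exists b, [/\ m a = Some b, b \in B & r a b]].
Proof.
move=> hk.
pose r' (a : T) (b : U + 'I_k) := if b is inl u then r a u else true.
pose B' : {set U + 'I_k} := [set b | if b is inl u then u \in B else true].
have [m [inj hm]] : exists m : T -> option (U + 'I_k),
    {in A &, injective m} /\
    forall a, a \in A -> exists b, [/\ m a = Some b, b \in B' & r' a b].
  apply: hall => S SA; have [->|[a aS]] := set_0Vmem S; first by rewrite cards0.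
  apply: leq_trans (hk S SA) _.
  rewrite -[X in _ + X]card_ord -(card_imset (mem (rel_nbrs r B S)) (@inl_inj U 'I_k)).
  rewrite -(card_imset (mem 'I_k) (@inr_inj U 'I_k)).
  set I1 := imset _ _; set I2 := imset _ _.
  have -> : #|I1| + #|I2| = #|I1 :|: I2|.
    rewrite cardsU disjoint_setI0 ?cards0 ?subn0 //.
    rewrite -setI_eq0; apply/eqP/setP=> x; rewrite !inE.
    by apply/negP=> /andP[/imsetP[u _ ->] /imsetP[i _]].
  apply/subset_leq_card/subsetP=> x; rewrite inE => /orP[]/imsetP[u hu ->].
  - move: hu; rewrite !inE => /andP[-> /existsP[c /andP[cS hr]]] /=.
    by apply/existsP; exists c; rewrite cS.
  - by rewrite !inE /=; apply/existsP; exists a; rewrite aS.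
pose D := [set a in A | if m a is Some (inl _) then true else false].
exists D, (fun a => if m a is Some (inl u) then Some u else None); split.
- by apply/subsetP=> a; rewrite inE => /andP[].
- have [i0|] := pickP 'I_k; last first.
    move=> no; suff -> : A :\: D = set0 by rewrite cards0.
    apply/setP=> a; rewrite !inE; apply/negP=> /andP[h aA].
    have [b [e _ _]] := hm a aA; move: h; rewrite aA e; case: b {e} => //= i.
    by have := no i.
  move=> _; rewrite -[X in _ <= X]card_ord.
  pose g a := if m a is Some (inr i) then i else i0.
  rewrite -(@card_in_imset _ _ g); first exact: max_card.
  move=> x y; rewrite !inE => /andP[hx xA] /andP[hy yA].
  have [b [e _ _]] := hm x xA; have [b' [e' _ _]] := hm y yA.
  move: hx hy; rewrite xA yA /g e e'.
  case: b e => // i e; case: b' e' => // j e' _ _ ij.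
  by apply: inj => //; rewrite e e' ij.
- move=> x y; rewrite !inE => /andP[xA +] /andP[yA +].
  case ex : (m x) => [[u|]|] // _; case ey: (m y) => [[v|]|] // _ [uv].
  by apply: inj => //; rewrite ex ey uv.
- move=> a; rewrite inE => /andP[aA +].
  case ex : (m a) => [[u|]|] // _; exists u.
  by have [b [e h1 h2]] := hm a aA; move: e h1 h2; rewrite ex => -[<-]; rewrite inE.
Qed.
End Hall.

(** * Haxell's theorem by alternating trees *)

Section DisjointRepresentatives.
Local Open Scope nat_scope.
Variables (I V : finType) (h : I -> {set V} -> Prop) (l : nat).
Hypothesis robust : forall (J : {set I}) (Z : {set V}), J != set0 ->
  #|Z| <= 2 * l * #|J| ->
  exists i e, [/\ i \in J, h i e, #|e| <= l & [disjoint e & Z]].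

Definition partial_reps (D : {set I}) (E : I -> {set V}) :=
  (forall b, b \in D -> h b (E b) /\ #|E b| <= l) /\
  (forall b b', b \in D -> b' \in D -> b != b' -> [disjoint E b & E b']).

(** [J] and [Z] are the indices and vertices of the tree grown so far. A set [e] obtained from
    [robust] may meet current representatives; the tree is then enlarged by these, and the recursive
    call frees a set for one of its indices. If that index is not in [J], it gives up its
    representative for the freed set, which avoids [e]. The outer induction is on the indices
    outside the tree, the inner one on the representatives that meet [e]. Changed representatives
    avoid the enlarged [Z], which contains [e], so no new conflict arises. *)
Lemma alternating_tree (D : {set I}) (E : I -> {set V}) (J : {set I}) (Z : {set V}) :
  partial_reps D E -> J != set0 -> #|Z| <= 2 * l * #|J| ->
  (forall b, b \in J :&: D -> E b \subset Z) ->
  exists E' a e, [/\ partial_reps D E',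
    forall b, b \in J :&: D -> E' b = E b,
    forall b, b \in D -> E' b = E b \/ [disjoint E' b & Z],
    [/\ a \in J, h a e, #|e| <= l & [disjoint e & Z]] &
    forall b, b \in D -> [disjoint e & E' b]].
Proof.
have [k] := ubnP #|D :\: J|; elim: k D E J Z => // k IHk D E J Z hk hE J0 hZ hJ.
have [a [e [aJ ha el eZ]]] := robust J0 hZ.
pose hits (E0 : I -> {set V}) := [set b in D | ~~ [disjoint e & E0 b]].
suff main : forall q (E1 : I -> {set V}), #|hits E1| < q -> partial_reps D E1 ->
    (forall b, b \in J :&: D -> E1 b = E b) ->
    (forall b, b \in D -> E1 b = E b \/ [disjoint E1 b & Z]) ->
  exists E' a e, [/\ partial_reps D E',
    forall b, b \in J :&: D -> E' b = E b,
    forall b, b \in D -> E' b = E b \/ [disjoint E' b & Z],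
    [/\ a \in J, h a e, #|e| <= l & [disjoint e & Z]] &
    forall b, b \in D -> [disjoint e & E' b]].
  by apply: (main #|hits E|.+1 E) => // b _; left.
elim=> // q IHq E1 hq hE1 agree fresh.
have [H0|H0] := eqVneq (hits E1) set0.
  exists E1, a, e; split=> // b bD.
  case: (boolP [disjoint e & E1 b]) => // hb.
  have : b \in hits E1 by rewrite inE bD.
  by rewrite H0 inE.
have HD : hits E1 \subset D by apply/subsetP=> b; rewrite inE => /andP[].
have HJ : [disjoint hits E1 & J].
  rewrite -setI_eq0; apply/eqP/setP=> b; rewrite !inE.
  apply/negP=> /andP[/andP[bD hb] bJ]; move: hb.
  have bJD : b \in J :&: D by rewrite inE bJ.
  by rewrite (agree b bJD) (disjointWr (hJ b bJD) eZ).
pose J2 := J :|: hits E1.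
pose Z2 := Z :|: e :|: \bigcup_(b in hits E1) E1 b.
have cJ2 : #|J2| = #|J| + #|hits E1|.
  by rewrite cardsU setIC (disjoint_setI0 HJ) cards0 subn0.
have cH : 0 < #|hits E1| by rewrite card_gt0.
have cB : #|\bigcup_(b in hits E1) E1 b| <= l * #|hits E1|.
  rewrite mulnC -sum_nat_const.
  have : forall A : {set I}, A \subset D -> #|\bigcup_(b in A) E1 b| <= \sum_(b in A) l.
    move=> A AD; apply: (@leq_trans (\sum_(b in A) #|E1 b|)).
      elim/big_rec2: _ => [|b n S _ hS]; first by rewrite cards0.
      by apply: leq_trans (leq_card_setU _ _) _; rewrite leq_add2l.
    by apply: leq_sum => b bA; have [_ ] := hE1.1 b (subsetP AD b bA).
  exact.
have J20 : J2 != set0.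
  by rewrite -card_gt0 cJ2 addn_gt0 cH orbT.
(* The set [e] costs [l], and so does each representative it hits. As there is at least one hit,
   this is at most [2 * l] per new index, whence the factor 2 in [robust]. *)
have hZ2 : #|Z2| <= 2 * l * #|J2|.
  rewrite cJ2 mulnDr; apply: leq_trans (leq_card_setU _ _) _.
  apply: leq_trans (leq_add (leq_card_setU _ _) (leqnn _)) _.
  rewrite -addnA; apply: leq_add => //.
  apply: leq_trans (leq_add el cB) _.
  by rewrite -mulnA mul2n -addnn leq_add2r leq_pmulr.
have kJ2 : #|D :\: J2| < k.
  rewrite -ltnS; apply: leq_trans hk; apply: proper_card.
  apply/properP; split.
    by apply/subsetP=> x; rewrite !inE negb_or => /andP[/andP[-> _] ->].
  have /set0Pn[b hb] := H0; exists b.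
    by rewrite inE (subsetP HD) // andbT (disjointFr HJ).
  by rewrite in_setD in_setU hb orbT.
have hJ2 : forall b, b \in J2 :&: D -> E1 b \subset Z2.
  move=> b; rewrite inE => /andP[+ bD]; rewrite in_setU => /orP[bJ|bH].
    have bJD : b \in J :&: D by rewrite inE bJ.
    by rewrite /Z2 -setUA; apply: subset_trans (subsetUl _ _); rewrite agree ?hJ.
  by apply: subset_trans (subsetUr _ _); apply: bigcup_sup.
have [E2 [a2 [e2 [hE2 agree2 fresh2 [a2J2 ha2 e2l e2Z] e2E]]]] :=
  IHk D E1 J2 Z2 kJ2 hE1 J20 hZ2 hJ2.
have ZZ2 : Z \subset Z2 by rewrite /Z2 -setUA subsetUl.
have eZ2 : e \subset Z2 by rewrite /Z2 setUAC subsetUr.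
have agreeJ b : b \in J :&: D -> E2 b = E b.
  move=> hb; rewrite agree2 ?agree //.
  by move: hb; rewrite !inE => /andP[-> ->].
have freshZ b : b \in D -> E2 b = E b \/ [disjoint E2 b & Z].
  move=> bD; case: (fresh2 b bD) => [->|hd]; first exact: fresh.
  by right; apply: disjointWr hd.
case: (boolP (a2 \in J)) => a2J.
  exists E2, a2, e2; split=> //; split=> //; exact: disjointWr e2Z.
have a2H : a2 \in hits E1 by move: a2J2; rewrite in_setU (negPf a2J).
have a2D : a2 \in D := subsetP HD a2 a2H.
(* [a2] gives up a representative met by [e] and takes [e2], which avoids [Z2] and hence [e]: one
   conflict less. *)
pose E3 b := if b == a2 then e2 else E2 b.
apply: (IHq E3).
- rewrite -ltnS; apply: leq_trans hq; apply: proper_card; apply/properP; split.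
    apply/subsetP=> b; rewrite inE => /andP[bD]; rewrite /E3.
    case: eqP => [->|_ hb]; first by rewrite disjoint_sym (disjointWr eZ2 e2Z).
    case: (fresh2 b bD) => e12; last by rewrite disjoint_sym (disjointWr eZ2 e12) in hb.
    by rewrite inE bD -e12.
  exists a2 => //; rewrite inE /E3 eqxx negb_and negbK.
  by rewrite disjoint_sym (disjointWr eZ2 e2Z) orbT.
- split.
    move=> b bD; rewrite /E3; case: eqP => [->//|_]; exact: hE2.1.
  move=> b b' bD b'D bb'; rewrite /E3; case: eqP => [eb|/eqP nb]; case: eqP => [eb'|/eqP nb'].
  + by rewrite eb eb' eqxx in bb'.
  + exact: e2E.
  + by rewrite disjoint_sym e2E.
  + exact: hE2.2.
- move=> b hb; rewrite /E3; case: eqP => [eb|_]; last exact: agreeJ.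
  by move: hb; rewrite inE eb (negPf a2J).
- move=> b bD; rewrite /E3; case: eqP => [_|_]; last exact: freshZ.
  by right; apply: disjointWr e2Z.
Qed.

(** Indices are added one at a time, with a tree that starts from the new index alone and an empty
    [Z]; the freed set then belongs to this index. *)
Lemma disjoint_representatives :
  exists E : I -> {set V}, (forall i, h i (E i)) /\
    (forall i j, i != j -> [disjoint E i & E j]).
Proof.
suff [E [h1 h2]] : exists E, partial_reps [set: I] E.
  exists E; split=> [i|i j ij]; first by have [] := h1 i (in_setT _).
  by apply: h2.
suff main n : n <= #|I| -> exists (D : {set I}) E, #|D| = n /\ partial_reps D E.
  have [D [E [cD hE]]] := main _ (leqnn _).
  have e : D = [set: I] by apply/eqP; rewrite eqEcard subsetT cardsT cD leqnn.
  by exists E; rewrite -e.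
elim: n => [|n IH] hn.
  by exists set0, (fun _ => set0); split; [rewrite cards0|split=> b; rewrite inE].
have [D [E [cD hE]]] := IH (ltnW hn).
have [i iD] : exists i, i \notin D.
  have : 0 < #|~: D| by rewrite -(ltn_add2l #|D|) cardsC addn0 cD.
  by rewrite card_gt0 => /set0Pn[i]; rewrite inE; exists i.
have J0 : [set i] != set0 by apply/set0Pn; exists i; rewrite inE.
have hJ : forall b, b \in [set i] :&: D -> E b \subset set0.
  by move=> b; rewrite !inE => /andP[/eqP-> ]; rewrite (negPf iD).
have c0 : #|@set0 V| <= 2 * l * #|[set i]| by rewrite cards0.
have [E' [a [e [hE' _ _ [+ ha el _] dis]]]] := alternating_tree hE J0 c0 hJ.
rewrite inE => /eqP ai; rewrite {}ai in ha.
exists (i |: D), (fun b => if b == i then e else E' b); split.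
  by rewrite cardsU1 iD cD.
split.
  by move=> b; rewrite !inE; case: eqP => [->|_ /= bD] //; exact: hE'.1.
move=> b b'; rewrite !inE; case: eqP => [->|_]; case: eqP => [->|_] //=.
- by rewrite eqxx.
- by move=> _ /dis.
- by move=> /dis + _; rewrite disjoint_sym.
- exact: hE'.2.
Qed.
End DisjointRepresentatives.

(** * Reachability and random layers *)

Section Reach.
Variable H : sgraph.
Implicit Types (S X Z w : {set H}) (ws : seq {set H}).

Definition nbr (x : H) : {set H} := [set y | sedge x y].
Definition Nb S : {set H} := \bigcup_(x in S) nbr x.

Lemma NbP S y : reflect (exists2 x, x \in S & sedge x y) (y \in Nb S).
Proof.
apply: (iffP bigcupP) => -[x xS]; first by rewrite inE => h; exists x.
by move=> h; exists x => //; rewrite inE.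
Qed.

Lemma Nb1 x : Nb [set x] = nbr x.
Proof. by rewrite /Nb big_set1. Qed.

Lemma NbU S1 S2 : Nb (S1 :|: S2) = Nb S1 :|: Nb S2.
Proof. exact: bigcup_setU. Qed.

Lemma NbS S1 S2 : S1 \subset S2 -> Nb S1 \subset Nb S2.
Proof. by move/setUidPr <-; rewrite NbU subsetUl. Qed.

Lemma sum_deg_swap (A B : {set H}) :
  (\sum_(x in A) #|nbr x :&: B| = \sum_(y in B) #|nbr y :&: A|)%N.
Proof.
have e C D : (\sum_(x in C) #|nbr x :&: D| = \sum_(x in C) \sum_(y in D | sedge x y) 1)%N.
  apply: eq_bigr => x _; rewrite -sum1_card; apply: eq_bigl => y.
  by rewrite !inE andbC.
rewrite !e (exchange_big_dep (mem B)) //=; last by move=> x y _ /andP[].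
apply: eq_bigr => y yB; apply: eq_bigl => x; rewrite yB /=.
by rewrite sedge_sym.
Qed.

(* Vertices reached from [X] by paths whose internal vertices avoid [Z] and
   lie in sets of [ws], met in the order from the last set to the first, each
   set being used at most once. *)
Fixpoint reach ws X Z : {set H} :=
  if ws is w :: ws' then reach ws' X Z :|: Nb (reach ws' X Z :&: w :\: Z)
  else Nb X.

(** Additivity in the source is what allows a source set to be halved repeatedly until one vertex is
    left. *)
Lemma reachU ws X1 X2 Z :
  reach ws (X1 :|: X2) Z = reach ws X1 Z :|: reach ws X2 Z.
Proof.
elim: ws => [|w ws IH] /=; first exact: NbU.
by rewrite IH setIUl setDUl NbU setUACA.
Qed.

Lemma reach0 ws Z : reach ws set0 Z = set0.
Proof.
have N0 : Nb set0 = set0 by rewrite /Nb big_set0.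
by elim: ws => [|w ws IH] /=; rewrite ?IH ?set0I ?set0D N0 ?setU0.
Qed.

Lemma reach_cat ws1 ws2 X Z : reach ws2 X Z \subset reach (ws1 ++ ws2) X Z.
Proof.
by elim: ws1 => //= w ws1 IH; apply: subset_trans (subsetUl _ _).
Qed.

Lemma reach_path ws x Z v : v \in reach ws [set x] Z ->
  exists q, [/\ path (@sedge H) x (rcons q v), (size q <= size ws)%N &
    forall u, u \in q -> u \notin Z /\ exists2 w, w \in ws & u \in w].
Proof.
elim: ws v => [|w ws IH] v /=.
  by rewrite Nb1 inE => h; exists [::]; split=> //=; rewrite h.
rewrite inE => /orP[/IH[q [hp hs hq]]|/NbP[u]].
  exists q; split=> //; first exact: leqW.
  move=> u /hq[uZ [w' w'ws uw']]; split=> //; exists w' => //.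
  by rewrite inE w'ws orbT.
rewrite !inE => /andP[uZ /andP[/IH[q [hp hs hq]] uw]] huv.
exists (rcons q u); split.
- by rewrite rcons_path last_rcons hp.
- by rewrite size_rcons.
- move=> y; rewrite mem_rcons inE => /orP[/eqP->|/hq[yZ [w' w'ws yw']]].
    by split=> //; exists w => //; rewrite inE eqxx.
  by split=> //; exists w' => //; rewrite inE w'ws orbT.
Qed.

(** The walk from [x] to [v] is continued by the reverse of the walk from [y] to [v], and loops are
    erased. Because of [x != y] the shortened walk is not empty and its last vertex [y] can be split
    off. *)
Lemma reach_link ws x y Z v (A : {set H}) : x != y ->
  v \in reach ws [set x] Z -> v \in reach ws [set y] Z ->
  v \in A :\: Z -> (forall w, w \in ws -> w \subset A) ->
  exists q, [/\ path (@sedge H) x (rcons q y), uniq (x :: rcons q y),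
    (size q <= (size ws).*2.+1)%N & {subset q <= A :\: Z}].
Proof.
move=> xy /reach_path[q1 [p1 s1 h1]] /reach_path[q2 [p2 s2 h2]] vA hA.
have hq (q0 : seq H) : (forall u, u \in q0 -> u \notin Z /\ exists2 w, w \in ws & u \in w) ->
    {subset q0 <= A :\: Z}.
  move=> h u /h[uZ [w wws uw]]; rewrite inE uZ; exact: (subsetP (hA w wws)).
pose p := rcons q1 v ++ rcons (rev q2) y.
have pp : path (@sedge H) x p.
  rewrite cat_path p1 last_rcons /=.
  have := rev_path (@sedge H) y (rcons q2 v).
  rewrite last_rcons belast_rcons rev_cons => e.
  rewrite e (@eq_path _ _ (@sedge H)) //.
  by move=> a b /=; rewrite sedge_sym.
have lp : last x p = y by rewrite last_cat last_rcons.
have sp : size p = (size q1 + size q2).+2.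
  by rewrite size_cat !size_rcons size_rev addSn addnS.
have subp u : u \in p -> u = y \/ u \in A :\: Z.
  rewrite mem_cat !mem_rcons !inE mem_rev => /orP[/orP[/eqP->|h]|/orP[/eqP->|h]].
  - by right; move: vA; rewrite !inE.
  - by right; have := hq _ h1 u h; rewrite inE.
  - by left.
  - by right; have := hq _ h2 u h; rewrite inE.
have : (size (shorten x p) <= size p)%N.
  have [u_ s_] : uniq (shorten x p) /\ {subset shorten x p <= p}.
    by case: (shortenP pp) => p' _ /= /andP[_ ? ] ?.
  exact: uniq_leq_size.
move: lp subp; case: (shortenP pp) => p' pp' up' sub' lp' subp sz.
case/lastP: p' pp' up' sub' lp' sz => [|q z] pp' up' sub' lp' sz.
  by move: xy; rewrite -lp' eqxx.
move: lp'; rewrite last_rcons => ez; subst z.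
exists q; split=> //.
- move: sz; rewrite size_rcons sp ltnS => sz; apply: leq_trans sz _.
  by rewrite ltnS -addnn leq_add.
- move=> u uq; have uy : u != y.
    by apply: contraTneq up' => <-; rewrite /= rcons_uniq uq andbF.
  have : u \in p by apply: sub'; rewrite mem_rcons inE uq orbT.
  by move/subp => [e|//]; rewrite e eqxx in uy.
Qed.
End Reach.

(** Evaluates the union bound over pairs of vertex sets. *)
Lemma sum_subset_expr (R : realType) (V : finType) (y : R) :
  \sum_(X : {set V}) y ^+ #|X| = (1 + y) ^+ #|V|.
Proof.
have -> : (1 + y) ^+ #|V| = \prod_(v : V) (y + 1) by rewrite prodr_const addrC.
rewrite bigA_distr; apply: eq_bigr => X _.
rewrite (bigID (mem X)) /= [X in _ = _ * X]big1 ?mulr1 => [|i /negPf->] //.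
rewrite (eq_bigr (fun=> y)) => [|i ->] //.
by rewrite prodr_const.
Qed.

(** * A random set through which all large sets expand *)

Section Layers.
Variables (R : realType) (H : sgraph) (d s beta lam : R).
Let n := #|H|.
Let zeta := s / (8 * d).
Hypothesis d0 : 0 < d.
Hypothesis s0 : 0 < s.
Hypothesis n0 : (0 < n)%N.
Hypothesis hdeg : forall v : H, #|nbr v|%:R <= d.
Hypothesis hexp : forall U : {set H}, (1 <= #|U|)%N ->
  #|U|%:R <= 2 / 3 * n%:R :> R ->
  s * #|U|%:R <= (\sum_(u in U) #|nbr u :\: U|)%N%:R.
Hypothesis hbeta : 0 < beta <= 1.
Hypothesis hlam : 1 <= 4 * zeta * lam.
Hypothesis hdegsum : n%:R * expR (- (beta * d / 8)) < 1 / 2.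
Hypothesis hunion : expR (- (beta * zeta * lam / 8)) <= 1 / (8 * n%:R).

(** Each vertex enters [W] with probability [beta]. For [U = rr X Z], more than
    [beta * s * #|U| / 4] edges leave [U] from [U :&: W :\: Z], except with probability
    [expR (- (beta * zeta * #|U| / 8))], which is summable over all pairs since [#|U|] is large
    compared with [#|X| + #|Z| + 1]. A vertex outside [U] absorbs at most [2 * beta * d] of these
    edges. As [rr] is arbitrary, it can describe reachability through sets drawn earlier. *)
Lemma expanding_layer (rr : {set H} -> {set H} -> {set H}) :
  exists W : {set H},
    (forall v, #|nbr v :&: W|%:R <= 2 * beta * d) /\
    forall X Z : {set H}, (1 <= #|rr X Z|)%N ->
      #|rr X Z|%:R <= 2 / 3 * n%:R :> R ->
      lam * (#|X| + #|Z| + 1)%N%:R <= #|rr X Z|%:R ->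
      (1 + zeta) * #|rr X Z|%:R <=
        #|rr X Z :|: Nb (rr X Z :&: W :\: Z)|%:R.
Proof.
have [b0 b1] := andP hbeta.
have z0 : 0 < zeta by rewrite divr_gt0 // mulr_gt0.
have sE : s = 8 * d * zeta by rewrite /zeta; field; rewrite lt0r_neq0.
(* The left summand indexes the upper bounds on degrees into [W], the right one the lower bounds on
   edges leaving [rr X Z]. *)
pose T : finType := (H + {set H} * {set H})%type.
pose good (p : {set H} * {set H}) := [&& (1 <= #|rr p.1 p.2|)%N,
  #|rr p.1 p.2|%:R <= 2 / 3 * n%:R :> R &
  lam * (#|p.1| + #|p.2| + 1)%N%:R <= #|rr p.1 p.2|%:R].
pose P (t : T) := if t is inr p then good p else true.
pose up (t : T) := if t is inl _ then true else false.
pose a (t : T) (v : H) (b : bool) : R :=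
  match t with
  | inl u => if b && (v \in nbr u) then 1 else 0
  | inr p => if b && (v \in rr p.1 p.2 :\: p.2) then #|nbr v :\: rr p.1 p.2|%:R else 0
  end.
pose M (t : T) : R := if t is inl _ then 1 else d.
pose m (t : T) : R := if t is inr p then beta * (s * #|rr p.1 p.2|%:R / 2) else beta * d.
pose delta (t : T) : R := if t is inl _ then 1 else 1 / 2.
pose mu (v : H) (b : bool) : R := if b then beta else 1 - beta.
have mean t v : \sum_l mu v l * a t v l = beta * a t v true.
  by rewrite big_bool /= /a; case: t => *; rewrite /= mulr0 addr0.
(* At most [d * #|Z|] edges start in [Z], and by [hlam] this is at most half of [s * #|U|]. *)
have outdeg (X Z : {set H}) : good (X, Z) ->
    s * #|rr X Z|%:R / 2 <= (\sum_(u in rr X Z :\: Z) #|nbr u :\: rr X Z|)%N%:R.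
  rewrite /good /=; set U := rr X Z => /and3P[h1 h2 h3].
  have z04 : 0 <= 4 * zeta by rewrite mulr_ge0 // ltW.
  have := hexp h1 h2; rewrite (big_setID Z) /= natrD => h4.
  have : (\sum_(i in U :&: Z) #|nbr i :\: U|)%N%:R <= d * #|Z|%:R.
    rewrite natr_sum; apply: (@le_trans _ _ (\sum_(i in U :&: Z) d)).
      apply: ler_sum => i _; apply: le_trans (hdeg i).
      by rewrite ler_nat subset_leq_card // subsetDl.
    rewrite sumr_const -[leLHS]mulr_natr ler_wpM2l ?(ltW d0) // ler_nat.
    by rewrite subset_leq_card // subsetIr.
  have : d * #|Z|%:R <= 4 * d * zeta * #|U|%:R.
    have hz : #|Z|%:R <= 4 * zeta * #|U|%:R :> R.
      apply: (@le_trans _ _ (4 * zeta * (lam * (#|X| + #|Z| + 1)%N%:R))); last first.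
        by rewrite ler_wpM2l.
      rewrite mulrA; apply: (@le_trans _ _ (1 * (#|X| + #|Z| + 1)%N%:R)).
        by rewrite mul1r ler_nat addnAC leq_addl.
      by rewrite ler_wpM2r.
    by have := ler_wpM2l (ltW d0) hz; rewrite !mulrA [d * 4]mulrC.
  rewrite sE in h4 *; lra.
have [|||||f hf] := @exists_concentrated R H bool T P mu up a M m delta.
- by move=> v []; rewrite /mu; lra.
- by move=> v; rewrite big_bool /= /mu; lra.
- case=> [u|p] hP; split=> //=; rewrite /M /delta; try lra.
  + by move=> v l; case: ifP; lra.
  + move=> v l; case: ifP => _; rewrite ?ler0n ?lexx ?(ltW d0) //=.
    by apply: le_trans (hdeg v); rewrite ler_nat subset_leq_card // subsetDl.
- move=> t Pt; under eq_bigr => v _ do rewrite mean.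
  rewrite -mulr_sumr; case: t Pt => [u _|[X Z] hg] /=; rewrite ler_wpM2l ?(ltW b0) //.
  + rewrite -big_mkcond /= sumr_const; apply: le_trans (hdeg u).
    by rewrite ler_nat subset_leq_card //; apply/subsetP=> x.
  + rewrite -big_mkcond /= -natr_sum; exact: outdeg.
(* The degree events cost less than 1/2 by [hdegsum]. The pairs cost at most
   [y * (1 + y) ^+ (2 * n)], which is at most 1/2 because [y <= 1 / (8 * n)]. *)
- rewrite big_sumType /=.
  have -> : \sum_(i : H) expR (- (1 ^+ 2 * (beta * d) / (8 * 1))) =
      n%:R * expR (- (beta * d / 8)).
    by rewrite sumr_const expr1n mul1r mulr1 -[LHS]mulr_natl.
  pose y := expR (- (beta * zeta * lam / 8)).
  have hy : y <= 1 / (8 * n%:R) by exact: hunion.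
  have y0 : 0 < y by exact: expR_gt0.
  suff : \sum_(i | good i) expR (- ((1 / 2) ^+ 2 *
      (beta * (s * #|rr i.1 i.2|%:R / 2)) / (8 * d))) <= 1 / 2.
    by move=> hh; rewrite [X in _ < X](_ : 1 = 1 / 2 + 1 / 2); [exact: ltr_leD|lra].
  apply: (@le_trans _ _ (\sum_(i : {set H} * {set H}) y * (y ^+ #|i.1| * y ^+ #|i.2|))).
    rewrite big_mkcond /=; apply: ler_sum => -[X Z] _ /=; case: ifP => hg; last first.
      by rewrite !mulr_ge0 // ?exprn_ge0 // ltW.
    rewrite -exprD -exprS -expRM_natl ler_expR.
    move: hg => /and3P[_ _ /= h3].
    have -> : (1 / 2) ^+ 2 * (beta * (s * #|rr X Z|%:R / 2)) / (8 * d) =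
       (beta * zeta / 8) * #|rr X Z|%:R by rewrite sE; field; rewrite lt0r_neq0.
    have hbz : 0 <= beta * zeta / 8 by rewrite divr_ge0 // mulr_ge0 // ltW.
    have := ler_wpM2l hbz h3; rewrite addn1; lra.
  rewrite -(pair_big xpredT xpredT (fun X Z : {set H} => y * (y ^+ #|X| * y ^+ #|Z|))) /=.
  have -> : \sum_(i : {set H}) \sum_(j : {set H}) y * (y ^+ #|i| * y ^+ #|j|) =
     y * ((1 + y) ^+ n * (1 + y) ^+ n).
    rewrite -!sum_subset_expr mulr_suml mulr_sumr; apply: eq_bigr => X _.
    by rewrite !mulr_sumr.
  have nR : 1 <= n%:R :> R by rewrite ler1n.
  have yn : n%:R * y <= 1 / 8.
    have := ler_wpM2l (ltW (lt_le_trans ltr01 nR)) hy.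
    by rewrite [X in _ <= X](_ : _ = 1 / 8) //; field; lra.
  have py : (1 + y) ^+ n <= expR (1 / 8).
    apply: (@le_trans _ _ (expR y ^+ n)).
      by apply: lerXn2r; rewrite ?nnegrE ?expR_ge0 ?expR_ge1Dx //; lra.
    by rewrite -expRM_natl ler_expR.
  have e8 : expR (1 / 8) <= 1 + 1 / 8 + 2 * (1 / 8) ^+ 2 :> R by apply: expR_quad; lra.
  have p0 : 0 <= (1 + y) ^+ n by rewrite exprn_ge0 //; lra.
  have p2 : (1 + y) ^+ n <= 5 / 4 by apply: le_trans py _; apply: le_trans e8 _; lra.
  have pp : (1 + y) ^+ n * (1 + y) ^+ n <= 5 / 4 * (5 / 4) by apply: ler_pM.
  have y8 : y <= 1 / 8 by nra.
  have pp0 : 0 <= (1 + y) ^+ n * (1 + y) ^+ n by rewrite mulr_ge0.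
  by nra.
pose W := [set v | f v]; exists W.
have hW1 v : #|nbr v :&: W|%:R <= 2 * beta * d.
  have := hf (inl v) isT; rewrite /= => /ltW.
  rewrite -big_mkcond /= sumr_const => h; apply: le_trans (_ : (1 + 1) * (beta * d) <= _); last lra.
  apply: le_trans h; rewrite ler_nat subset_leq_card //.
  by apply/subsetP=> x; rewrite !inE => /andP[e1 e2]; rewrite unfold_in /= inE e1 e2.
split=> // X Z h1 h2 h3.
have hg : good (X, Z) by apply/and3P.
have := hf (inr (X, Z)) hg; rewrite /= -big_mkcond /=; set U := rr X Z.
rewrite -natr_sum => hS.
have eS : (\sum_(i | f i && (i \in U :\: Z)) #|nbr i :\: U| =
    \sum_(i in U :&: W :\: Z) #|nbr i :&: ~: U|)%N.
  apply: eq_big => i; last by move=> _; rewrite setDE.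
  by rewrite !inE andbC -andbA.
(* From here on the leaving edges are counted at their ends outside [U]. *)
rewrite eS sum_deg_swap in hS.
have hT : (\sum_(y in ~: U) #|nbr y :&: (U :&: W :\: Z)|)%N%:R <=
    #|Nb (U :&: W :\: Z) :\: U|%:R * (2 * beta * d).
  rewrite (bigID (mem (Nb (U :&: W :\: Z)))) /= [X in (_ + X)%N]big1; last first.
    move=> y /andP[_ hy]; apply/eqP; rewrite cards_eq0; apply/eqP/setP=> x.
    apply/negP; rewrite [in x \in set0]inE => hx; case/negP: hy; apply/NbP.
    by move: hx; rewrite in_setI inE => /andP[hyx hx]; exists x => //; rewrite sedge_sym.
  rewrite addn0 natr_sum -[leRHS]mulrC mulr_natr -sumr_const.
  rewrite [leRHS](eq_bigl (fun y => (y \in ~: U) && (y \in Nb (U :&: W :\: Z)))); last first.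
    by move=> y; rewrite !inE.
  apply: ler_sum => y _; apply: le_trans (hW1 y); rewrite ler_nat subset_leq_card //.
  by apply/subsetP=> x; rewrite !inE => /and4P[-> _ _ ->].
have -> : #|U :|: Nb (U :&: W :\: Z)|%:R = #|U|%:R + #|Nb (U :&: W :\: Z) :\: U|%:R :> R.
  set N := Nb _; have NU : (#|U :&: N| <= #|N|)%N by rewrite subset_leq_card ?subsetIr.
  by rewrite cardsU cardsD [N :&: U]setIC -addnBA // natrD.
rewrite mulrDl mul1r lerD2l.
have bd0 : 0 < 2 * beta * d by rewrite !mulr_gt0.
rewrite -(ler_pM2r bd0); apply: le_trans hT; apply: le_trans (ltW hS).
by rewrite sE; lra.
Qed.
End Layers.

(** * Disjoint links for many pairs through a sparse set *)

Section Connector.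
Variables (R : realType) (H : sgraph) (d s beta lam : R) (m a : nat).
Let n := #|H|.
Let zeta := s / (8 * d).
Hypothesis d0 : 0 < d.
Hypothesis s0 : 0 < s.
Hypothesis n0 : (3 <= n)%N.
Hypothesis hdeg : forall v : H, #|nbr v|%:R <= d.
Hypothesis hexp : forall U : {set H}, (1 <= #|U|)%N ->
  #|U|%:R <= 2 / 3 * n%:R :> R ->
  s * #|U|%:R <= (\sum_(u in U) #|nbr u :\: U|)%N%:R.
Hypothesis hbeta : 0 < beta <= 1.
Hypothesis hlam : 1 <= 4 * zeta * lam.
Hypothesis hdegsum : n%:R * expR (- (beta * d / 8)) < 1 / 2.
Hypothesis hunion : expR (- (beta * zeta * lam / 8)) <= 1 / (8 * n%:R).
Hypothesis hm : 1 <= m%:R * zeta.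
Hypothesis ha : (n <= 2 ^ a)%N.

(** The head is the set drawn last. Its expansion clause concerns what the tail already reaches, so
    every set is drawn for earlier ones that are fixed. *)
Fixpoint expanding_seq (ws : seq {set H}) : Prop :=
  if ws is w :: ws' then
    [/\ expanding_seq ws', forall v, #|nbr v :&: w|%:R <= 2 * beta * d &
     forall X Z : {set H}, (1 <= #|reach ws' X Z|)%N ->
      #|reach ws' X Z|%:R <= 2 / 3 * n%:R :> R ->
      lam * (#|X| + #|Z| + 1)%N%:R <= #|reach ws' X Z|%:R ->
      (1 + zeta) * #|reach ws' X Z|%:R <= #|reach ws X Z|%:R]
  else True.

Let zeta0 : 0 < zeta.
Proof. by rewrite divr_gt0 // mulr_gt0. Qed.

Let lam0 : 0 < lam.
Proof.
rewrite ltNge; apply/negP=> h; have : 4 * zeta * lam <= 0.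
  by rewrite mulr_ge0_le0 // mulr_ge0 // ltW.
by have := hlam; lra.
Qed.

Let n0' : (0 < n)%N.
Proof. exact: leq_trans n0. Qed.

Lemma exists_expanding_seq l : exists ws, size ws = l /\ expanding_seq ws.
Proof.
elim: l => [|l [ws [sz hws]]]; first by exists [::].
have [W [h1 h2]] := expanding_layer d0 s0 n0' hdeg hexp hbeta hlam hdegsum
  hunion (reach ws).
by exists (W :: ws); rewrite /= sz; split=> //; split.
Qed.

Lemma expanding_seq_cat ws1 ws2 : expanding_seq (ws1 ++ ws2) -> expanding_seq ws2.
Proof. by elim: ws1 => //= w ws1 IH [/IH]. Qed.

Lemma reach_mono (ws1 ws2 : seq {set H}) (X Z : {set H}) : #|reach ws2 X Z|%:R <= #|reach (ws1 ++ ws2) X Z|%:R :> R.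
Proof. by rewrite ler_nat subset_leq_card // reach_cat. Qed.

(** Only the linear part [1 + k * zeta] of [(1 + zeta) ^+ k] is kept; after [m >= 1 / zeta] sets it
    already gives a doubling. *)
Lemma reach_growth ws1 ws2 X Z : expanding_seq (ws1 ++ ws2) ->
  (1 <= #|reach ws2 X Z|)%N ->
  lam * (#|X| + #|Z| + 1)%N%:R <= #|reach ws2 X Z|%:R ->
  2 / 3 * n%:R < #|reach (ws1 ++ ws2) X Z|%:R :> R \/
  (1 + (size ws1)%:R * zeta) * #|reach ws2 X Z|%:R <= #|reach (ws1 ++ ws2) X Z|%:R.
Proof.
move=> + h1 h2; elim: ws1 => [|w ws1 IH]; first by right; rewrite mul0r addr0 mul1r.
move=> [hws _ hw]; case: (IH hws) => [h|h].
  by left; apply: lt_le_trans h (reach_mono [:: w] _ _ _).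
case: (ltP (2 / 3 * n%:R) (#|reach (ws1 ++ ws2) X Z|%:R : R)) => h3.
  by left; apply: lt_le_trans h3 (reach_mono [:: w] _ _ _).
right; apply: le_trans (hw X Z _ h3 _).
- rewrite -[size (w :: ws1)]/((size ws1).+1) -natr1.
  set r := #|reach ws2 X Z|%:R in h h2 *; set r' := #|reach _ X Z|%:R in h *.
  have r0 : 0 <= r by exact: ler0n.
  have q0 : 0 <= (size ws1)%:R * zeta * zeta * r.
    exact: (mulr_ge0 (mulr_ge0 (mulr_ge0 (ler0n _ _) (ltW zeta0)) (ltW zeta0)) r0).
  have := ler_wpM2l (ltW (addr_gt0 ltr01 zeta0)) h; lra.
- have := reach_mono ws1 ws2 X Z; rewrite ler_nat; exact: leq_trans.
- exact: le_trans h2 (reach_mono _ _ _ _).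
Qed.

Lemma reach_double ws1 ws2 X Z : expanding_seq (ws1 ++ ws2) -> size ws1 = m ->
  (1 <= #|reach ws2 X Z|)%N ->
  lam * (#|X| + #|Z| + 1)%N%:R <= #|reach ws2 X Z|%:R ->
  2 / 3 * n%:R < #|reach (ws1 ++ ws2) X Z|%:R :> R \/
  2 * #|reach ws2 X Z|%:R <= #|reach (ws1 ++ ws2) X Z|%:R :> R.
Proof.
move=> hws sz h1 h2; case: (reach_growth hws h1 h2) => h; [by left|right].
apply: le_trans h; rewrite ler_wpM2r // sz; have := hm; lra.
Qed.

(** Doubling in each of [a] blocks of [m] sets would reach [2 ^ a >= n] vertices, so two thirds are
    exceeded in any case. *)
Lemma reach_most ws1 ws2 X Z : expanding_seq (ws1 ++ ws2) -> size ws1 = (a * m)%N ->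
  (1 <= #|reach ws2 X Z|)%N ->
  lam * (#|X| + #|Z| + 1)%N%:R <= #|reach ws2 X Z|%:R ->
  2 / 3 * n%:R < #|reach (ws1 ++ ws2) X Z|%:R :> R.
Proof.
move=> hws sz h1 h2.
have nR : 1 <= n%:R :> R by rewrite ler1n.
suff main k ws : size ws = (k * m)%N -> expanding_seq (ws ++ ws2) ->
  2 / 3 * n%:R < #|reach (ws ++ ws2) X Z|%:R :> R \/
  (2 ^ k)%:R <= #|reach (ws ++ ws2) X Z|%:R :> R.
  case: (main _ _ sz hws) => // h; apply: lt_le_trans h.
  have : n%:R <= (2 ^ a)%:R :> R by rewrite ler_nat.
  lra.
elim: k ws => [|k IH] ws szk; first by move=> _; right; rewrite ler1n; case: ws szk.
rewrite -(cat_take_drop m ws) -catA => hws'.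
have sz1 : size (take m ws) = m by rewrite size_takel // szk mulSn leq_addr.
have sz2 : size (drop m ws) = (k * m)%N by rewrite size_drop szk mulSn addKn.
case: (IH _ sz2 (expanding_seq_cat hws')) => h.
  by left; apply: lt_le_trans h (reach_mono _ _ _ _).
have mono := reach_mono (drop m ws) ws2 X Z.
case: (reach_double hws' sz1 (X := X) (Z := Z)) => [||h'|h'].
- by apply: leq_trans h1 _; move: mono; rewrite ler_nat.
- exact: le_trans h2 mono.
- by left.
- right; apply: le_trans h'; rewrite expnS natrM; apply: ler_wpM2l h; lra.
Qed.

Lemma subset_of_card (A : {set H}) k : (k <= #|A|)%N ->
  exists B : {set H}, B \subset A /\ #|B| = k.
Proof.
move=> hk; exists [set x in take k (enum A)]; split.
  by apply/subsetP=> x; rewrite inE => /mem_take; rewrite mem_enum.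
rewrite cardsE (card_uniqP _) ?take_uniq ?enum_uniq //.
by rewrite size_takel // -cardE.
Qed.

(* One of two halves of [X] reaches more than a third of the graph, and then
   soon more than two thirds; iterating this singles out one vertex. *)
Lemma reach_single k (ws1 ws2 : seq {set H}) (X Z : {set H}) : expanding_seq (ws1 ++ ws2) ->
  size ws1 = (k * m)%N -> (#|X| <= 2 ^ k)%N ->
  2 / 3 * n%:R < #|reach ws2 X Z|%:R :> R ->
  lam * (#|X| + #|Z| + 1)%N%:R <= n%:R / 3 ->
  exists2 x, x \in X & 2 / 3 * n%:R < #|reach (ws1 ++ ws2) [set x] Z|%:R :> R.
Proof.
have nR : 1 <= n%:R :> R by rewrite ler1n.
elim: k ws1 ws2 X => [|k IH] ws1 ws2 X hws sz cX hX hl.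
  have [x xX] : exists x, x \in X.
    apply/set0Pn; apply/eqP=> X0; move: hX; rewrite X0 reach0 cards0; lra.
  have eX : X = [set x].
    by apply/eqP; rewrite eq_sym eqEcard sub1set xX cards1.
  exists x => //; rewrite -eX; apply: lt_le_trans hX (reach_mono _ _ _ _).
have [X1 [X1X cX1]] : exists B : {set H}, B \subset X /\ #|B| = minn #|X| (2 ^ k).
  by apply: subset_of_card; rewrite geq_minl.
pose X2 := X :\: X1.
have eX : X = X1 :|: X2 by rewrite -[LHS](setID X X1) (setIidPr X1X).
have cX2 : (#|X2| <= 2 ^ k)%N.
  rewrite cardsD (setIidPr X1X) cX1 leq_subLR.
  case: (leqP #|X| (2 ^ k)) => h; first by rewrite leq_addr.
  by move: cX; rewrite expnS mul2n addnn.
have [X' [X'X cX' hX']] : exists X' : {set H}, [/\ X' \subset X, (#|X'| <= 2 ^ k)%N &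
    n%:R / 3 < #|reach ws2 X' Z|%:R :> R].
  have hU : #|reach ws2 X Z|%:R <= #|reach ws2 X1 Z|%:R + #|reach ws2 X2 Z|%:R :> R.
    by rewrite -natrD ler_nat [in leqLHS]eX reachU leq_card_setU.
  case: (ltP (n%:R / 3) (#|reach ws2 X1 Z|%:R : R)) => h.
    by exists X1; split=> //; rewrite cX1 geq_minr.
  exists X2; split=> //; first exact: subsetDl.
  lra.
have sz1 : size (take (k * m) ws1) = (k * m)%N.
  by rewrite size_takel // sz leq_mul2r leqnSn orbT.
have sz2 : size (drop (k * m) ws1) = m by rewrite size_drop sz mulSn addnK.
move: hws; rewrite -(cat_take_drop (k * m) ws1) -catA => hws.
have hl' : lam * (#|X'| + #|Z| + 1)%N%:R <= n%:R / 3.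
  apply: le_trans hl; rewrite ler_wpM2l ?(ltW lam0) // ler_nat !leq_add2r.
  exact: subset_leq_card.
have hX'' : 2 / 3 * n%:R < #|reach (drop (k * m) ws1 ++ ws2) X' Z|%:R :> R.
  case: (reach_double (expanding_seq_cat hws) sz2 (X := X') (Z := Z)) => //.
  - rewrite -(ltr_nat R); apply: le_lt_trans hX'; lra.
  - exact: le_trans hl' (ltW hX').
  - lra.
have [x xX' hx] := IH _ _ _ hws sz1 cX' hX'' hl'.
by exists x => //; exact: (subsetP X'X).
Qed.

(** One half of the sets takes a source set beyond two thirds of the graph, the other half singles
    out one of its vertices. A link consists of two walks with at most [l] internal vertices each
    and their meeting vertex, whence [l']. *)
Let l := (2 * (a * m))%N.
Let l' := l.*2.+1.

(** [disjoint_representatives] is applied to the vertex sets of links. By [reach_single], fewer than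
    half of the indices of [J] have a source reaching at most two thirds of the graph, and likewise
    for targets. So some index has both ends reaching more than two thirds; the two reached sets
    share more than a third of the vertices, and the last random set [w] contains one of these
    outside [Z]. *)
Lemma exists_connector : exists W : {set H},
  (forall v, #|nbr v :&: W|%:R <= (l.+1)%:R * (2 * beta * d)) /\
  forall (I : finType) (x y : I -> H), injective x -> injective y ->
    (forall i, x i != y i) ->
    (forall J : {set I}, J != set0 ->
       3 * lam * (2 + 4 * l')%N%:R * #|J|%:R <= #|Nb (x @: J)|%:R) ->
    (forall J : {set I}, J != set0 ->
       3 * lam * (2 + 4 * l')%N%:R * #|J|%:R <= #|Nb (y @: J)|%:R) ->
  exists Q : I -> seq H,
    (forall i, [/\ path (@sedge H) (x i) (rcons (Q i) (y i)),
       uniq (x i :: rcons (Q i) (y i)) & {subset Q i <= W}]) /\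
    (forall i j, i != j -> forall u, u \in Q i -> u \notin Q j).
Proof.
have nR : 3 <= n%:R :> R by rewrite (ler_nat _ 3).
have [ws [sz hws]] := exists_expanding_seq l.
pose T (X Z : {set H}) := \bigcap_(x in X) reach ws [set x] Z.
(* The common reached set is truncated just above a third of the graph, to respect the two-thirds
   bound in [expanding_layer]. *)
pose rr (X Z : {set H}) := [set x in take (n %/ 3).+1 (enum (T X Z))].
have [w [hw1 hw2]] := expanding_layer d0 s0 n0' hdeg hexp hbeta hlam hdegsum
  hunion rr.
pose W := w :|: \bigcup_(u <- ws) u.
exists W; split.
  move=> v; rewrite setIUr; apply: (@le_trans _ _ (2 * beta * d + (size ws)%:R * (2 * beta * d))).
    apply: (@le_trans _ _ (#|nbr v :&: w|%:R + #|nbr v :&: \bigcup_(u <- ws) u|%:R)).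
      by rewrite -natrD ler_nat leq_card_setU.
    apply: lerD => //; elim: ws hws {sz T rr hw1 hw2 W} => [_|u ws IH [h1 h2 _]].
      by rewrite big_nil setI0 cards0 mul0r.
    rewrite big_cons setIUr; apply: le_trans (_ : #|nbr v :&: u|%:R + #|nbr v :&: \bigcup_(u0 <- ws) u0|%:R <= _).
      by rewrite -natrD ler_nat leq_card_setU.
    rewrite -[size (u :: ws)]/((size ws).+1) -natr1 mulrDl mul1r addrC lerD //.
    exact: IH.
  by rewrite sz -[l.+1%:R]natr1 [leRHS]mulrDl mul1r [leLHS]addrC.
move=> I x y injx injy xy hx hy.
have wsW u : u \in ws -> u \subset W.
  move=> uws; apply: subset_trans (subsetUr _ _); by rewrite (big_rem u uws) subsetUl.
pose h (i : I) (e : {set H}) := exists q : seq H, [/\ e = [set z in q],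
  path (@sedge H) (x i) (rcons q (y i)), uniq (x i :: rcons q (y i)) &
  {subset q <= W}].
have big (x' : I -> H) (J J' : {set I}) (Z : {set H}) : injective x' ->
    (forall J : {set I}, J != set0 ->
       3 * lam * (2 + 4 * l')%N%:R * #|J|%:R <= #|Nb (x' @: J)|%:R) ->
    J' != set0 -> (#|J| <= 2 * #|J'|)%N -> (#|Z| <= 2 * l' * #|J|)%N ->
    exists2 i, i \in J' & 2 / 3 * n%:R < #|reach ws [set x' i] Z|%:R :> R.
  move=> injx' hx' J'0 cJ cZ; pose X := x' @: J'.
  have cX : #|X| = #|J'| by rewrite card_imset.
  have J'1 : (1 <= #|J'|)%N by rewrite card_gt0.
  have c1 : (#|X| + #|Z| + 1 <= (2 + 4 * l') * #|J'|)%N.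
    rewrite cX; apply: (@leq_trans (#|J'| + 2 * l' * (2 * #|J'|) + #|J'|)).
      by rewrite !leq_add // (leq_trans cZ) // leq_mul2l cJ orbT.
    by rewrite addnAC addnn -mul2n mulnA [(2 * l' * 2)%N]mulnAC -mulnDl.
  have c2 : 3 * (lam * (#|X| + #|Z| + 1)%N%:R) <= #|Nb X|%:R.
    apply: le_trans (hx' J' J'0); rewrite -!mulrA ler_wpM2l // ler_wpM2l ?(ltW lam0) //.
    by rewrite -natrM ler_nat.
  have c3 : #|Nb X|%:R <= n%:R :> R by rewrite ler_nat max_card.
  have c4 : lam * (#|X| + #|Z| + 1)%N%:R > 0 by rewrite mulr_gt0 // ltr0n addn1.
  pose ws1 := take (a * m) ws; pose ws2 := drop (a * m) ws.
  have sz1 : size ws1 = (a * m)%N by rewrite size_takel // sz /l leq_pmull.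
  have sz2 : size ws2 = (a * m)%N by rewrite size_drop sz /l mul2n -addnn addnK.
  have ews : ws = ws1 ++ ws2 by rewrite cat_take_drop.
  have hws2 : expanding_seq ws2 by move: hws; rewrite ews; exact: expanding_seq_cat.
  have r2 : 2 / 3 * n%:R < #|reach ws2 X Z|%:R :> R.
    rewrite -(cats0 ws2); apply: reach_most => //; rewrite ?cats0 //=.
    - by rewrite -(ltr_nat R); lra.
    - lra.
  have hws12 : expanding_seq (ws1 ++ ws2) by rewrite -ews.
  have cXa : (#|X| <= 2 ^ a)%N by exact: leq_trans (max_card _) ha.
  have hl : lam * (#|X| + #|Z| + 1)%N%:R <= n%:R / 3 by lra.
  have [_ /imsetP[i iJ' ->]] := reach_single hws12 sz1 cXa r2 hl.
  by rewrite -ews => hi; exists i.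
have robust : forall (J : {set I}) (Z : {set H}), J != set0 ->
    (#|Z| <= 2 * l' * #|J|)%N ->
    exists i (e : {set H}), [/\ i \in J, h i e, (#|e| <= l')%N & [disjoint e & Z]].
  move=> J Z J0 cZ.
  have J1 : (1 <= #|J|)%N by rewrite card_gt0.
  pose bad (x' : I -> H) := [set i in J | #|reach ws [set x' i] Z|%:R <= 2 / 3 * n%:R :> R].
  have badlt (x' : I -> H) : injective x' ->
    (forall J : {set I}, J != set0 ->
       3 * lam * (2 + 4 * l')%N%:R * #|J|%:R <= #|Nb (x' @: J)|%:R) ->
    (2 * #|bad x'| < #|J|)%N.
    move=> injx' hx'; rewrite ltnNge; apply/negP=> hb.
    have b0 : bad x' != set0.
      by rewrite -card_gt0; case: #|bad x'| hb => //; rewrite muln0 leqNgt J1.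
    have [i] := big x' J (bad x') Z injx' hx' b0 hb cZ.
    by rewrite inE ltNge => /andP[_ ->].
  have [i [iJ ix iy]] : exists i, [/\ i \in J, i \notin bad x & i \notin bad y].
    have : (#|bad x :|: bad y| < #|J|)%N.
      have h1 := badlt x injx hx; have h2 := badlt y injy hy.
      by have h3 := (leq_card_setU (bad x) (bad y)).1; lia.
    rewrite ltnNge => hc; have : ~~ (J \subset bad x :|: bad y).
      by apply: contraNN hc => /subset_leq_card.
    by move/subsetPn=> [i iJ]; rewrite inE negb_or => /andP[]; exists i.
  move: ix iy; rewrite !inE iJ /= -!ltNge => ix iy.
  have cT : n%:R / 3 < #|T [set x i; y i] Z|%:R :> R.
    rewrite /T bigcap_setU !big_set1.
    set A := reach _ _ _ in ix *; set B := reach _ _ _ in iy *.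
    have : #|A|%:R + #|B|%:R = #|A :|: B|%:R + #|A :&: B|%:R :> R.
      by rewrite -!natrD cardsUI.
    have : #|A :|: B|%:R <= n%:R :> R by rewrite ler_nat max_card.
    lra.
  pose U := rr [set x i; y i] Z.
  have n3 : n = (n %/ 3 * 3 + n %% 3)%N by exact: divn_eq.
  have n33 : (n %% 3 < 3)%N by rewrite ltn_pmod.
  have n3R : n%:R = (n %/ 3)%:R * 3 + (n %% 3)%:R :> R.
    by rewrite {1}n3 natrD natrM.
  have n33R : (n %% 3)%:R <= 2 :> R by rewrite (ler_nat _ _ 2).
  have n30 : 0 <= (n %% 3)%:R :> R by exact: ler0n.
  have n31 : 1 <= (n %/ 3)%:R :> R by rewrite ler1n divn_gt0.
  have cU : #|U| = (n %/ 3).+1.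
    rewrite /U /rr cardsE (card_uniqP _) ?take_uniq ?enum_uniq //.
    rewrite size_takel // -cardE -(ltr_nat R); apply: le_lt_trans cT; lra.
  have UT : U \subset T [set x i; y i] Z.
    by apply/subsetP=> z; rewrite inE => /mem_take; rewrite mem_enum.
  have cUR : #|U|%:R = (n %/ 3)%:R + 1 :> R by rewrite cU -natr1.
  have hU1 : (1 <= #|U|)%N by rewrite cU.
  have hU2 : #|U|%:R <= 2 / 3 * n%:R :> R by rewrite cUR; lra.
  have hU3 : lam * (#|[set x i; y i]| + #|Z| + 1)%N%:R <= #|U|%:R.
    have c1 : (#|[set x i; y i]| + #|Z| + 1 <= (2 + 4 * l') * #|J|)%N.
      rewrite cards2 xy addnAC -/((2 + 1)%N); apply: (@leq_trans (3 * #|J| + 2 * l' * #|J|)).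
        by rewrite leq_add // leq_pmulr.
      rewrite -mulnDl leq_mul2r; apply/orP; right.
      by rewrite /l' (_ : 4 = 2 + 2)%N // mulnDl addnA leq_add2r (_ : 3 = 2 + 1)%N // leq_add2l mul2n double_gt0.
    have c2 : 3 * (lam * (#|[set x i; y i]| + #|Z| + 1)%N%:R) <= #|Nb (x @: J)|%:R.
      apply: le_trans (hx J J0); rewrite -!mulrA ler_wpM2l // ler_wpM2l ?(ltW lam0) //.
      by rewrite -natrM ler_nat.
    have c3 : #|Nb (x @: J)|%:R <= n%:R :> R by rewrite ler_nat max_card.
    rewrite cUR; lra.
  have hgrow := hw2 [set x i; y i] Z hU1 hU2 hU3.
  (* If this set were empty, [U] could not grow by the factor [1 + zeta]. *)
  have [z zU] : exists z, z \in U :&: w :\: Z.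
    apply/set0Pn; apply/eqP=> e0; move: hgrow; rewrite -/U e0 /Nb big_set0 setU0.
    have U0 : 0 < #|U|%:R :> R by rewrite ltr0n.
    by have := mulr_gt0 zeta0 U0; rewrite -[s / (8 * d)]/zeta; lra.
  move: zU; rewrite !inE => /andP[zZ /andP[zU zw]].
  have zT := subsetP UT z; rewrite inE zU in zT.
  move: (zT isT); rewrite /T bigcap_setU !big_set1 inE => /andP[zx zy].
  have zW : z \in W :\: Z by rewrite !inE zZ zw.
  have [q [hp hu hs hq]] := reach_link (xy i) zx zy zW wsW.
  exists i, [set z in q]; split=> //.
  - by exists q; split=> // u /hq; rewrite inE => /andP[].
  - rewrite cardsE; apply: leq_trans (card_size _) _; by rewrite /l' -sz.
  - rewrite -setI_eq0; apply/eqP/setP=> u; rewrite !inE; apply/negP=> /andP[/hq].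
    by rewrite inE => /andP[/negPf->].
have [E [hE dis]] := disjoint_representatives robust.
(* The boolean form makes [xchoose] applicable, so that the links become a function of [i]. *)
have hQ : forall i, exists q : seq H, [&& E i == [set z in q],
  path (@sedge H) (x i) (rcons q (y i)), uniq (x i :: rcons q (y i)) &
  all (mem W) q].
  move=> i; have [q [-> h2 h3 h4]] := hE i; exists q.
  by rewrite eqxx h2 h3 /=; apply/allP.
exists (fun i => xchoose (hQ i)); split.
  move=> i; have /and4P[_ -> -> hall] := xchooseP (hQ i); split=> //.
  exact/allP.
move=> i j ij u ui; apply/negP=> uj.
have /and4P[/eqP ei _ _ _] := xchooseP (hQ i).
have /and4P[/eqP ej _ _ _] := xchooseP (hQ j).
have := dis i j ij; rewrite ei ej disjoint_subset => /subsetP/(_ u).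
by rewrite !inE ui uj => /(_ isT).
Qed.
End Connector.

(** * Path forests *)

Lemma sum_nbr_swap (R : realType) (H : sgraph) (A B : {set H}) (F : H -> H -> R) :
  \sum_(x in A) \sum_(y in nbr x :&: B) F x y =
  \sum_(y in B) \sum_(x in nbr y :&: A) F x y.
Proof.
rewrite (exchange_big_dep (mem B)) /=; last by move=> x y _; rewrite inE => /andP[].
apply: eq_bigr => y yB; apply: eq_bigl => x; rewrite !inE yB andbT andbC.
by rewrite sedge_sym.
Qed.

Section LayeredPaths.
Variables (H : sgraph) (L : nat -> {set H}) (k : nat).

(** Deficient matchings between consecutive layers are composed; [P i v] is the vertex in layer [i]
    of the path labelled [v], and each matching drops at most [k] labels. *)
Lemma layered_paths K :
  (forall i, (i < K)%N -> forall S : {set H}, S \subset L i ->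
     (#|S| <= #|rel_nbrs (@sedge H) (L i.+1) S| + k)%N) ->
  exists (C : {set H}) (P : nat -> H -> H),
    [/\ (#|L 0| <= #|C| + K * k)%N,
      forall v i, v \in C -> (i <= K)%N -> P i v \in L i,
      forall v i, v \in C -> (i < K)%N -> sedge (P i v) (P i.+1 v) &
      forall i, (i <= K)%N -> {in C &, injective (P i)}].
Proof.
elim: K => [|K IH] hall.
  exists (L 0), (fun _ v => v); split=> //; first by rewrite mul0n addn0.
    by move=> v [|i].
  by move=> i _ u v.
have [C [P [cC hL hE hinj]]] := IH (fun i hi => hall i (ltnW hi)).
have [D [mt [DL cD injm hm]]] := hall_deficient (hall K (leqnn _)).
pose C' := [set v in C | P K v \in D].
exists C', (fun i v => if (i <= K)%N then P i v else odflt v (mt (P K v))).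
have hC v : v \in C' -> v \in C /\ P K v \in D by rewrite inE => /andP.
split.
- apply: leq_trans cC _; rewrite mulSn addnA leq_add2r.
  rewrite -(cardsID [set v | P K v \in D] C) leq_add //.
    by apply/subset_leq_card/subsetP=> v; rewrite !inE.
  apply: leq_trans cD; rewrite -(card_in_imset (f := P K)).
    apply/subset_leq_card/subsetP=> _ /imsetP[v + ->]; rewrite !inE => /andP[-> vC].
    exact: hL.
  by move=> u v; rewrite !inE => /andP[_ uC] /andP[_ vC]; apply: hinj.
- move=> v i /hC[vC vD] iK; case: (leqP i K) => hi; first exact: hL.
  have -> : i = K.+1 by apply/eqP; rewrite eqn_leq iK.
  by have [b [-> bL _]] := hm _ vD.
- move=> v i /hC[vC vD]; rewrite ltnS => iK; rewrite iK.
  case: (ltnP i K) => hi; first exact: hE.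
  have -> : i = K by apply/eqP; rewrite eqn_leq iK.
  by have [b [-> _ hb]] := hm _ vD.
- move=> i iK u v /hC[uC uD] /hC[vC vD]; case: (leqP i K) => hi; first exact: hinj.
  have [b [eb _ _]] := hm _ uD; have [b' [eb' _ _]] := hm _ vD.
  rewrite eb eb' /= => e; apply: (hinj K) => //; apply: injm => //.
  by rewrite eb eb' e.
Qed.
End LayeredPaths.

(** * Covering almost everything by long disjoint paths *)

Section PathForest.
Variables (R : realType) (H : sgraph) (d delta : R) (K' : nat) (Vp : {set H}).
Let K := K'.+1.
Let n := #|H|.
Hypothesis d0 : 0 < d.
Hypothesis hdeg : forall v : H, #|nbr v|%:R <= d.
Hypothesis hmin : forall v : H, d / 3 <= #|nbr v :&: Vp|%:R.
Hypothesis hdelta : 0 < delta <= 1.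
Hypothesis hsmall : 2 * n%:R * K%:R * expR (- (delta ^+ 2 * d / (72 * K%:R))) < 1.

Let cv v : R := #|nbr v :&: Vp|%:R.
Let Sx : R := \sum_(v in Vp) cv v / d.

Let cv0 v : 0 < cv v.
Proof. by apply: lt_le_trans (hmin v); rewrite divr_gt0. Qed.

Let cvd v : cv v <= d.
Proof. by apply: le_trans (hdeg v); rewrite ler_nat subset_leq_card // subsetIl. Qed.

Let K0 : 0 < K%:R :> R.
Proof. by rewrite ltr0n. Qed.

(* A vertex [u] is kept with probability [cv u / d]; edges to [u] get weight
   [1 / cv u], so that the expected weight from any [v] to a layer is exactly
   [cv v / (d * K)], however irregular the graph is. *)
Lemma exists_balanced_layers : exists f : H -> nat,
  forall v i, (i < K)%N ->
    (1 - delta) * (cv v / (d * K%:R)) <=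
      \sum_(u in nbr v :&: [set u in Vp | f u == i]) (cv u)^-1 <=
    (1 + delta) * (cv v / (d * K%:R)).
Proof.
have [de0 de1] := andP hdelta.
have cvd1 v : cv v / d <= 1 by rewrite ler_pdivrMr // mul1r.
have cvdp v : 0 <= cv v / d by rewrite divr_ge0 // ltW.
pose T : finType := (bool * (H * 'I_K))%type.
pose up (t : T) := t.1.
pose a (t : T) (u : H) (l : 'I_K.+1) : R :=
  if [&& u \in nbr t.2.1, u \in Vp & (l == t.2.2 :> nat)] then (cv u)^-1 else 0.
(* Labels below [K] are layers; the extra label [K] discards the vertex. *)
pose mu (u : H) (l : 'I_K.+1) : R :=
  if (l < K)%N then cv u / d / K%:R else 1 - cv u / d.
have cM u : (cv u)^-1 <= 3 / d.
  by rewrite -[leRHS]invrK lef_pV2 ?posrE ?invr_gt0 ?divr_gt0 // invf_div hmin.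
have mean t v : \sum_l mu v l * a t v l =
    if (v \in nbr t.2.1) && (v \in Vp) then (d * K%:R)^-1 else 0.
  rewrite /a; case: ifP => hv; last first.
    by rewrite big1 // => l _; case: ifP => //; rewrite ?mulr0 // andbA hv.
  rewrite (bigD1 (widen_ord (leqnSn K) t.2.2)) //= big1 ?addr0; last first.
    move=> l hl; case: ifP; rewrite ?mulr0 // => /and3P[_ _ /eqP e].
    by case/negP: hl; apply/eqP/val_inj.
  move/andP: hv => [-> ->]; rewrite eqxx /mu /= ltn_ord.
  by field; rewrite !gt_eqF //; exact: cv0.
have meanE (t : T) : \sum_v \sum_l mu v l * a t v l = cv t.2.1 / (d * K%:R).
  under eq_bigr => v _ do rewrite mean.
  rewrite -big_mkcond /= sumr_const -[LHS]mulr_natl /cv.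
  by congr (_%:R * _); apply: eq_card => v; rewrite [RHS]inE unfold_in.
have [|||||f hf] := @exists_concentrated R H _ T xpredT mu up a (fun=> 3 / d)
   (fun t => cv t.2.1 / (d * K%:R)) (fun=> delta).
- move=> v l; rewrite /mu; case: ifP => _; last by rewrite subr_ge0.
  by rewrite divr_ge0 // ltW.
- move=> v; rewrite big_ord_recr /= /mu /= ltnn.
  under eq_bigr => i _ do rewrite /= ltn_ord.
  rewrite sumr_const card_ord -[X in X + _]mulr_natr divfK ?gt_eqF //; lra.
- move=> t _; split=> //; first by rewrite divr_gt0.
  move=> u l; rewrite /a; case: ifP => _; rewrite ?cM ?invr_ge0 ?(ltW (cv0 _)) //=.
  by rewrite lexx divr_ge0 // ltW.
- by move=> t _; rewrite meanE; case: (up t).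
- apply: le_lt_trans hsmall.
  apply: (@le_trans _ _ (\sum_(t : T) expR (- (delta ^+ 2 * d / (72 * K%:R))))).
    apply: ler_sum => t _; rewrite ler_expR lerN2.
    have -> : delta ^+ 2 * (cv t.2.1 / (d * K%:R)) / (8 * (3 / d)) =
       delta ^+ 2 * (cv t.2.1) / (24 * K%:R) by field; rewrite !gt_eqF //; exact: cv0.
    have -> : delta ^+ 2 * d / (72 * K%:R) = delta ^+ 2 * (d / 3) / (24 * K%:R).
      by field; rewrite gt_eqF.
    rewrite ler_wpM2r ?invr_ge0 ?mulr_ge0 ?(ltW K0) // ler_wpM2l ?sqr_ge0 ?hmin //.
  rewrite sumr_const card_prod card_bool card_prod card_ord -[leLHS]mulr_natl !natrM.
  by rewrite mulrA.
exists (fun u => f u : nat) => v i iK.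
have := hf (true, (v, Ordinal iK)) isT; have := hf (false, (v, Ordinal iK)) isT.
rewrite /= /a /=.
under eq_bigr => u _ do idtac.
rewrite -!big_mkcond /=.
have -> : \sum_(u in nbr v :&: [set u in Vp | (f u : nat) == i]) (cv u)^-1 =
    \sum_(u | [&& u \in nbr v, u \in Vp & f u == i :> nat]) (cv u)^-1.
  by apply: eq_bigl => u; rewrite !inE.
by move=> /ltW -> /ltW ->.
Qed.

(** With weight [d / (cv u * cv v)] on an edge [uv], each vertex sends weight at least
    [(1 - delta) / K] into the next layer and receives at most [(1 + delta) / K] from the previous
    one, so consecutive layers have matchings of small deficiency. [Sx] is the expected number of
    kept vertices. *)
Lemma path_forest : exists (t : nat) (hd : 'I_t -> H) (tl : 'I_t -> seq H),
  [/\ forall i, [/\ path (@sedge H) (hd i) (tl i), uniq (hd i :: tl i),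
        {subset hd i :: tl i <= Vp} & size (tl i) = K'],
    forall i j, i != j -> forall u, u \in hd i :: tl i -> u \notin hd j :: tl j,
    forall w, #|nbr w :&: [set hd i | i : 'I_t]|%:R <= 2 * d / K%:R,
    forall w, #|nbr w :&: [set last (hd i) (tl i) | i : 'I_t]|%:R <= 2 * d / K%:R &
    (1 - delta) * Sx - 4 * delta * K%:R * n%:R <= K%:R * t%:R].
Proof.
have [de0 de1] := andP hdelta.
have [f hf] := exists_balanced_layers.
pose L i := [set u in Vp | f u == i].
have dK0 : 0 < d * K%:R by rewrite mulr_gt0.
(* A vertex [u] of the layer has exactly [cv u] neighbours in [Vp], so its weights [1 / cv u] add up
   to 1. The balance of the layers thus also controls their sizes. *)
have sumL i : \sum_(v in Vp) \sum_(u in nbr v :&: L i) (cv u)^-1 = #|L i|%:R.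
  rewrite sum_nbr_swap -sum1_card natr_sum; apply: eq_bigr => u _.
  by rewrite sumr_const -[LHS]mulr_natl -/(cv u) divff // gt_eqF.
have SxE : \sum_(v in Vp) cv v / (d * K%:R) = Sx / K%:R.
  by rewrite /Sx mulr_suml; apply: eq_bigr => v _; rewrite invfM mulrA.
have Sxn : Sx <= n%:R.
  apply: (@le_trans _ _ (\sum_(v in Vp) 1)).
    by apply: ler_sum => v _; rewrite ler_pdivrMr // mul1r.
  by rewrite sumr_const ler_nat max_card.
have cL i : (i < K)%N -> (1 - delta) * (Sx / K%:R) <= #|L i|%:R <= (1 + delta) * (Sx / K%:R).
  move=> iK; rewrite -sumL -SxE !mulr_sumr.
  by apply/andP; split; apply: ler_sum => v _; have /andP[] := hf v i iK.
have cLn i : (i < K)%N -> #|L i|%:R <= 2 * (n%:R / K%:R) :> R.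
  move=> iK; have /andP[_ h] := cL i iK; apply: le_trans h _.
  have h1 : Sx / K%:R <= n%:R / K%:R by rewrite ler_wpM2r // invr_ge0 ltW.
  have h2 : 0 <= n%:R / K%:R :> R by rewrite divr_ge0 // ltW.
  have : (1 + delta) * (Sx / K%:R) <= (1 + delta) * (n%:R / K%:R).
    by rewrite ler_wpM2l //; lra.
  have : delta * (n%:R / K%:R) <= 1 * (n%:R / K%:R) by rewrite ler_wpM2r.
  by lra.
have degL w i : (i < K)%N -> #|nbr w :&: L i|%:R <= 2 * d / K%:R.
  move=> iK; have /andP[_ h] := hf w i iK.
  have : #|nbr w :&: L i|%:R / d <= \sum_(u in nbr w :&: L i) (cv u)^-1.
    rewrite mulr_natl -sumr_const; apply: ler_sum => u _.
    by rewrite lef_pV2 ?posrE.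
  move=> /le_trans/(_ h); rewrite ler_pdivrMr // => /le_trans; apply.
  have -> : (1 + delta) * (cv w / (d * K%:R)) * d = (1 + delta) * cv w / K%:R.
    by field; rewrite !gt_eqF //; exact: cv0.
  rewrite ler_wpM2r ?invr_ge0 ?(ltW K0) //.
  by apply: ler_pM; rewrite ?(ltW (cv0 _)) //; lra.
(* From [(1 - delta) * #|S| <= (1 + delta) * #|N|] the deficiency is at most
   [delta * (#|S| + #|N|)], and each layer has at most [2 * n / K] vertices. *)
pose y : R := 4 * delta * (n%:R / K%:R).
have y0 : 0 <= y by rewrite !mulr_ge0 ?invr_ge0 ?(ltW K0) ?(ltW de0).
pose k := Num.trunc y.
have /andP[ky yk] : k%:R <= y < k.+1%:R by exact: Num.Theory.truncn_itv.
have hall i : (i < K')%N -> forall S : {set H}, S \subset L i ->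
    (#|S| <= #|rel_nbrs (@sedge H) (L i.+1) S| + k)%N.
  move=> iK' S SL.
  have iK : (i < K)%N by exact: leqW.
  set N := rel_nbrs _ _ _.
  have NL : N \subset L i.+1 by apply/subsetP=> u; rewrite inE => /andP[].
  have h1 : #|S|%:R * ((1 - delta) / K%:R) <=
      \sum_(v in S) \sum_(u in nbr v :&: L i.+1) (d / cv v * (cv u)^-1).
    rewrite mulr_natl -sumr_const; apply: ler_sum => v vS.
    rewrite -mulr_sumr; have /andP[h _] := hf v i.+1 iK'.
    have p : 0 <= d / cv v by rewrite divr_ge0 // ltW.
    apply: le_trans (ler_wpM2l p h).
    by rewrite le_eqVlt; apply/orP; left; apply/eqP; field; rewrite !gt_eqF //; exact: cv0.
  have h2 : \sum_(v in S) \sum_(u in nbr v :&: L i.+1) (d / cv v * (cv u)^-1) <=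
      #|N|%:R * ((1 + delta) / K%:R).
    rewrite sum_nbr_swap.
    rewrite (bigID (mem N)) /= [X in _ + X]big1 ?addr0; last first.
      move=> u /andP[uL uN]; apply: big1 => v; rewrite !inE => /andP[hv vS].
      case/negP: uN; rewrite inE uL; apply/existsP; exists v.
      by rewrite vS sedge_sym.
    rewrite (eq_bigl (mem N)); last first.
      by move=> u /=; case: (boolP (u \in N)) => uN; rewrite ?andbF // andbT (subsetP NL).
    rewrite mulr_natl -sumr_const; apply: ler_sum => u uN.
    have /andP[_ h] := hf u i iK.
    have p : 0 <= d / cv u by rewrite divr_ge0 // ltW.
    apply: (@le_trans _ _ (d / cv u * ((1 + delta) * (cv u / (d * K%:R))))); last first.
      by rewrite le_eqVlt; apply/orP; left; apply/eqP; field; rewrite !gt_eqF //; exact: cv0.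
    apply: le_trans (ler_wpM2l p h); rewrite mulr_sumr.
    rewrite [leRHS](big_setID S) /= -[leLHS]addr0; apply: lerD; last first.
      by apply: sumr_ge0 => v _; rewrite mulr_ge0 // invr_ge0 ltW.
    rewrite (eq_bigl (mem (nbr u :&: L i :&: S))); last first.
      by move=> v; rewrite /= -setIA (setIidPr SL).
    rewrite le_eqVlt; apply/orP; left; apply/eqP; apply: eq_bigr => v _.
    by field; rewrite !gt_eqF //; exact: cv0.
  have h3 : #|S|%:R * (1 - delta) <= #|N|%:R * (1 + delta).
    have := le_trans h1 h2; rewrite !mulrA ler_pM2r // invr_gt0 //.
  have cS : #|S|%:R <= 2 * (n%:R / K%:R) :> R.
    by apply: le_trans (cLn i iK); rewrite ler_nat subset_leq_card.
  have cN : #|N|%:R <= 2 * (n%:R / K%:R) :> R.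
    by apply: le_trans (cLn i.+1 iK'); rewrite ler_nat subset_leq_card.
  have h4 : #|S|%:R <= #|N|%:R + y.
    have : delta * (#|S|%:R + #|N|%:R) <= delta * (4 * (n%:R / K%:R)).
      by rewrite ler_wpM2l ?(ltW de0) //; lra.
    rewrite /y; lra.
  rewrite -ltnS -addnS -(ltr_nat R) natrD; apply: le_lt_trans h4 _.
  by rewrite ltrD2l.
have [C [P [cC hL hE hinj]]] := layered_paths hall.
pose c0 (i : 'I_#|C|) := enum_val i.
pose tlc v := [seq P j v | j <- iota 1 K'].
pose hdc v := P 0 v.
have hdtl v : hdc v :: tlc v = [seq P j v | j <- iota 0 K] by [].
have mem_path v u : v \in C -> u \in hdc v :: tlc v ->
    exists j, [/\ (j <= K')%N, u = P j v & f u = j].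
  move=> vC; rewrite hdtl => /mapP[j]; rewrite mem_iota add0n /= ltnS => jK ->.
  by exists j; have := hL v j vC jK; rewrite inE => /andP[_ /eqP].
have lastE v : last (hdc v) (tlc v) = P K' v.
  rewrite /tlc /hdc (last_map (P^~ v)); congr (P _ v).
  by rewrite (last_nth 0%N) size_iota -[0%N :: _]/(iota 0 K'.+1) nth_iota.
exists #|C|, (fun i => hdc (enum_val i)), (fun i => tlc (enum_val i)).
have cc (i : 'I_#|C|) : enum_val i \in C := enum_valP i.
have degim (F : 'I_#|C| -> H) j w : (j < K)%N -> (forall i, F i \in L j) ->
    #|nbr w :&: [set F i | i : 'I_#|C|]|%:R <= 2 * d / K%:R.
  move=> jK hF; apply: le_trans (degL w j jK); rewrite ler_nat subset_leq_card //.
  by apply: setIS; apply/subsetP=> _ /imsetP[i _ ->].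
split.
- move=> i; have vC := cc i; move: (enum_val i) vC => v vC; split.
  + apply/(pathP v) => j; rewrite size_map size_iota => jK.
    rewrite -[nth v (hdc v :: tlc v) j]/(nth v (hdc v :: tlc v) j) hdtl.
    rewrite !(nth_map 0%N) ?size_iota ?leqW // !nth_iota ?leqW // add0n add1n.
    exact: hE.
  + rewrite hdtl map_inj_in_uniq ?iota_uniq // => j j'.
    rewrite !mem_iota !add0n /= !ltnS => jK jK' e.
    have := hL v j vC jK; have := hL v j' vC jK'.
    by rewrite -e !inE => /andP[_ /eqP->] /andP[_ /eqP->].
  + move=> u; rewrite hdtl => /mapP[j]; rewrite mem_iota add0n /= ltnS => jK ->.
    by have := hL v j vC jK; rewrite inE => /andP[].
  + by rewrite size_map size_iota.
- move=> i j ij u ui; apply/negP=> uj.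
  have [a [aK ea fa]] := mem_path _ _ (cc i) ui.
  have [b [bK eb fb]] := mem_path _ _ (cc j) uj.
  have ab : a = b by rewrite -fa -fb.
  case/eqP: ij; apply: enum_val_inj; apply: (hinj a aK); rewrite ?cc //.
  by rewrite -ea eb ab.
- by move=> w; apply: (degim _ 0) => // i; apply: hL.
- by move=> w; apply: (degim _ K') => // i; rewrite lastE; apply: hL.
- have /andP[h _] := cL 0 isT.
  have h1 : #|L 0|%:R <= #|C|%:R + K'%:R * k%:R :> R.
    by rewrite -natrM -natrD ler_nat.
  have h2 : K%:R * ((1 - delta) * (Sx / K%:R)) <= K%:R * (#|C|%:R + K'%:R * k%:R).
    by rewrite ler_wpM2l ?(ltW K0) //; exact: le_trans h h1.
  have e : K%:R * ((1 - delta) * (Sx / K%:R)) = (1 - delta) * Sx.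
    by field; rewrite gt_eqF.
  have h3 : K'%:R * k%:R <= K%:R * y.
    by apply: ler_pM => //; rewrite ler_nat /K.
  have h4 : K%:R * (K'%:R * k%:R) <= K%:R * (K%:R * y) by rewrite ler_wpM2l ?(ltW K0).
  have e2 : K%:R * (K%:R * y) = 4 * delta * K%:R * n%:R.
    by rewrite /y; field; rewrite gt_eqF.
  rewrite e2 in h4; rewrite e in h2; lra.
Qed.
End PathForest.

(** * Dense subsets *)

Lemma ln2_gt0 (R : realType) : 0 < ln 2 :> R.
Proof. by rewrite ln_gt0 // ltr1n. Qed.

Section Log2.
Variable R : realType.

Lemma log2_le (x y : R) : 0 < x -> x <= y -> log2 x <= log2 y.
Proof.
move=> x0 xy; rewrite /log2 ler_wpM2r ?invr_ge0 ?(ltW (ln2_gt0 R)) //.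
by rewrite ler_ln ?posrE // (lt_le_trans x0).
Qed.

Lemma log2_double (x : R) : 0 < x -> log2 (2 * x) = 1 + log2 x.
Proof.
move=> x0; have l0 : ln 2 != 0 :> R by rewrite lt0r_neq0 // ln2_gt0.
by rewrite /log2 lnM ?posrE // mulrDl divff.
Qed.

Lemma log2_ge0 (x : R) : 1 <= x -> 0 <= log2 x.
Proof. move=> x1; exact: divr_ge0 (ln_ge0 x1) (ltW (ln2_gt0 R)). Qed.
End Log2.

(** If [f] did not exceed [B] by step [a * m], each block of [m] steps would double it, as
    [1 + m * eta >= 2], and [B] would be at least [2 ^+ a]. *)
Lemma geometric_growth (R : realType) (f : nat -> R) (eta B : R) (m a : nat) :
  0 < eta -> 1 <= m%:R * eta -> 1 <= f 0 -> (forall j, f j <= f j.+1) ->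
  (forall j, f j <= B -> (1 + eta) * f j <= f j.+1) -> B < 2 ^+ a ->
  B < f (a * m)%N.
Proof.
move=> e0 hm f1 fmono fgrow hB; rewrite ltNge; apply/negP=> hf.
have mono i j : (i <= j)%N -> f i <= f j.
  by move/subnK <-; elim: (j - i)%N => //= k IH; apply: le_trans IH (fmono _).
have fB j : (j <= a * m)%N -> f j <= B by move/mono/le_trans; apply.
have f0 j : 0 <= f j by apply: le_trans (mono 0 j (leq0n j)); lra.
have step i j : (i + j <= a * m)%N -> (1 + j%:R * eta) * f i <= f (i + j)%N.
  elim: j => [|j IH]; first by rewrite mul0r addr0 mul1r addn0.
  rewrite addnS => hj; have h1 := IH (ltnW hj).
  apply: le_trans (fgrow _ (fB _ (ltnW hj))).
  have h2 : (1 + eta) * ((1 + j%:R * eta) * f i) <= (1 + eta) * f (i + j)%N.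
    by rewrite ler_wpM2l //; lra.
  have h3 : 0 <= j%:R * eta * eta * f i.
    by rewrite !mulr_ge0 // ltW.
  rewrite -[j.+1%:R]natr1; lra.
have pow k : (k <= a)%N -> 2 ^+ k <= f (k * m)%N.
  elim: k => [|k IH] hk; first by rewrite expr0.
  have h1 := IH (ltnW hk); rewrite mulSn addnC exprS.
  have h2 : (k * m + m <= a * m)%N by rewrite addnC -mulSn leq_mul2r hk orbT.
  apply: le_trans (step _ _ h2).
  have h3 := mono 0 (k * m)%N (leq0n _).
  apply: (@le_trans _ _ (2 * f (k * m)%N)); first by rewrite ler_wpM2l.
  by rewrite ler_wpM2r //; lra.
by have := pow a (leqnn a); lra.
Qed.

Section DenseSubset.
Variables (R : realType) (H : sgraph) (alpha gamma : R).
Hypothesis alpha0 : 0 < alpha.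
Hypothesis gamma0 : 0 < gamma.

(** Twice the number of edges inside [A]. *)
Let e2 (A : {set H}) : nat := \sum_(v in A) #|nbr v :&: A|.

Lemma e2_split (A U : {set H}) : U \subset A ->
  e2 A = (e2 U + e2 (A :\: U) + 2 * \sum_(u in U) #|nbr u :&: (A :\: U)|)%N.
Proof.
move=> UA; rewrite /e2 (big_setID U) /= (setIidPr UA).
have split x : #|nbr x :&: A| = (#|nbr x :&: U| + #|nbr x :&: (A :\: U)|)%N.
  by rewrite -(cardsID U (nbr x :&: A)) setIDA -setIA (setIidPr UA).
rewrite (eq_bigr _ (fun x _ => split x)) big_split /=.
rewrite [X in (_ + X)%N](eq_bigr _ (fun x _ => split x)) big_split /=.
by rewrite [X in (_ + (X + _))%N]sum_deg_swap; lia.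
Qed.

(** Take [A] minimal with [e2 A >= #|A| * (alpha + gamma * log2 #|A|)]. Removing one vertex destroys
    the inequality, which bounds its degree from below. For [U] of at most half the size, both [U]
    and [A :\: U] are too sparse and [log2 #|U|] is smaller by at least 1, so the missing edges must
    cross. *)
Lemma exists_dense_subset (B : {set H}) : B != set0 ->
  #|B|%:R * (alpha + gamma * log2 #|B|%:R) <= (e2 B)%:R ->
  exists A : {set H}, [/\ A != set0, A \subset B,
    forall v, v \in A -> alpha / 2 <= #|nbr v :&: A|%:R &
    forall U : {set H}, U \subset A -> U != set0 -> (2 * #|U| <= #|A|)%N ->
      gamma / 2 * #|U|%:R <= (\sum_(u in U) #|nbr u :&: (A :\: U)|)%N%:R].
Proof.
move=> B0 hB.
pose P (A : {set H}) := [&& A != set0, A \subset B &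
  #|A|%:R * (alpha + gamma * log2 #|A|%:R) <= (e2 A)%:R].
have [A /minsetP[/and3P[A0 AB hA] minA]] : exists A, minset P A.
  have PB : P B by rewrite /P B0 subxx hB.
  by have [A hA _] := minset_exists PB; exists A.
have small (U : {set H}) : U \proper A -> U != set0 ->
    (e2 U)%:R < #|U|%:R * (alpha + gamma * log2 #|U|%:R).
  move=> UA U0; rewrite ltNge; apply/negP=> hU.
  have PU : P U by rewrite /P U0 (subset_trans (proper_sub UA) AB) hU.
  by have := minA U PU (proper_sub UA) => e; rewrite e properxx in UA.
have cpos (U : {set H}) : U != set0 -> 1 <= #|U|%:R :> R by rewrite ler1n card_gt0.
have split_strict (U : {set H}) : U \subset A -> U != set0 -> A :\: U != set0 ->
    #|A|%:R * (alpha + gamma * log2 #|A|%:R) < (e2 U)%:R +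
     #|A :\: U|%:R * (alpha + gamma * log2 #|A|%:R) +
     2 * (\sum_(u in U) #|nbr u :&: (A :\: U)|)%N%:R.
  move=> UA U0 D0.
  have DA : A :\: U \proper A.
    rewrite properE subsetDl; have /set0Pn[x xU] := U0.
    by apply/subsetPn; exists x; rewrite ?(subsetP UA) // inE xU.
  have h1 := small _ DA D0; have h2 := hA; rewrite (e2_split UA) natrD natrM natrD in h2.
  have h3 : log2 #|A :\: U|%:R <= log2 #|A|%:R :> R.
    apply: log2_le; first by have := cpos _ D0; lra.
    by rewrite ler_nat subset_leq_card // subsetDl.
  have h4 : #|A :\: U|%:R * (alpha + gamma * log2 #|A :\: U|%:R) <=
            #|A :\: U|%:R * (alpha + gamma * log2 #|A|%:R).
    by rewrite ler_wpM2l // lerD2l ler_wpM2l // ltW.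
  by lra.
have lA0 : 0 <= log2 #|A|%:R :> R by apply: log2_ge0; exact: cpos.
have cAU (U : {set H}) : U \subset A -> #|A|%:R = #|U|%:R + #|A :\: U|%:R :> R.
  by move=> UA; rewrite -natrD -(cardsID U A) (setIidPr UA).
have e21 v : e2 [set v] = 0%N.
  rewrite /e2 big_set1; apply/eqP; rewrite cards_eq0; apply/eqP/setP=> x.
  by rewrite !inE; case: eqP => [->|]; rewrite ?sedge_irr ?andbF.
exists A; split=> // [v vA|U UA U0 cU].
- have vsub : [set v] \subset A by rewrite sub1set.
  have v0 : [set v] != set0 by apply/set0Pn; exists v; rewrite inE.
  have [D0|D0] := eqVneq (A :\: [set v]) set0.
    have eA : A = [set v].
      by apply/eqP; rewrite eqEsubset vsub andbT -setD_eq0 D0.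
    move: hA; rewrite eA e21 cards1 /log2 ln1 mul0r mulr0 addr0; have := alpha0; lra.
  have := split_strict _ vsub v0 D0; rewrite e21 big_set1 (cAU _ vsub) cards1.
  have h : #|nbr v :&: (A :\: [set v])|%:R <= #|nbr v :&: A|%:R :> R.
    by rewrite ler_nat subset_leq_card // setIS // subsetDl.
  have : 0 <= gamma * log2 (1 + #|A :\: [set v]|%:R) by rewrite mulr_ge0 ?(ltW gamma0) // log2_ge0 // lerDl.
  by have := alpha0; lra.
- have D0 : A :\: U != set0.
    rewrite -card_gt0 cardsD (setIidPr UA) subn_gt0.
    by move: cU U0; rewrite -card_gt0; lia.
  have UpA : U \proper A.
    by rewrite properE UA /=; apply: contra D0; rewrite -setD_eq0.
  have h1 := split_strict U UA U0 D0; have h2 := small U UpA U0.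
  have cU1 := cpos U U0.
  have h3 : 1 + log2 #|U|%:R <= log2 #|A|%:R :> R.
    rewrite -log2_double; last lra.
    apply: log2_le; first lra.
    by rewrite -[2]/(2%:R) -natrM ler_nat.
  have h4 : #|U|%:R * (gamma * (1 + log2 #|U|%:R)) <= #|U|%:R * (gamma * log2 #|A|%:R).
    by rewrite ler_wpM2l // ler_wpM2l // ltW.
  by rewrite (cAU _ UA) in h1 h4 *; lra.
Qed.
End DenseSubset.

(** * Short paths inside a dense subset *)

Section DenseLinks.
Variables (R : realType) (H : sgraph) (d alpha gamma : R) (A : {set H}) (m a : nat).
Hypothesis d0 : 0 < d.
Hypothesis alpha1 : 4 <= alpha.
Hypothesis gamma0 : 0 < gamma.
Hypothesis gammad : gamma <= 4 * d.
Hypothesis hdeg : forall v : H, #|nbr v|%:R <= d.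
Hypothesis hmin : forall v, v \in A -> alpha / 2 <= #|nbr v :&: A|%:R.
Hypothesis hexp : forall U : {set H}, U \subset A -> U != set0 -> (2 * #|U| <= #|A|)%N ->
      gamma / 2 * #|U|%:R <= (\sum_(u in U) #|nbr u :&: (A :\: U)|)%N%:R.
Hypothesis hm : 1 <= m%:R * (gamma / (4 * d)).
Hypothesis ha : (#|A| < 2 ^ a)%N.

(** With all sets of the list equal to [A], [reach] is a breadth-first search in [A :\: Z]. At least
    [alpha / 4] vertices are present from the start, and [d * #|Z| <= gamma * alpha / 16], so [Z]
    absorbs at most half of the crossing edges. This leaves a growth factor [1 + gamma / (4 * d)]
    until half of [A] is passed. *)
Lemma dense_reach (Z : {set H}) x : x \in A ->
  #|Z|%:R <= gamma * alpha / (16 * d) ->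
  (#|A| < 2 * #|reach (nseq (a * m) A) [set x] Z :&: A :\: Z|)%N.
Proof.
move=> xA cZ.
have [d0' alpha1' gammad'] := And3 d0 alpha1 gammad.
pose S j := reach (nseq j A) [set x] Z :&: A :\: Z.
have SS j : S j \subset S j.+1.
  by apply: setSD; apply: setSI; exact: (reach_cat [:: A]).
have cZ' : 4 * d * #|Z|%:R <= gamma * (alpha / 4).
  have := ler_wpM2l (ltW (mulr_gt0 (ltr0n R 4) d0)) cZ.
  by rewrite (_ : 4 * d * (gamma * alpha / (16 * d)) = gamma * (alpha / 4)) //; field; rewrite gt_eqF.
have Z4 : #|Z|%:R <= alpha / 4.
  have : gamma * (alpha / 4) <= 4 * d * (alpha / 4) by rewrite ler_wpM2r //; lra.
  by move=> h; rewrite -(ler_pM2l (mulr_gt0 (ltr0n R 4) d0)); apply: le_trans cZ' h.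
have S0 : alpha / 4 <= #|S 0|%:R.
  have := hmin xA; rewrite /S /= Nb1 -(cardsID Z) natrD.
  have : #|nbr x :&: A :&: Z|%:R <= #|Z|%:R :> R by rewrite ler_nat subset_leq_card // subsetIr.
  lra.
have Sj j : alpha / 4 <= #|S j|%:R.
  elim: j => // j IH; apply: le_trans IH _.
  by rewrite ler_nat subset_leq_card // SS.
have grow j : #|S j|%:R <= #|A|%:R / 2 :> R ->
    (1 + gamma / (4 * d)) * #|S j|%:R <= #|S j.+1|%:R.
  move=> hj; set U := S j.
  have UA : U \subset A by apply/subsetP=> u; rewrite !inE => /andP[_ /andP[]].
  have U0 : U != set0.
    by rewrite -card_gt0 -(ltr_nat R); apply: lt_le_trans (Sj j); lra.
  have cU : (2 * #|U| <= #|A|)%N by rewrite -(ler_nat R) natrM; move: hj; rewrite -/U; lra.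
  have h1 := hexp UA U0 cU; rewrite sum_deg_swap in h1.
  pose N := S j.+1 :\: U.
  have h2 : (\sum_(y in A :\: U) #|nbr y :&: U|)%N%:R <= (#|Z|%:R + #|N|%:R) * d.
    have sub : (\sum_(y in A :\: U) #|nbr y :&: U| <= \sum_(y in Z :|: N) #|nbr y :&: U|)%N.
      rewrite [leqLHS](bigID (mem (Z :|: N))) /= [X in (_ + X)%N]big1 ?addn0.
        rewrite [leqRHS](bigID (mem (A :\: U))) /=.
        rewrite [X in (_ <= X + _)%N](eq_bigl (fun i => (i \in A :\: U) && (i \in Z :|: N))).
          exact: leq_addr.
        by move=> i /=; rewrite andbC.
      move=> y /andP[]; rewrite in_setD in_setU negb_or => /andP[yU yA] /andP[yZ yN].
      apply/eqP; rewrite cards_eq0; apply/eqP/setP=> u; rewrite in_setI [u \in nbr y]inE in_set0.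
      apply/negP=> /andP[yu uU]; case/negP: yN.
      rewrite /N in_setD yU /S /= in_setD in_setI yZ yA andbT in_setU.
      by apply/orP; right; apply/NbP; exists u => //; rewrite sedge_sym.
    apply: (@le_trans _ _ (\sum_(y in Z :|: N) #|nbr y :&: U|)%N%:R); first by rewrite ler_nat.
    rewrite natr_sum; apply: (@le_trans _ _ (\sum_(y in Z :|: N) d)).
      apply: ler_sum => y _; apply: le_trans (hdeg y); rewrite ler_nat.
      by rewrite subset_leq_card // subsetIl.
    rewrite sumr_const -[leLHS]mulr_natl ler_wpM2r ?(ltW d0) // -natrD ler_nat.
    exact: leq_card_setU.
  have h3 : #|S j.+1|%:R = #|U|%:R + #|N|%:R :> R.
    by rewrite -natrD -(cardsID U (S j.+1)) (setIidPr (SS j)).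
  have h4 : gamma * (alpha / 4) <= gamma * #|U|%:R by rewrite ler_wpM2l ?(ltW gamma0) // Sj.
  rewrite h3 mulrDl mul1r lerD2l -(ler_pM2r d0).
  have -> : gamma / (4 * d) * #|U|%:R * d = gamma / 4 * #|U|%:R by field; rewrite gt_eqF.
  lra.
rewrite -(ltr_nat R) natrM.
suff : #|A|%:R / 2 < #|S (a * m)%N|%:R :> R by rewrite -/(S (a * m)%N); lra.
apply: (@geometric_growth R (fun j => #|S j|%:R) (gamma / (4 * d))) => //.
- by rewrite divr_gt0 // mulr_gt0.
- by apply: le_trans S0; lra.
- by move=> j; rewrite ler_nat subset_leq_card // SS.
- have : #|A|%:R < (2 ^ a)%N%:R :> R by rewrite ltr_nat.
  by rewrite natrX; have : 0 <= #|A|%:R :> R by []; lra.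
Qed.

(** The searches from [x] and from [y] each cover more than half of [A], so they meet. *)
Lemma dense_link (Z : {set H}) x y : x \in A -> y \in A -> x != y ->
  #|Z|%:R <= gamma * alpha / (16 * d) ->
  exists q, [/\ path (@sedge H) x (rcons q y), uniq (x :: rcons q y),
    (size q <= (a * m).*2.+1)%N & {subset q <= A :\: Z}].
Proof.
move=> xA yA xy cZ.
have hx := dense_reach xA cZ; have hy := dense_reach yA cZ.
set X := reach _ [set x] _ :&: _ :\: _ in hx.
set Y := reach _ [set y] _ :&: _ :\: _ in hy.
have [v] : exists v, v \in X :&: Y.
  apply/set0Pn; rewrite -card_gt0.
  have := cardsUI X Y; have : (#|X :|: Y| <= #|A|)%N.
    apply/subset_leq_card/subsetP=> v; rewrite !inE.
    by case/orP=> /andP[_ /andP[]].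
  by lia.
rewrite !inE => /andP[/andP[vZ /andP[vx vA]] /andP[_ /andP[vy _]]].
have vAZ : v \in A :\: Z by rewrite inE vZ.
have [|q [h1 h2 h3 h4]] := reach_link xy vx vy vAZ.
  by move=> w; rewrite mem_nseq => /andP[_ /eqP->].
by exists q; split=> //; rewrite size_nseq in h3.
Qed.
End DenseLinks.

Lemma size_flatten_map_le (T E : eqType) (g : E -> seq T) (s : seq E) (M : nat) :
  (forall e, e \in s -> (size (g e) <= M)%N) ->
  (size (flatten (map g s)) <= size s * M)%N.
Proof.
elim: s => //= e s IH h; rewrite size_cat mulSn leq_add ?h ?mem_head //.
by apply: IH => e' he'; apply: h; rewrite inE he' orbT.
Qed.

(** Links are chosen one at a time, with [B] and all other chosen links forbidden; [z] bounds the
    forbidden set throughout. *)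
Lemma greedy_links (H : sgraph) (E : eqType) (es : seq E) (x y : E -> H)
    (A B : {set H}) (M z : nat) :
  (forall (Z : {set H}) e, (#|Z| <= z)%N -> e \in es ->
    exists q, [/\ path (@sedge H) (x e) (rcons q (y e)), uniq (x e :: rcons q (y e)),
      (size q <= M)%N & {subset q <= A :\: Z}]) ->
  (#|B| + size es * M <= z)%N -> uniq es ->
  exists Q : E -> seq H,
    (forall e, e \in es -> [/\ path (@sedge H) (x e) (rcons (Q e) (y e)),
      uniq (x e :: rcons (Q e) (y e)), (size (Q e) <= M)%N & {subset Q e <= A :\: B}]) /\
    (forall e e', e \in es -> e' \in es -> e != e' -> forall u, u \in Q e -> u \notin Q e').
Proof.
move=> hlink; elim: es hlink => [|e es IH] hlink hz.
  by exists (fun _ => [::]); split.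
rewrite /= => /andP[ees ues].
have [||Q [hQ dis]] := IH _ _ ues.
- by move=> Z e' hZ he'; apply: hlink => //; rewrite inE he' orbT.
- by apply: leq_trans hz; rewrite leq_add2l leq_mul2r /= leqnSn orbT.
pose Z := B :|: [set u in flatten [seq Q e' | e' <- es]].
have cZ : (#|Z| <= z)%N.
  apply: leq_trans hz; apply: leq_trans (leq_card_setU _ _) _; rewrite leq_add2l.
  rewrite cardsE; apply: leq_trans (card_size _) _.
  apply: (@leq_trans (size es * M)%N); last by rewrite /= leq_mul2r leqnSn orbT.
  by apply: size_flatten_map_le => e' he'; have [] := hQ e' he'.
have [q [q1 q2 q3 q4]] := hlink Z e cZ (mem_head _ _).
have ne e' : e' \in es -> (e' == e) = false.
  by move=> he'; apply: contraNF ees => /eqP <-.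
have qQ e' : e' \in es -> forall u, u \in q -> u \notin Q e'.
  move=> he' u /q4; rewrite !inE negb_or => /andP[/andP[_ + ] _].
  apply: contra => hu; apply/flattenP; exists (Q e') => //; exact: map_f.
exists (fun e' => if e' == e then q else Q e'); split.
- move=> e'; rewrite inE; case: eqP => [->|_] /=; last exact: hQ.
  by move=> _; split=> // u /q4; rewrite !inE negb_or => /andP[/andP[-> _] ->].
- move=> e1 e2; rewrite !inE; case: eqP => [->|_]; case: eqP => [->|_] //=.
  + by rewrite eqxx.
  + by move=> _ he2 _; apply: qQ.
  + by move=> he1 _ _ u hu; apply/negP=> /(qQ _ he1); rewrite hu.
  + exact: dis.
Qed.

(** * Subdivisions from paths *)

Section Subdivision.

Lemma infix_pair_map (T U : eqType) (f : T -> U) (x y : T) (s : seq T) :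
  injective f -> infix [:: f x; f y] (map f s) = infix [:: x; y] s.
Proof.
move=> inj; elim: s => // a s IH.
rewrite map_cons infix_consl IH [RHS]infix_consl; congr (_ || _).
by case: s {IH} => [|c s] /=; rewrite (inj_eq inj) ?prefix0s ?andbT // (inj_eq inj).
Qed.

(** The prefix [t] serves the induction. For empty [t], a list is a path for the relation of being
    consecutive in it, which is how the edges of a subdivision are built below. *)
Lemma path_infix (T : eqType) (x : T) (s t : seq T) :
  path [rel a b | infix [:: a; b] (t ++ x :: s)] x s.
Proof.
elim: s x t => //= y s IH x t; rewrite -cat_rcons IH andbT cat_rcons.
by apply: infix_catl; rewrite (prefix_infix [:: x; y]).
Qed.

Lemma path_infix_edge (T : eqType) (e : rel T) (x a b : T) (s : seq T) :
  path e x s -> infix [:: a; b] (x :: s) -> e a b.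
Proof.
elim: s x => [|y s IH] x; first by rewrite infix_consl /= andbF.
rewrite infix_consl => /andP[exy hp] /orP[|]; last exact: IH.
by rewrite /= prefix0s andbT => /andP[/eqP-> /eqP->].
Qed.

(** The vertices of [S] form a subtype of [H], and its edges are only the consecutive pairs of the
    paths; other edges of [H] between these vertices are left out. *)
Lemma subdivision_of_paths (F H : sgraph) (b : F -> H) (p : F -> F -> seq H) :
  injective b ->
  (forall u v, sedge u v ->
     [/\ path (@sedge H) (b u) (rcons (p u v) (b v)),
       uniq (b u :: rcons (p u v) (b v)), p v u = rev (p u v)
       & forall w, b w \notin p u v]) ->
  (forall u v u' v', sedge u v -> sedge u' v' -> [set u; v] != [set u'; v'] ->
     forall x, x \in p u v -> x \notin p u' v') ->
  exists (S : sgraph) (f : S -> H),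
    [/\ is_subdivision F S, subgraph_embedding f &
     forall x, (exists u, x = b u) \/ (exists u v, sedge u v /\ x \in p u v) ->
       x \in [set f y | y : S]].
Proof.
move=> binj hp dis.
pose full u v := b u :: rcons (p u v) (b v).
pose C (x : H) := [exists u, x == b u] ||
  [exists u, [exists v, sedge u v && (x \in p u v)]].
have Cb u : C (b u) by apply/orP; left; apply/existsP; exists u.
have Cp u v x : sedge u v -> x \in p u v -> C x.
  move=> uv xp; apply/orP; right; apply/existsP; exists u.
  by apply/existsP; exists v; rewrite uv.
pose V : finType := {x : H | C x}.
pose E : rel V := [rel x y | [exists u, [exists v,
  sedge u v && infix [:: val x; val y] (full u v)]]].
have frev u v : sedge u v -> full v u = rev (full u v).
  by move=> uv; rewrite /full; have [_ _ -> _] := hp u v uv; rewrite rev_cons rev_rcons.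
have Esym : symmetric E.
  suff h x y : E x y -> E y x by move=> x y; apply/idP/idP; apply: h.
  move=> /existsP[u /existsP[v /andP[uv hi]]].
  apply/existsP; exists v; apply/existsP; exists u.
  apply/andP; split; first by rewrite sedge_sym.
  by rewrite (frev _ _ uv) -[[:: _; _]]/(rev [:: val x; val y]) infix_rev.
have Esub x y : E x y -> sedge (val x) (val y).
  move=> /existsP[u /existsP[v /andP[uv hi]]].
  by have [h _ _ _] := hp u v uv; apply: path_infix_edge h hi.
have Eirr : irreflexive E.
  by move=> x; apply: contraFF (sedge_irr (val x)); exact: Esub.
pose S := SGraph Esym Eirr.
pose phi u : S := exist _ (b u) (Cb u).
pose pS u v : seq S := pmap insub (p u v).
have valpS u v : sedge u v -> map val (pS u v) = p u v.
  move=> uv; rewrite /pS pmap_filter; last exact: insubK.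
  by apply/all_filterP/allP => x xp; rewrite isSome_insub; apply: Cp xp.
have valfull u v : sedge u v -> map val (phi u :: rcons (pS u v) (phi v)) = full u v.
  by move=> uv; rewrite /= map_rcons valpS.
have Efull u v x y : sedge u v ->
    infix [:: x; y] (phi u :: rcons (pS u v) (phi v)) = infix [:: val x; val y] (full u v).
  by move=> uv; rewrite -(valfull u v uv) infix_pair_map //; exact: val_inj.
exists S, val; split.
- exists phi, pS; split.
  + by move=> u v /(congr1 val)/binj.
  + move=> u v uv; have [h1 h2 h3 h4] := hp u v uv; split.
    * apply: sub_path (path_infix (phi u) (rcons (pS u v) (phi v)) [::]) => x y h.
      have hi : infix [:: x; y] (phi u :: rcons (pS u v) (phi v)) by exact: h.
      rewrite (Efull u v) // in hi.
      by apply/existsP; exists u; apply/existsP; exists v; rewrite uv.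
    * by apply: (@map_uniq _ _ val); rewrite valfull.
    * apply: (inj_map val_inj); rewrite map_rev !valpS //.
      by rewrite sedge_sym.
    * by move=> w; rewrite mem_pmap_sub h4.
  + move=> u v u' v' uv uv' ne x; rewrite !mem_pmap_sub; exact: dis.
  + case=> x Cx; case/orP: (Cx) => [/existsP[u /eqP e]|/existsP[u /existsP[v /andP[uv xp]]]].
      by left; exists u; apply: val_inj.
    by right; exists u, v; split=> //; rewrite mem_pmap_sub.
  + move=> x y /existsP[u /existsP[v /andP[uv hi]]]; exists u, v; split=> //.
    by rewrite Efull.
- by split; [exact: val_inj | exact: Esub].
- move=> x hx; have Cx : C x.
    case: hx => [[u ->]|[u [v [uv xp]]]]; first exact: Cb.
    exact: Cp xp.
  by apply/imsetP; exists (exist _ x Cx : S).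
Qed.
End Subdivision.

Lemma uniq_flatten_map (T E : eqType) (g : E -> seq T) (s : seq E) :
  uniq s -> (forall e, e \in s -> uniq (g e)) ->
  (forall e e', e \in s -> e' \in s -> e != e' -> forall u, u \in g e -> u \notin g e') ->
  uniq (flatten (map g s)).
Proof.
elim: s => //= e s IH /andP[es us] hu dis.
rewrite cat_uniq hu ?mem_head //= IH //; last first.
- by move=> e1 e2 h1 h2; apply: dis; rewrite inE ?h1 ?h2 orbT.
- by move=> e' he'; apply: hu; rewrite inE he' orbT.
rewrite andbT; apply/hasPn => u /flatten_mapP[e' he' ue'].
apply/negP=> ue; have : u \notin g e'; last by rewrite ue'.
apply: (dis e) => //; rewrite ?mem_head // ?inE ?he' ?orbT //.
by apply: contraNneq es => ->.
Qed.

Lemma path_rev_sym (H : sgraph) (x y : H) (q : seq H) :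
  path (@sedge H) x (rcons q y) -> path (@sedge H) y (rcons (rev q) x).
Proof.
have := rev_path (@sedge H) x (rcons q y).
rewrite last_rcons belast_rcons rev_cons => -> h.
by rewrite (@eq_path _ _ (@sedge H)) // => a b /=; rewrite sedge_sym.
Qed.

(** * Joining paths and links into one long path *)

Section JoinPaths.
Variables (H : sgraph) (t : nat) (hd : 'I_t -> H) (tl : 'I_t -> seq H).
Variables (x0 y0 : H) (Vp W : {set H}) (k : nat).
Hypothesis hpath : forall i, [/\ path (@sedge H) (hd i) (tl i), uniq (hd i :: tl i),
  {subset hd i :: tl i <= Vp} & size (tl i) = k].
Hypothesis hdis : forall i j, i != j ->
  forall u, u \in hd i :: tl i -> u \notin hd j :: tl j.
Hypothesis x0V : x0 \notin Vp.
Hypothesis y0V : y0 \notin Vp.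
Hypothesis xy0 : x0 != y0.
Hypothesis x0W : x0 \notin W.
Hypothesis y0W : y0 \notin W.
Hypothesis VW : [disjoint Vp & W].

(** There are [t.+1] links for [t] paths. As [lift ord0 j] is [j + 1] and [lift ord_max j] is [j],
    link [i] runs from the end of path [i - 1] to the head of path [i]; [x0] and [y0] stand in at
    the two extremes. *)
Definition join_src (i : 'I_t.+1) : H :=
  if unlift ord0 i is Some j then last (hd j) (tl j) else x0.
Definition join_dst (i : 'I_t.+1) : H :=
  if unlift ord_max i is Some j then hd j else y0.

Lemma join_src_last j : join_src (lift ord0 j) = last (hd j) (tl j).
Proof. by rewrite /join_src liftK. Qed.

Lemma join_dst_hd j : join_dst (lift ord_max j) = hd j.
Proof. by rewrite /join_dst liftK. Qed.

Lemma join_src0 : join_src ord0 = x0.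
Proof. by rewrite /join_src unlift_none. Qed.

Lemma join_dst_max : join_dst ord_max = y0.
Proof. by rewrite /join_dst unlift_none. Qed.

Lemma mem_last_path j : last (hd j) (tl j) \in hd j :: tl j.
Proof. exact: mem_last. Qed.

Lemma path_sub j u : u \in hd j :: tl j -> u \in Vp.
Proof. by have [_ _ h _] := hpath j; apply: h. Qed.

Lemma eq_index u j j' : u \in hd j :: tl j -> u \in hd j' :: tl j' -> j = j'.
Proof.
move=> h h'; apply/eqP; apply: contraTT h' => ne; exact: hdis h.
Qed.

Lemma join_src_inj : injective join_src.
Proof.
move=> i i'; case: (unliftP ord0 i) => [j|] ->; case: (unliftP ord0 i') => [j'|] -> //;
  rewrite ?join_src_last ?join_src0 => e.
- congr (lift _ _); apply: (@eq_index (last (hd j) (tl j))); first exact: mem_last.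
  by rewrite e mem_last.
- by have := path_sub (mem_last_path j); rewrite e (negPf x0V).
- by have := path_sub (mem_last_path j'); rewrite -e (negPf x0V).
Qed.

Lemma join_dst_inj : injective join_dst.
Proof.
move=> i i'; case: (unliftP ord_max i) => [j|] ->; case: (unliftP ord_max i') => [j'|] -> //;
  rewrite ?join_dst_hd ?join_dst_max => e.
- congr (lift _ _); apply: (@eq_index (hd j)); first exact: mem_head.
  by rewrite e mem_head.
- by have := path_sub (mem_head (hd j) (tl j)); rewrite e (negPf y0V).
- by have := path_sub (mem_head (hd j') (tl j')); rewrite -e (negPf y0V).
Qed.

Lemma join_neq i : join_src i != join_dst i.
Proof.
case: (unliftP ord0 i) => [j|] e1; case: (unliftP ord_max i) => [j'|] e2.
- rewrite [in join_src i]e1 [in join_dst i]e2 join_src_last join_dst_hd.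
  apply/eqP=> e; have ej : j = j'.
    by apply: (@eq_index (hd j')); rewrite ?mem_head // -e mem_last.
  (* Here [i] would be both [j + 1] and [j]. *)
  move: (congr1 val e1); rewrite e2 ej /= /bump leq0n leqNgt ltn_ord /=; lia.
- rewrite [in join_src i]e1 [in join_dst i]e2 join_src_last join_dst_max.
  by apply: contraNneq y0V => <-; apply: (@path_sub j); exact: mem_last.
- rewrite [in join_src i]e1 [in join_dst i]e2 join_src0 join_dst_hd.
  by apply: contraNneq x0V => ->; apply: (@path_sub j'); exact: mem_head.
- by rewrite [in join_src i]e1 [in join_dst i]e2 join_src0 join_dst_max.
Qed.

(** Each block [g j] is link [j] followed by path [j], and link [t] closes the walk. The length
    bound counts only the vertices of the paths. *)
Lemma joined_path (Q : 'I_t.+1 -> seq H) :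
  (forall i, [/\ path (@sedge H) (join_src i) (rcons (Q i) (join_dst i)),
     uniq (join_src i :: rcons (Q i) (join_dst i)) & {subset Q i <= W}]) ->
  (forall i j, i != j -> forall u, u \in Q i -> u \notin Q j) ->
  exists q, [/\ path (@sedge H) x0 (rcons q y0), uniq (x0 :: rcons q y0),
    {subset q <= Vp :|: W} & (k.+1 * t <= size q)%N].
Proof.
move=> hQ dQ.
pose g (j : 'I_t) := Q (lift ord_max j) ++ hd j :: tl j.
pose es := enum 'I_t.
pose q := flatten (map g es) ++ Q ord_max.
have gV j u : u \in g j -> u \in Vp :|: W.
  rewrite mem_cat in_setU => /orP[uQ|/path_sub->//].
  by have [_ _ h] := hQ (lift ord_max j); rewrite (h _ uQ) orbT.
have VnW u : u \in Vp -> u \in W -> False.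
  by move=> uV uW; move: (disjointFr VW uV); rewrite uW.
have qV : {subset q <= Vp :|: W}.
  move=> u; rewrite mem_cat => /orP[/flatten_mapP[j _]|]; first exact: gV.
  by have [_ _ h] := hQ ord_max; move/h; rewrite inE orbC => ->.
(* Invariant: after [m] blocks the walk stands where link [m] starts. *)
have hwalk (m : 'I_t.+1) : path (@sedge H) x0 (flatten (map g (take m es))) /\
    last x0 (flatten (map g (take m es))) = join_src m.
  case: m => m; elim: m => [|m IH] hm.
    rewrite take0 /=; split=> //.
    by rewrite (_ : Ordinal hm = ord0) ?join_src0 //; exact: val_inj.
  have hm' : (m < t)%N by [].
  have [p1 l1] := IH (ltnW hm); pose j := Ordinal hm'.
  have szes : size es = t by rewrite size_enum_ord.
  have et : take m.+1 es = rcons (take m es) j.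
    by rewrite (take_nth j) ?szes // /es -[X in nth j _ X]/(val j) nth_ord_enum.
  rewrite /= in p1 l1 *; rewrite et map_rcons flatten_rcons cat_path last_cat p1 l1 /=.
  have [h1 _ _] := hQ (lift ord_max j); have [h2 _ _ _] := hpath j.
  have eo : lift ord_max j = Ordinal (ltnW hm).
    by apply: val_inj; rewrite /= /bump leqNgt hm'.
  rewrite join_dst_hd eo in h1.
  rewrite rcons_path in h1; case/andP: h1 => h1 h1'.
  split; first by rewrite /g eo cat_path h1 /= h1' h2.
  rewrite /g last_cat /= (_ : Ordinal hm = lift ord0 j) ?join_src_last //.
  exact: val_inj.
have [pw lw] := hwalk ord_max; rewrite take_oversize ?size_enum_ord // in pw lw.
exists q; split=> //.
- rewrite rcons_path cat_path pw last_cat lw /=.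
  have [h1 _ _] := hQ ord_max; move: h1; rewrite rcons_path join_dst_max.
  by case/andP=> -> ->.
- rewrite /= mem_rcons inE negb_or xy0 rcons_uniq.
  have nq z : z \notin Vp -> z \notin W -> z \notin q.
    by move=> zV zW; apply/negP=> /qV; rewrite inE (negPf zV) (negPf zW).
  rewrite !nq //= cat_uniq; apply/and3P; split.
  + apply: uniq_flatten_map; first exact: enum_uniq.
    * move=> j _; have [_ u1 s1] := hQ (lift ord_max j); have [_ u2 _ _] := hpath j.
      rewrite cat_uniq u2 andbT; apply/andP; split.
        by move: u1; rewrite /= rcons_uniq => /and3P[].
      by apply/hasPn => u /path_sub uV; apply/negP=> /s1; exact: VnW.
    * move=> j j' _ _ ne u; rewrite !mem_cat negb_or => /orP[uQ|up]; apply/andP; split.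
      - by apply: (dQ (lift ord_max j)) => //; rewrite (inj_eq lift_inj).
      - apply/negP=> /path_sub uV; apply: (VnW u uV).
        by have [_ _ s1] := hQ (lift ord_max j); apply: s1.
      - apply/negP=> uQ; apply: (VnW u (path_sub up)).
        by have [_ _ s1] := hQ (lift ord_max j'); apply: s1.
      - exact: hdis up.
  + apply/hasPn => u uQ; apply/negP=> /flatten_mapP[j _]; rewrite mem_cat => /orP[uQ'|up].
      have := dQ ord_max (lift ord_max j) _ u uQ; rewrite uQ' neq_lift.
      by move/(_ isT).
    apply: (VnW u (path_sub up)); have [_ _ s1] := hQ ord_max; exact: s1.
  + by have [_ u1 _] := hQ ord_max; move: u1; rewrite /= rcons_uniq => /and3P[].
- rewrite size_cat; apply: leq_trans (leq_addr _ _).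
  have sz s : (k.+1 * size s <= size (flatten (map g s)))%N.
    elim: s => [|j s IH]; first by rewrite muln0.
    rewrite /= size_cat mulnS leq_add //.
    by have [_ _ _ e] := hpath j; rewrite size_cat /= e leq_addl.
  by have := sz es; rewrite size_enum_ord.
Qed.
End JoinPaths.

(** [enum_rank] selects one orientation of each edge of [F]; the opposite one receives the reversed
    list. *)
Lemma subdivision_of_oriented_paths (F H : sgraph) (b : F -> H) (P : F * F -> seq H) :
  let fwd (e : F * F) := sedge e.1 e.2 && (enum_rank e.1 < enum_rank e.2)%N in
  injective b ->
  (forall e, fwd e ->
     [/\ path (@sedge H) (b e.1) (rcons (P e) (b e.2)),
       uniq (b e.1 :: rcons (P e) (b e.2)) & forall w, b w \notin P e]) ->
  (forall e e', fwd e -> fwd e' -> e != e' -> forall x, x \in P e -> x \notin P e') ->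
  exists (S : sgraph) (f : S -> H),
    [/\ is_subdivision F S, subgraph_embedding f &
     forall e x, fwd e -> x \in P e -> x \in [set f y | y : S]].
Proof.
move=> fwd binj hP dis.
pose p u v := if (enum_rank u < enum_rank v)%N then P (u, v) else rev (P (v, u)).
have orient (u v : F) : sedge u v -> (enum_rank u < enum_rank v)%N || (enum_rank v < enum_rank u)%N.
  move=> uv; rewrite -neq_ltn; apply/negP=> /eqP/val_inj/enum_rank_inj e.
  by rewrite e sedge_irr in uv.
have pE (u v : F) : sedge u v -> exists e, [/\ fwd e, [set e.1; e.2] = [set u; v] & p u v =i P e].
  move=> uv; case: (boolP (enum_rank u < enum_rank v)%N) => h.
    by exists (u, v); rewrite /fwd /= uv h /p h; split.
  have := orient u v uv; rewrite (negPf h) /= => h'.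
  exists (v, u); rewrite /fwd /= sedge_sym uv h' /p (negPf h); split=> //.
    by rewrite setUC.
  by move=> x; rewrite mem_rev.
have [||S [f [h1 h2 h3]]] := @subdivision_of_paths F H b p binj.
- move=> u v uv; case: (boolP (enum_rank u < enum_rank v)%N) => h.
    have [|q1 q2 q3] := hP (u, v); first by rewrite /fwd /= uv h.
    split=> //=; rewrite /p h //.
    by rewrite ltnNge (ltnW h).
  have := orient u v uv; rewrite (negPf h) /= => h'.
  have [|q1 q2 q3] := hP (v, u); first by rewrite /fwd /= sedge_sym uv h'.
  rewrite /p (negPf h) h' revK; split=> //.
  + exact: path_rev_sym.
  + by rewrite -[X in is_true X]/(uniq (b u :: _)) -rev_uniq rev_cons rev_rcons revK.
  + by move=> w; rewrite mem_rev.
- move=> u v u' v' uv uv' ne x.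
  have [e [fe ee pe]] := pE u v uv; have [e' [fe' ee' pe']] := pE u' v' uv'.
  rewrite pe pe'; apply: dis => //; apply: contraNneq ne => ee0.
  by rewrite -ee -ee' ee0.
exists S, f; split=> // -[u v] x /= /andP[/= uv h] xP; apply: h3; right.
by exists u, v; rewrite /p h.
Qed.

(** * Almost spanning subdivisions *)

(** If fewer edges left [U], deleting them all would be permitted and would leave [U] without
    neighbours. *)
Lemma expander_edges (R : realType) (eps c s : R) (H : sgraph) (U : {set H}) :
  0 < eps -> 0 < log2 (#|H|%:R : R) -> expander eps c s H -> (1 <= #|U|)%N ->
  #|U|%:R <= 2 / 3 * #|H|%:R :> R ->
  s * #|U|%:R <= (\sum_(u in U) #|nbr u :\: U|)%N%:R.
Proof.
move=> e0 l0 hexp U1 U2; rewrite leNgt; apply/negP=> hlt.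
pose D := [set p : H * H | (p.1 \in U) && (p.2 \in nbr p.1 :\: U)].
pose E : {set {set H}} := [set [set p.1; p.2] | p in D].
have cD : #|D| = (\sum_(u in U) #|nbr u :\: U|)%N.
  rewrite -sum1_card (eq_bigr (fun u => \sum_(v in nbr u :\: U) 1)%N); last first.
    by move=> u _; rewrite sum1_card.
  by rewrite pair_big_dep /=; apply: eq_bigl => p; rewrite inE.
have EH : E \subset edges H.
  apply/subsetP=> _ /imsetP[p + ->]; rewrite !inE => /andP[_ /andP[_ h]].
  by apply/imsetP; exists p; rewrite // inE.
have cE : #|E|%:R <= s * #|U|%:R.
  apply: le_trans (ltW hlt); rewrite -cD ler_nat; exact: leq_imset_card.
have := hexp U E EH U1 U2 cE.
have -> : #|@nbhd (del_edges E) U| = 0%N.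
  apply/eqP; rewrite cards_eq0; apply/eqP/setP=> y; rewrite !inE.
  apply/negP=> /andP[yU /existsP[x /andP[xU]]]; rewrite /= => /andP[xy].
  case/negP; apply/imsetP; exists (x, y) => //.
  by rewrite !inE xU yU.
rewrite leNgt mulr_gt0 //; last by rewrite ltr0n.
by rewrite divr_gt0 // powR_gt0.
Qed.

Lemma bigminn_le (T : eqType) (k : nat) (f : T -> nat) (s : seq T) x :
  x \in s -> (\big[minn/k]_(y <- s) f y <= f x)%N.
Proof.
elim: s => // y s IH; rewrite inE big_cons geq_min => /orP[/eqP->|/IH->].
  by rewrite leqnn.
by rewrite orbT.
Qed.

Lemma sum_deg_in (H : sgraph) (X : {set H}) :
  (\sum_(v in X) #|nbr v| = \sum_(v : H) #|nbr v :&: X|)%N.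
Proof.
have := sum_deg_swap [set: H] X.
rewrite (eq_bigl (fun _ : H => true)) => [->|v]; last by rewrite inE.
by apply: eq_bigr => v _; rewrite setIT.
Qed.

(** An edge lost with [X] has an end in [X] and counts twice in the degree sum. *)
Lemma sum_deg_setC (H : sgraph) (X : {set H}) :
  (\sum_(v : H) #|nbr v| <= \sum_(v in ~: X) #|nbr v :&: ~: X| + 2 * \sum_(v in X) #|nbr v|)%N.
Proof.
have swap := sum_deg_in X.
have h1 : (\sum_(v : H) #|nbr v| = \sum_(v : H) #|nbr v :&: X| + \sum_(v : H) #|nbr v :&: ~: X|)%N.
  by rewrite -big_split; apply: eq_bigr => v _; rewrite -(cardsID X (nbr v)) setDE.
have h2 : (\sum_(v : H) #|nbr v :&: ~: X| =
    \sum_(v in X) #|nbr v :&: ~: X| + \sum_(v in ~: X) #|nbr v :&: ~: X|)%N.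
  by rewrite (bigID (mem X)) /=; congr (_ + _)%N; apply: eq_bigl => v; rewrite !inE.
have h3 : (\sum_(v in X) #|nbr v :&: ~: X| <= \sum_(v in X) #|nbr v|)%N.
  by apply: leq_sum => v _; rewrite subset_leq_card // subsetIl.
by lia.
Qed.

Lemma exists_injection_into (T : finType) (V : finType) (A : {set V}) :
  (#|T| <= #|A|)%N -> (exists x, x \in A) ->
  exists b : T -> V, injective b /\ forall x, b x \in A.
Proof.
move=> cT [x0 _].
have sz (u : T) : (enum_rank u < size (enum A))%N.
  by rewrite -cardE; apply: leq_trans cT.
exists (fun u => nth x0 (enum A) (enum_rank u)); split.
- move=> u v /eqP; rewrite nth_uniq ?sz ?enum_uniq // => /eqP/val_inj.
  exact: enum_rank_inj.
- by move=> u; rewrite -mem_enum mem_nth.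
Qed.

(** Only the vertex of [i0] may lie outside the sparse set [D]. For the others, edges to their
    neighbourhood are counted twice: at least [d / 3] per vertex on one side, at most [2 * d / K] on
    the other, giving a factor [K / 6]. Dropping [i0] loses at most half of [J], hence [K / 12]; a
    set consisting of [i0] alone is handled by the minimum degree. *)
Lemma Nb_expansion (R : realType) (H : sgraph) (d K Lam : R) (D : {set H})
    (I : finType) (x : I -> H) (i0 : I) :
  0 < d -> 0 < K -> (forall v : H, d / 3 <= #|nbr v|%:R) ->
  (forall w : H, #|nbr w :&: D|%:R <= 2 * d / K) -> Lam <= K / 12 -> 0 <= Lam -> Lam <= d / 3 ->
  injective x -> (forall i, i != i0 -> x i \in D) ->
  forall J : {set I}, J != set0 -> Lam * #|J|%:R <= #|Nb (x @: J)|%:R.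
Proof.
move=> d0 K0 hmin hD hK Lam0 hd injx xD J J0.
have [e|] := eqVneq (J :\ i0) set0.
  have [j jJ] := set0Pn _ J0.
  have cJ : #|J|%:R <= 1 :> R.
    have := cardsD1 i0 J; rewrite e cards0 addn0 => ->.
    by case: (i0 \in J).
  have : nbr (x j) \subset Nb (x @: J).
    by rewrite -Nb1; apply: NbS; rewrite sub1set imset_f.
  move/subset_leq_card; rewrite -(ler_nat R) => h.
  have := hmin (x j); have : Lam * #|J|%:R <= Lam * 1 by rewrite ler_wpM2l.
  lra.
rewrite -card_gt0 => J1; pose J' := J :\ i0; pose X := x @: J'; rewrite -/J' in J1.
have XD : X \subset D.
  by apply/subsetP=> _ /imsetP[j + ->]; rewrite !inE => /andP[ji _]; apply: xD.
have cX : #|X| = #|J'| by rewrite card_imset.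
have cJ : (#|J| <= 2 * #|J'|)%N by rewrite (cardsD1 i0 J) -/J'; case: (i0 \in J); lia.
have NX : #|Nb X|%:R <= #|Nb (x @: J)|%:R :> R.
  by rewrite ler_nat subset_leq_card // NbS // imsetS // subsetDl.
have h1 : #|X|%:R * (d / 3) <= #|Nb X|%:R * (2 * d / K).
  apply: (@le_trans _ _ (\sum_(u in X) #|nbr u :&: Nb X|)%N%:R).
    rewrite natr_sum mulr_natl -sumr_const; apply: ler_sum => u uX.
    apply: le_trans (hmin u) _; rewrite ler_nat subset_leq_card //.
    rewrite subsetI subxx /=; apply/subsetP=> y; rewrite inE => uy.
    by apply/NbP; exists u.
  rewrite sum_deg_swap natr_sum mulr_natl -sumr_const; apply: ler_sum => y _.
  by apply: le_trans (hD y); rewrite ler_nat subset_leq_card // setIS.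
have h2 : #|X|%:R * K <= 6 * #|Nb X|%:R.
  have k0 : 0 < 3 * K / d by rewrite divr_gt0 // mulr_gt0.
  have := ler_wpM2r (ltW k0) h1.
  have -> : #|X|%:R * (d / 3) * (3 * K / d) = #|X|%:R * K by field; rewrite gt_eqF.
  by have -> : #|Nb X|%:R * (2 * d / K) * (3 * K / d) = 6 * #|Nb X|%:R by field; rewrite !gt_eqF.
have h3 : Lam * #|J|%:R <= K / 12 * (2 * #|X|%:R).
  by apply: ler_pM => //; rewrite cX -natrM ler_nat.
lra.
Qed.

Section AlmostSpanning.
Variables (R : realType) (H : sgraph) (L Lc d : R).
Let n := #|H|.
Hypothesis hL : (40 * 100) <= L.
Hypothesis hLn : L = log2 n%:R.
Hypothesis hLc : 1 <= Lc.
Hypothesis hd : Lc ^+ 10 * L ^+ 51 <= d.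
Hypothesis hdeg : forall v : H, #|nbr v|%:R <= d.
Hypothesis hmin : forall v : H, 2 / 5 * d <= #|nbr v|%:R.
Hypothesis hsum : n%:R * d * (1 - 1 / L ^+ 4) <= (\sum_(v : H) #|nbr v|)%N%:R.
Hypothesis hexp : forall U : {set H}, (1 <= #|U|)%N ->
  #|U|%:R <= 2 / 3 * n%:R :> R ->
  d / (4 * Lc) * #|U|%:R <= (\sum_(u in U) #|nbr u :\: U|)%N%:R.

Let L0 : 0 < L. Proof. by apply: lt_le_trans hL; rewrite mulr_gt0. Qed.
Let L1 : 1 <= L. Proof. by apply: le_trans hL; rewrite -natrM ler1n. Qed.
Let Lc0 : 0 < Lc. Proof. exact: lt_le_trans hLc. Qed.

(** All lower bounds on [d] in this section come from this one. *)
Lemma pow_le_d i j : (i <= 10)%N -> (j <= 51)%N -> Lc ^+ i * L ^+ j <= d.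
Proof.
move=> hi hj; apply: le_trans hd; apply: ler_pM; rewrite ?exprn_ge0 ?(ltW L0) ?(ltW Lc0) //.
- by rewrite ler_weXn2l.
- by rewrite ler_weXn2l.
Qed.

Let d0 : 0 < d.
Proof. by apply: lt_le_trans (pow_le_d (leq0n _) (leq0n _)); rewrite !expr0 mulr1. Qed.

Let n0 : (0 < n)%N.
Proof.
rewrite lt0n; apply/eqP=> e; move: L0; rewrite hLn e /log2 ln0 // mul0r ltxx //.
Qed.

Let nR0 : 0 < n%:R :> R. Proof. by rewrite ltr0n. Qed.

Lemma lnnE : ln n%:R = L * ln 2 :> R.
Proof. by rewrite hLn /log2 divfK // lt0r_neq0 // ln2_gt0. Qed.

Lemma ln2_le1 : ln 2 <= 1 :> R.
Proof. exact: (@le_ln1Dx R 1 (lt_trans (ltrN10 R) ltr01)). Qed.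

(** [n], which is 2 to the power [L], is at most [expR L], and a second factor [expR L] absorbs the
    8. Exponents of size [2 * L] therefore suffice in the union bounds. *)
Lemma eight_n_le : 8 * n%:R <= expR (2 * L).
Proof.
have e : n%:R = expR (L * ln 2) by rewrite -lnnE lnK.
have h1 : n%:R <= expR L.
  by rewrite e ler_expR -[leRHS]mulr1 ler_wpM2l ?(ltW L0) ?ln2_le1.
have h2 : 8 <= expR L by have := expR_ge1Dx L; have := hL; lra.
have -> : 2 * L = L + L by ring.
by rewrite expRD; apply: ler_pM.
Qed.

Lemma expRN_le (x : R) : 2 * L <= x -> expR (- x) <= 1 / (8 * n%:R).
Proof.
move=> hx; have h : expR (2 * L) <= expR x by rewrite ler_expR.
rewrite expRN -[leLHS]mul1r ler_pdivlMr ?mulr_gt0 //.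
rewrite mul1r mulrC ler_pdivrMr ?expR_gt0 // mul1r.
exact: le_trans eight_n_le h.
Qed.

(** This exceeds [L] even if [L] is an integer, so [2 ^ log_ceil] is strictly above [n]. *)
Definition log_ceil : nat := (Num.trunc L).+1.

Lemma log_ceil_le : log_ceil%:R <= 2 * L.
Proof.
have /andP[h _] : (Num.trunc L)%:R <= L < (Num.trunc L).+1%:R.
  by apply: Num.Theory.truncn_itv; exact: ltW.
by rewrite /log_ceil -natr1; have := L1; lra.
Qed.

Lemma n_lt_pow : (n < 2 ^ log_ceil)%N.
Proof.
have /andP[_ h] : (Num.trunc L)%:R <= L < (Num.trunc L).+1%:R.
  by apply: Num.Theory.truncn_itv; exact: ltW.
have e : n%:R = expR (L * ln 2) by rewrite -lnnE lnK.
rewrite -(ltr_nat R) e natrX; have e2 : 2 = expR (ln 2) :> R by rewrite lnK // posrE.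
by rewrite [X in _ < X ^+ _]e2 -expRM_natl ltr_expR ltr_pM2r // ln2_gt0.
Qed.

(** The average degree is at most [n] and at least [d / 2]. *)
Lemma d_le_n : d <= 2 * n%:R.
Proof.
have h1 : n%:R * d * (1 - 1 / L ^+ 4) <= n%:R * n%:R.
  apply: le_trans hsum _; rewrite -natrM ler_nat -[X in (X * _)%N]/(#|H|) -sum_nat_const.
  by apply: leq_sum => v _; apply: max_card.
have h2 : 1 / L ^+ 4 <= 1 / 2.
  have h : L <= L ^+ 4 by rewrite -[leLHS]expr1 ler_weXn2l.
  by rewrite ler_pdivrMr ?exprn_gt0 //; have := hL; lra.
rewrite -mulrA ler_pM2l // in h1.
have : d * (1 / L ^+ 4) <= d * (1 / 2) by rewrite ler_wpM2l // ltW.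
lra.
Qed.

(** Choice of parameters for [exists_connector]: [zeta] is [1 / (32 * Lc)], so [m] has order [Lc]
    and the number [l] of random sets has order [L * Lc]. *)
Lemma exists_sparse_connector : exists W : {set H},
  (forall v, #|nbr v :&: W|%:R <= d / ((4 * 100) * L)) /\
  forall (I : finType) (x y : I -> H), injective x -> injective y ->
    (forall i, x i != y i) ->
    (forall J : {set I}, J != set0 -> L ^+ 9 * Lc ^+ 3 * #|J|%:R <= #|Nb (x @: J)|%:R) ->
    (forall J : {set I}, J != set0 -> L ^+ 9 * Lc ^+ 3 * #|J|%:R <= #|Nb (y @: J)|%:R) ->
  exists Q : I -> seq H,
    (forall i, [/\ path (@sedge H) (x i) (rcons (Q i) (y i)),
       uniq (x i :: rcons (Q i) (y i)) & {subset Q i <= W}]) /\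
    (forall i j, i != j -> forall u, u \in Q i -> u \notin Q j).
Proof.
have [hL' hLc' L0' d0' L1'] := And5 hL hLc L0 d0 L1.
pose m := (Num.trunc (32 * Lc)).+1.
have /andP[m1 m2] : (Num.trunc (32 * Lc))%:R <= 32 * Lc < (Num.trunc (32 * Lc)).+1%:R.
  by apply: Num.Theory.truncn_itv; rewrite mulr_ge0 // ltW.
have m3 : m%:R <= 33 * Lc by rewrite /m -natr1; lra.
pose l := (2 * (log_ceil * m))%N.
pose l1 : R := l.+1%:R.
have l1L : l1 <= L ^+ 2 * Lc.
  have h1 : log_ceil%:R * m%:R <= 2 * L * (33 * Lc).
    by apply: ler_pM => //; exact: log_ceil_le.
  have h2 : (100 + 33) * (L * Lc) <= L * (L * Lc) by rewrite ler_wpM2r // ?mulr_ge0 ?(ltW L0) ?(ltW Lc0) //; lra.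
  have h3 : 1 <= L * Lc by rewrite -[leLHS]mulr1; apply: ler_pM.
  have -> : L ^+ 2 * Lc = L * (L * Lc) by ring.
  rewrite /l1 -natr1 /l !natrM; lra.
have l11 : 1 <= l1 by rewrite /l1 ler1n.
have l10 : 0 < l1 by lra.
(* The connector is made of [l.+1] random sets, each of degree at most [2 * beta * d]; the total
   becomes [d / (400 * L)]. *)
pose beta : R := 1 / ((8 * 100) * L * l1).
have Ll1 : 1 <= (8 * 100) * L * l1.
  by rewrite -[leLHS]mulr1; apply: ler_pM => //; lra.
have Ll0 : 0 < (8 * 100) * L * l1 by lra.
have b0 : 0 < beta by rewrite divr_gt0.
(* Makes [beta * zeta * lam / 8] equal to [2 * L], the exponent in [expRN_le]. *)
pose lam : R := (8 * 64) * L * Lc * ((8 * 100) * L * l1).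
pose s : R := d / (4 * Lc).
have s0 : 0 < s by rewrite divr_gt0 // mulr_gt0.
have zE : s / (8 * d) = 1 / (32 * Lc) by rewrite /s; field; rewrite !gt_eqF.
have lE : lam = (8 * 64) * L * Lc * ((8 * 100) * L * l1) by [].
have hbeta : 0 < beta <= 1.
  by rewrite b0 /= ler_pdivrMr // mul1r.
have e1 : 4 * (s / (8 * d)) * lam = 64 * L * ((8 * 100) * L * l1).
  by rewrite zE lE; field; rewrite gt_eqF.
have hlam : 1 <= 4 * (s / (8 * d)) * lam.
  by rewrite e1 -[leLHS]mulr1; apply: ler_pM => //; lra.
have e2 : beta * (s / (8 * d)) * lam / 8 = 2 * L.
  by rewrite zE lE /beta; field; rewrite !gt_eqF.
have hunion : expR (- (beta * (s / (8 * d)) * lam / 8)) <= 1 / (8 * n%:R).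
  by rewrite e2; apply: expRN_le.
have dl : 2 * L <= beta * d / 8.
  have h : 16 * L * ((8 * 100) * L * l1) <= d.
    apply: le_trans (pow_le_d (isT : (1 <= 10)%N) (isT : (6 <= 51)%N)).
    have -> : 16 * L * ((8 * 100) * L * l1) = (32 * 100) * (4 * L ^+ 2 * l1) by ring.
    have -> : Lc ^+ 1 * L ^+ 6 = L * (L * L ^+ 2 * (L ^+ 2 * Lc)) by ring.
    have p2 : 0 <= L ^+ 2 by rewrite exprn_ge0 // ltW.
    have a1 : 4 * L ^+ 2 <= L * L ^+ 2 by rewrite ler_wpM2r //; lra.
    have a0 : 0 <= 4 * L ^+ 2 by rewrite mulr_ge0.
    have a2 := ler_pM a0 (ltW l10) a1 l1L.
    have a3 : 0 <= 4 * L ^+ 2 * l1 by rewrite mulr_ge0 // ltW.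
    have a4 : 32 * 100 <= L by lra.
    by apply: ler_pM a4 a2 => //; rewrite mulr_ge0.
  rewrite /beta (_ : 1 / ((8 * 100) * L * l1) * d / 8 = d / (8 * ((8 * 100) * L * l1))); last by field; rewrite !gt_eqF.
  by rewrite ler_pdivlMr ?mulr_gt0 //; lra.
have hdegsum : n%:R * expR (- (beta * d / 8)) < 1 / 2.
  have h := ler_wpM2l (ltW nR0) (expRN_le dl).
  have e : n%:R * (1 / (8 * n%:R)) = 1 / 8 :> R by field; rewrite gt_eqF.
  rewrite e in h; lra.
have n3 : (3 <= n)%N.
  rewrite -(ler_nat R); have := d_le_n; have h := pow_le_d (leq0n _) (isT : (1 <= 51)%N).
  rewrite expr0 expr1 in h; lra.
have hm : 1 <= m%:R * (s / (8 * d)).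
  by rewrite zE mulrA mulr1 ler_pdivlMr ?mulr_gt0 // mul1r ltW.
have [W [hW1 hW2]] := exists_connector d0 s0 n3 hdeg hexp hbeta hlam hdegsum
  hunion hm (ltnW n_lt_pow).
exists W; split.
  move=> v; apply: le_trans (hW1 v) _; rewrite -/l -/l1 le_eqVlt; apply/orP; left; apply/eqP.
  by rewrite /beta; field; rewrite !gt_eqF.
(* The left side has order at most [L ^+ 6 * Lc ^+ 3]; three further powers of [L] absorb the
   numerical constants. *)
have big : 3 * lam * (2 + 4 * l.*2.+1)%N%:R <= L ^+ 9 * Lc ^+ 3.
  have h1 : (2 + 4 * l.*2.+1)%N%:R <= 8 * l1.
    by rewrite /l1 -natrM ler_nat; clear; lia.
  have p1 : 0 <= L ^+ 2 * Lc by rewrite mulr_ge0 ?exprn_ge0 // ltW.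
  have lam0 : 0 <= 3 * lam by rewrite !mulr_ge0 // ltW.
  apply: le_trans (ler_wpM2l lam0 h1) _.
  have -> : 3 * lam * (8 * l1) = (3 * (8 * 64)) * ((32 * 100) * 2) * (L ^+ 2 * Lc) * (l1 * l1).
    by rewrite lE; ring.
  have -> : L ^+ 9 * Lc ^+ 3 = L * (L * L) * (L ^+ 2 * Lc) * ((L ^+ 2 * Lc) * (L ^+ 2 * Lc)).
    by ring.
  have c0 : 0 <= (3 * (8 * 64)) * ((32 * 100) * 2) :> R by rewrite !mulr_ge0.
  have c1 : (3 * (8 * 64)) * ((32 * 100) * 2) <= L * (L * L).
    have c10 : 3 * (8 * 64) <= L by lra.
    have c11 : 32 * 100 <= L by lra.
    have c12 : (32 * 100) * 2 <= L * L by apply: ler_pM => //; lra.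
    by apply: ler_pM c10 c12; rewrite !mulr_ge0.
  have c2 : (3 * (8 * 64)) * ((32 * 100) * 2) * (L ^+ 2 * Lc) <= L * (L * L) * (L ^+ 2 * Lc).
    by rewrite ler_wpM2r.
  have c3 : l1 * l1 <= L ^+ 2 * Lc * (L ^+ 2 * Lc) by apply: ler_pM => //; exact: ltW.
  apply: ler_pM => //; first exact: mulr_ge0.
  by rewrite mulr_ge0 // ltW.
move=> I x y injx injy xy hx hy; apply: hW2 => // J J0.
- by apply: le_trans (hx J J0); rewrite ler_wpM2r.
- by apply: le_trans (hy J J0); rewrite ler_wpM2r.
Qed.

(** The degree sum outside [W] is still at least [9 / 10 * n * d], and [alpha + gamma * L] equals
    [9 / 10 * d], so [exists_dense_subset] applies there. Branch vertices are placed arbitrarily in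
    the resulting [A], where links have [O(L ^+ 2)] internal vertices. *)
Lemma exists_short_subdivision (W : {set H}) (F : finType) (es : seq (F * F)) :
  (forall v, #|nbr v :&: W|%:R <= d / ((4 * 100) * L)) ->
  (1 <= #|F|)%N -> (#|F| * #|F|)%N%:R <= d / L ^+ 4 ->
  uniq es -> (forall e, e \in es -> e.1 != e.2) ->
  exists (b : F -> H) (Q : F * F -> seq H),
    [/\ injective b, forall u, b u \notin W,
     forall e, e \in es -> [/\ path (@sedge H) (b e.1) (rcons (Q e) (b e.2)),
       uniq (b e.1 :: rcons (Q e) (b e.2)), {subset Q e <= ~: W} &
       forall w, b w \notin Q e],
     forall e e', e \in es -> e' \in es -> e != e' -> forall u, u \in Q e -> u \notin Q e' &
     #|[set b u | u : F] :|: [set u in flatten (map Q es)]|%:R <= d / (80 * L)].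
Proof.
move=> hW F1 F2 ues nes.
have [hL' L0' d0' L1'] := And4 hL L0 d0 L1.
pose B := ~: W.
pose alpha := d / 2; pose gamma := 2 / 5 * d / L.
have g0 : 0 < gamma by rewrite divr_gt0 // mulr_gt0 // divr_gt0.
have eB : 9 / 10 * (n%:R * d) <= (\sum_(v in B) #|nbr v :&: B|)%N%:R.
  have h1 := sum_deg_setC W; rewrite sum_deg_in -(ler_nat R) natrD natrM in h1.
  have h2 : (\sum_(v : H) #|nbr v :&: W|)%N%:R <= n%:R * (d / ((4 * 100) * L)).
    rewrite natr_sum mulr_natl -sumr_const; exact: ler_sum.
  have h3 := le_trans hsum h1.
  have h4 : n%:R * (d / ((4 * 100) * L)) <= n%:R * d * (1 / (4 * 100)).
    have -> : n%:R * (d / ((4 * 100) * L)) = n%:R * d * (1 / (4 * 100)) * (1 / L).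
      by field; rewrite gt_eqF.
    have i1 : 1 / L <= 1 by rewrite ler_pdivrMr // mul1r.
    have i2 : 0 <= n%:R * d * (1 / (4 * 100)).
      by rewrite mulr_ge0 ?divr_ge0 ?mulr_ge0 ?(ltW d0).
    by have := ler_wpM2l i2 i1; rewrite mulr1.
  have h5 : n%:R * d * (1 / L ^+ 4) <= n%:R * d * (1 / (40 * 100)).
    have i1 : L <= L ^+ 4 by rewrite -[leLHS]expr1 ler_weXn2l.
    have i2 : 1 / L ^+ 4 <= 1 / (40 * 100) by rewrite ler_pdivrMr ?exprn_gt0 //; lra.
    by apply: ler_wpM2l i2; rewrite mulr_ge0 // ltW.
  have nd0 : 0 < n%:R * d by rewrite mulr_gt0.
  rewrite -/B in h3; lra.
have nd0 : 0 < n%:R * d by rewrite mulr_gt0.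
have B0 : B != set0.
  apply/eqP=> e; move: eB; rewrite e big_set0; lra.
have hB : #|B|%:R * (alpha + gamma * log2 #|B|%:R) <= (\sum_(v in B) #|nbr v :&: B|)%N%:R.
  have cB : #|B|%:R <= n%:R :> R by rewrite ler_nat max_card.
  have cB1 : 1 <= #|B|%:R :> R by rewrite ler1n card_gt0.
  have lB : log2 #|B|%:R <= L by rewrite hLn; apply: log2_le => //; lra.
  have h1 : gamma * log2 #|B|%:R <= 2 / 5 * d.
    apply: le_trans (ler_wpM2l (ltW g0) lB) _.
    by rewrite /gamma divfK // gt_eqF.
  have h2 : #|B|%:R * (alpha + gamma * log2 #|B|%:R) <= n%:R * (9 / 10 * d).
    apply: ler_pM => //; last by rewrite /alpha; lra.
    by have := mulr_ge0 (ltW g0) (log2_ge0 cB1); rewrite /alpha; lra.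
  by apply: le_trans h2 _; apply: le_trans eB; lra.
have alpha0 : 0 < alpha by rewrite divr_gt0.
have [A [A0 AB minA expA]] := exists_dense_subset alpha0 g0 B0 hB.
have d32 : (40 * 100) <= d.
  by apply: le_trans hL _; have := pow_le_d (leq0n _) (isT : (1 <= 51)%N); rewrite expr0 expr1 mul1r.
have alpha4 : 4 <= alpha by rewrite /alpha; lra.
have gd : gamma <= 4 * d.
  rewrite /gamma ler_pdivrMr //.
  have : d * 1 <= d * L by rewrite ler_wpM2l // ltW.
  lra.
pose m := (Num.trunc (10 * L)).+1.
have /andP[m1 m2] : (Num.trunc (10 * L))%:R <= 10 * L < (Num.trunc (10 * L)).+1%:R.
  by apply: Num.Theory.truncn_itv; rewrite mulr_ge0 // ltW.
have m3 : m%:R <= 11 * L by rewrite /m -natr1; lra.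
have gE : gamma / (4 * d) = 1 / (10 * L) by rewrite /gamma; field; rewrite !gt_eqF.
have hm : 1 <= m%:R * (gamma / (4 * d)).
  by rewrite gE mulrA mulr1 ler_pdivlMr ?mulr_gt0 // mul1r ltW.
have ha : (#|A| < 2 ^ log_ceil)%N by apply: leq_ltn_trans n_lt_pow; apply: max_card.
have cA : (#|F| <= #|A|)%N.
  have [v vA] := set0Pn _ A0.
  have h1 := minA v vA.
  have h2 : #|nbr v :&: A|%:R <= #|A|%:R :> R by rewrite ler_nat subset_leq_card // subsetIr.
  have h3 : d / L ^+ 4 <= d / 4.
    rewrite ler_wpM2l ?(ltW d0) // lef_pV2 ?posrE ?exprn_gt0 //.
    by apply: le_trans (_ : L <= _); [lra | rewrite -[leLHS]expr1 ler_weXn2l].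
  have h4 : #|F|%:R <= (#|F| * #|F|)%N%:R :> R by rewrite ler_nat leq_pmulr.
  rewrite -(ler_nat R); rewrite /alpha in h1; lra.
have [b [binj bA]] : exists b : F -> H, injective b /\ forall x, b x \in A.
  by apply: exists_injection_into => //; apply/set0Pn.
pose M := (log_ceil * m).*2.+1.
have hM : M%:R <= 45 * L ^+ 2.
  have h1 : log_ceil%:R * m%:R <= 2 * L * (11 * L).
    by apply: ler_pM => //; exact: log_ceil_le.
  have h2 : 1 <= L ^+ 2 by rewrite exprn_ege1.
  have -> : 45 * L ^+ 2 = 2 * (2 * L * (11 * L)) + L ^+ 2 by ring.
  rewrite /M -natr1 -mul2n !natrM; lra.
(* [d / (80 * L)] equals [gamma * alpha / (16 * d)], the size of the obstacle that [dense_link]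
   tolerates. *)
pose z := Num.trunc (d / (80 * L)).
have hz (x : nat) : (x <= z)%N = (x%:R <= d / (80 * L)).
  by rewrite Num.Theory.truncn_ge_nat // divr_ge0 ?mulr_ge0 // ltW.
pose BB := [set b u | u : F].
have ces : (size es <= #|F| * #|F|)%N.
  by rewrite -card_prod -(card_uniqP ues) max_card.
have total : (#|BB| + size es * M)%N%:R <= d / (80 * L).
  have h1 : (#|BB| + size es * M <= #|F| * #|F| * M.+1)%N.
    rewrite mulnS leq_add ?leq_mul2r ?ces ?orbT //.
    by rewrite card_imset // leq_pmulr.
  have h2 : M.+1%:R <= 46 * L ^+ 2.
    have : 1 <= L ^+ 2 by rewrite exprn_ege1.
    by rewrite -natr1; lra.
  have h3 : (#|F| * #|F| * M.+1)%N%:R <= d / L ^+ 4 * (46 * L ^+ 2).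
    by rewrite natrM; apply: ler_pM.
  have h4 : d / L ^+ 4 * (46 * L ^+ 2) = d * (46 / L ^+ 2) by field; rewrite gt_eqF.
  (* This amounts to [46 * 80 <= L], which [hL] covers. *)
  have h5 : d * (46 / L ^+ 2) <= d * (1 / (80 * L)).
    rewrite ler_wpM2l ?(ltW d0) // ler_pdivrMr ?exprn_gt0 //.
    have -> : 1 / (80 * L) * L ^+ 2 = L / 80 by field; rewrite gt_eqF.
    lra.
  apply: le_trans (_ : (#|F| * #|F| * M.+1)%N%:R <= _); first by rewrite ler_nat.
  by move: h5; rewrite h4 in h3; lra.
have link (Z : {set H}) e : (#|Z| <= z)%N -> e \in es ->
    exists q, [/\ path (@sedge H) (b e.1) (rcons q (b e.2)),
      uniq (b e.1 :: rcons q (b e.2)), (size q <= M)%N & {subset q <= A :\: Z}].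
  rewrite hz => cZ ees; apply: (dense_link d0 alpha4 g0 gd hdeg minA expA hm ha) => //.
    by rewrite (inj_eq binj) nes.
  apply: le_trans cZ _; rewrite le_eqVlt; apply/orP; left; apply/eqP.
  by rewrite /gamma /alpha; field; rewrite !gt_eqF.
have cz : (#|BB| + size es * M <= z)%N by rewrite hz.
have [Q [hQ dis]] := greedy_links link cz ues.
exists b, Q; split=> //.
- by move=> u; have := subsetP AB _ (bA u); rewrite inE.
- move=> e ees; have [q1 q2 q3 q4] := hQ e ees; split=> //.
    by move=> u /q4; rewrite inE => /andP[_ /(subsetP AB)].
  move=> w; apply/negP=> /q4; rewrite inE => /andP[/negP[]].
  by apply/imsetP; exists w.
- apply: le_trans total; rewrite ler_nat.
  apply: leq_trans (leq_card_setU _ _) _; rewrite leq_add2l.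
  rewrite cardsE; apply: leq_trans (card_size _) _.
  by apply: size_flatten_map_le => e ees; have [] := hQ e ees.
Qed.
Lemma almost_spanning_subdivision (F : sgraph) :
  (exists u v : F, sedge u v) -> (#|F| * #|F|)%N%:R <= d / L ^+ 4 ->
  exists (S : sgraph) (f : S -> H),
    [/\ is_subdivision F S, subgraph_embedding f &
     #|~: [set f x | x : S]|%:R <= n%:R / L].
Proof.
move=> hF F2.
have [hL' hLc' L0' d0' L1'] := And5 hL hLc L0 d0 L1.
pose fwd (e : F * F) := sedge e.1 e.2 && (enum_rank e.1 < enum_rank e.2)%N.
have [e0 fe0] : exists e0, fwd e0.
  have [u [v uv]] := hF.
  have : enum_rank u != enum_rank v.
    by apply: contraTneq uv => /enum_rank_inj->; rewrite sedge_irr.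
  rewrite neq_ltn => /orP[h|h]; first by exists (u, v); rewrite /fwd /= uv.
  by exists (v, u); rewrite /fwd /= sedge_sym uv.
(* The edge [e0] is held back for the long path. *)
pose es := [seq e <- enum {: F * F} | fwd e && (e != e0)].
have ues : uniq es by rewrite filter_uniq // enum_uniq.
have esP e : (e \in es) = fwd e && (e != e0) by rewrite mem_filter mem_enum andbT.
have fwd_neq e : fwd e -> e.1 != e.2.
  by case/andP=> h _; apply: contraTneq h => ->; rewrite sedge_irr.
have F1 : (1 <= #|F|)%N by apply/card_gt0P; exists e0.1.
have [W [hW conn]] := exists_sparse_connector.
have [b [Q [binj bW hQ dQ cS]]] : exists (b : F -> H) (Q : F * F -> seq H),
    [/\ injective b, forall u, b u \notin W,
     forall e, e \in es -> [/\ path (@sedge H) (b e.1) (rcons (Q e) (b e.2)),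
       uniq (b e.1 :: rcons (Q e) (b e.2)), {subset Q e <= ~: W} &
       forall w, b w \notin Q e],
     forall e e', e \in es -> e' \in es -> e != e' -> forall u, u \in Q e -> u \notin Q e' &
     #|[set b u | u : F] :|: [set u in flatten (map Q es)]|%:R <= d / (80 * L)].
  apply: exists_short_subdivision => // e; rewrite esP => /andP[/fwd_neq].
  by [].
set SF := _ :|: _ in cS.
pose Vp := ~: (W :|: SF).
have dL : d / ((4 * 100) * L) <= d / 100 /\ d / (80 * L) <= d / 100.
  by split; rewrite ler_wpM2l ?(ltW d0) // lef_pV2 ?posrE ?mulr_gt0 //; lra.
have hminp (v : H) : d / 3 <= #|nbr v :&: Vp|%:R.
  have h1 : #|nbr v|%:R <= #|nbr v :&: W|%:R + #|SF|%:R + #|nbr v :&: Vp|%:R :> R.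
    rewrite -!natrD ler_nat -(cardsID (W :|: SF) (nbr v)) setDE leq_add2r setIUr.
    apply: leq_trans (leq_card_setU _ _) _; rewrite leq_add2l.
    by rewrite subset_leq_card // subsetIr.
  have := hmin v; have := hW v; have [] := dL; lra.
(* Forest paths have [K] vertices, one per layer. Their ends meet each neighbourhood in at most
   [2 * d / K] vertices, and [Nb_expansion] then gives the factor [K / 12], which must reach the
   [L ^+ 9 * Lc ^+ 3] asked for by the connector. *)
pose K' := Num.trunc (12 * (L ^+ 9 * Lc ^+ 3)).
pose K := K'.+1.
have LLc0 : 0 <= L ^+ 9 * Lc ^+ 3 by rewrite mulr_ge0 ?exprn_ge0 // ltW.
have LLc1 : 1 <= L ^+ 9 * Lc ^+ 3.
  by rewrite -[leLHS]mulr1; apply: ler_pM => //; rewrite exprn_ege1.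
have /andP[K1 K2] : K'%:R <= 12 * (L ^+ 9 * Lc ^+ 3) < K'.+1%:R.
  by apply: Num.Theory.truncn_itv; rewrite mulr_ge0.
have KL : K%:R <= L ^+ 10 * Lc ^+ 3.
  rewrite /K -natr1 (_ : L ^+ 10 * Lc ^+ 3 = L * (L ^+ 9 * Lc ^+ 3)); last by ring.
  have : 13 * (L ^+ 9 * Lc ^+ 3) <= L * (L ^+ 9 * Lc ^+ 3) by rewrite ler_wpM2r //; lra.
  lra.
have K0 : 0 < K%:R :> R by rewrite ltr0n.
have K1R : 1 <= K%:R :> R by rewrite ler1n.
(* For the [delta] below, the exponent [delta ^+ 2 * d / (72 * K)] is
   [d / (720000 * K ^+ 3 * L ^+ 2)]; this bound makes it at least [4 * L]. *)
have KKL : (100 * 72 * (4 * 100)) * (K%:R ^+ 3 * L ^+ 3) <= d.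
  apply: le_trans (pow_le_d (isT : (9 <= 10)%N) (isT : (36 <= 51)%N)).
  have -> : Lc ^+ 9 * L ^+ 36 = (L * L * L) * ((L ^+ 10 * Lc ^+ 3) ^+ 3 * L ^+ 3) by ring.
  apply: ler_pM; rewrite ?mulr_ge0 ?exprn_ge0 ?(ltW K0) ?(ltW L0) //.
    have h1 : 100 * 72 <= L * L.
      by apply: ler_pM => //; lra.
    by apply: ler_pM; rewrite ?mulr_ge0 //; lra.
  rewrite ler_wpM2r ?exprn_ge0 ?(ltW L0) //.
  by apply: lerXn2r; rewrite ?nnegrE ?mulr_ge0 ?exprn_ge0 ?(ltW L0) ?(ltW Lc0) ?(ltW K0).
(* Keeps the matching loss [4 * delta * K * n] of the forest at [n / (25 * L)]. *)
pose delta : R := 1 / (100 * K%:R * L).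
have KL0 : 0 < 100 * K%:R * L by rewrite !mulr_gt0.
have de0 : 0 < delta by rewrite divr_gt0.
have hdelta : 0 < delta <= 1.
  have k1 : 1 <= K%:R * L by rewrite -[leLHS]mulr1; apply: ler_pM.
  by rewrite de0 /= ler_pdivrMr // mul1r -mulrA; lra.
have hK3 : K%:R <= d / (10 * 100).
  have h : 1 <= K%:R ^+ 2 * L ^+ 3.
    by rewrite -[leLHS]mulr1; apply: ler_pM => //; rewrite exprn_ege1.
  have : K%:R * 1 <= K%:R * (K%:R ^+ 2 * L ^+ 3) by rewrite ler_wpM2l // ltW.
  have -> : K%:R * (K%:R ^+ 2 * L ^+ 3) = K%:R ^+ 3 * L ^+ 3 by ring.
  have h0 : 0 <= K%:R ^+ 3 * L ^+ 3 by rewrite mulr_ge0 ?exprn_ge0 // ltW.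
  lra.
have Kn : K%:R <= n%:R :> R by have := d_le_n; lra.
have hx : 2 * (2 * L) <= delta ^+ 2 * d / (72 * K%:R).
  have -> : delta ^+ 2 * d / (72 * K%:R) = d / (100 * 100 * 72 * K%:R ^+ 3 * L ^+ 2).
    by rewrite /delta; field; rewrite !gt_eqF.
  rewrite ler_pdivlMr; last by rewrite !mulr_gt0 ?exprn_gt0.
  by apply: le_trans KKL; lra.
have hsmall : 2 * n%:R * K%:R * expR (- (delta ^+ 2 * d / (72 * K%:R))) < 1.
  set x := delta ^+ 2 * d / (72 * K%:R) in hx *.
  have h1 : expR (- x) <= 1 / (8 * n%:R) * (1 / (8 * n%:R)).
    have -> : - x = - (x / 2) + - (x / 2) by field.
    by rewrite expRD; apply: ler_pM; rewrite ?expR_ge0 //; apply: expRN_le; lra.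
  have h2 : 2 * n%:R * K%:R * expR (- x) <= 2 * n%:R * n%:R * (1 / (8 * n%:R) * (1 / (8 * n%:R))).
    apply: ler_pM; rewrite ?mulr_ge0 ?expR_ge0 //.
    by rewrite ler_wpM2l // mulr_ge0.
  have e : 2 * n%:R * n%:R * (1 / (8 * n%:R) * (1 / (8 * n%:R))) = 1 / 32 :> R.
    by field; rewrite gt_eqF.
  rewrite e in h2; lra.
have [t [hd' [tl [hpf dpf degh degl cover]]]] := path_forest d0 hdeg hminp hdelta hsmall.
have bS u : b u \in SF by rewrite in_setU imset_f.
have bV u : b u \notin Vp by rewrite in_setC negbK in_setU bS orbT.
have VW : [disjoint Vp & W].
  rewrite -setI_eq0; apply/eqP/setP=> u; rewrite in_setI in_setC in_setU in_set0 negb_or.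
  by case: (u \in W); rewrite ?andbF.
have b12 : b e0.1 != b e0.2 by rewrite (inj_eq binj) fwd_neq.
pose src := join_src hd' tl (b e0.1).
pose dst := join_dst hd' (b e0.2).
have LamK : L ^+ 9 * Lc ^+ 3 <= K%:R / 12 by rewrite /K; lra.
have Lamd : L ^+ 9 * Lc ^+ 3 <= d / 3 by lra.
have hmin3 (v : H) : d / 3 <= #|nbr v|%:R.
  by apply: le_trans (hminp v) _; rewrite ler_nat subset_leq_card // subsetIl.
have src_inj : injective src by apply: (join_src_inj hpf dpf).
have dst_inj : injective dst by apply: (join_dst_inj hpf dpf).
have src_dst i : src i != dst i by apply: (join_neq hpf dpf).
have srcD i : i != ord0 -> src i \in [set last (hd' j) (tl j) | j : 'I_t].
  case: (unliftP ord0 i) => [j ->|->]; last by rewrite eqxx.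
  by move=> _; rewrite /src join_src_last imset_f.
have dstD i : i != ord_max -> dst i \in [set hd' j | j : 'I_t].
  case: (unliftP ord_max i) => [j ->|->]; last by rewrite eqxx.
  by move=> _; rewrite /dst join_dst_hd imset_f.
(* All sources except that of [ord0] are ends of forest paths, and all targets except that of
   [ord_max] are heads of forest paths. *)
have [QW [hQW dQW]] := conn _ src dst src_inj dst_inj src_dst
  (Nb_expansion d0 K0 hmin3 degl LamK LLc0 Lamd src_inj srcD)
  (Nb_expansion d0 K0 hmin3 degh LamK LLc0 Lamd dst_inj dstD).
have [q [q1 q2 q3 q4]] := joined_path hpf dpf (bV _) (bV _) b12 (bW _) (bW _) VW hQW dQW.
pose P e := if e == e0 then q else Q e.
have QS e u : e \in es -> u \in Q e -> u \in SF /\ u \notin W.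
  move=> ees uQ; split.
    by rewrite in_setU inE; apply/orP; right; apply/flatten_mapP; exists e.
  by have [_ _ h _] := hQ e ees; have := h u uQ; rewrite inE.
have qS u : u \in q -> u \notin SF \/ u \in W.
  move=> /q3; rewrite in_setU => /orP[|->]; last by right.
  by rewrite inE in_setU negb_or => /andP[_ h]; left.
have qQ e u : e \in es -> u \in q -> u \in Q e -> False.
  move=> ees uq uQ; have [h1 h2] := QS e u ees uQ.
  by case: (qS u uq); rewrite ?h1 ?(negPf h2).
have fe e : fwd e -> (e == e0) = false -> e \in es by rewrite esP => -> ->.
have [||S [f [h1 h2 h3]]] := @subdivision_of_oriented_paths F H b P binj.
- move=> e fwe; rewrite /P; case: eqP => [->|/eqP/negPf ne].
    split=> // w; apply/negP=> /qS; rewrite bS (negPf (bW w)).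
    by case.
  by have [? ? _ ?] := hQ e (fe _ fwe ne); split.
- move=> e e' fwe fwe'; rewrite /P; case: (e =P e0) => [->|/eqP/negPf ne]; case: (e' =P e0) => [->|/eqP/negPf ne'].
  + by rewrite eqxx.
  + by move=> _ u uq; apply/negP=> uQ; apply: (qQ e' u) => //; apply: fe.
  + by move=> _ u uQ; apply/negP=> uq; apply: (qQ e u) => //; apply: fe.
  + by apply: dQ; apply: fe.
exists S, f; split=> //.
have cq : (K * t <= #|[set f x | x : S]|)%N.
  apply: leq_trans q4 _.
  have uq : uniq q by move: q2; rewrite /= rcons_uniq => /and3P[].
  rewrite -(card_uniqP uq); apply/subset_leq_card/subsetP=> x xq.
  by apply: (h3 e0) => //; rewrite /P eqxx.
have cC : #|~: [set f x | x : S]|%:R = n%:R - #|[set f x | x : S]|%:R :> R.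
  by rewrite /n -(cardsC [set f x | x : S]) natrD addrC addKr.
have cq' : K%:R * t%:R <= #|[set f x | x : S]|%:R :> R by rewrite -natrM ler_nat.
rewrite cC; set Sx := \sum_(v in Vp) _ in cover.
(* [d * Sx] is the degree sum inside [Vp]: that of [H], less at most twice the degree sum of the
   removed vertices. *)
have SxE : n%:R * (1 - 1 / L ^+ 4) - 2 * (n%:R / ((4 * 100) * L) + #|SF|%:R) <= Sx.
  have eS : Sx = (\sum_(v in Vp) #|nbr v :&: Vp|)%N%:R / d.
    by rewrite /Sx natr_sum mulr_suml.
  rewrite eS ler_pdivlMr //.
  have g1 := sum_deg_setC (W :|: SF); rewrite -(ler_nat R) natrD natrM in g1.
  have g2 : (\sum_(v in W :|: SF) #|nbr v|)%N%:R <= n%:R * (d / ((4 * 100) * L)) + #|SF|%:R * d.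
    rewrite sum_deg_in.
    apply: (@le_trans _ _ (\sum_(v : H) (#|nbr v :&: W| + #|nbr v :&: SF|))%N%:R).
      by rewrite ler_nat leq_sum // => v _; rewrite setIUr leq_card_setU.
    rewrite big_split natrD; apply: lerD.
      by rewrite natr_sum mulr_natl -sumr_const; apply: ler_sum.
    rewrite -sum_deg_in natr_sum mulr_natl -sumr_const; exact: ler_sum.
  have := le_trans hsum g1; rewrite -/Vp.
  have -> : (n%:R * (1 - 1 / L ^+ 4) - 2 * (n%:R / ((4 * 100) * L) + #|SF|%:R)) * d =
     n%:R * d * (1 - 1 / L ^+ 4) - 2 * (n%:R * (d / ((4 * 100) * L)) + #|SF|%:R * d).
    by field; rewrite gt_eqF.
  lra.
(* In units of [x] the losses are at most 1/100 from irregularity, 1/200 and 1/20 from removing [W]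
   and [SF], and 1/100 and 1/25 from the forest. *)
pose x : R := n%:R / L.
have x0 : 0 < x by rewrite divr_gt0.
have xL4 : n%:R * (1 / L ^+ 4) <= x / 100.
  have -> : n%:R * (1 / L ^+ 4) = x * (1 / L ^+ 3) by rewrite /x; field; rewrite gt_eqF.
  rewrite ler_wpM2l ?(ltW x0) // mul1r lef_pV2 ?posrE ?exprn_gt0 //.
  by apply: le_trans (_ : L <= _); [lra | rewrite -[leLHS]expr1 ler_weXn2l].
have xW : n%:R / ((4 * 100) * L) = x / (4 * 100) by rewrite /x; field; rewrite gt_eqF.
have xS : #|SF|%:R <= x / 40.
  apply: le_trans cS _; have -> : x / 40 = 2 * n%:R / (80 * L) by rewrite /x; field; rewrite gt_eqF.
  by rewrite ler_wpM2r ?invr_ge0 ?mulr_ge0 ?(ltW L0) // d_le_n.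
have xK : 4 * delta * K%:R * n%:R = x / 25.
  by rewrite /x /delta; field; rewrite !gt_eqF.
have Sxn : Sx <= n%:R.
  apply: (@le_trans _ _ (\sum_(v in Vp) 1)).
    apply: ler_sum => v _; rewrite ler_pdivrMr // mul1r; apply: le_trans (hdeg v).
    by rewrite ler_nat subset_leq_card // subsetIl.
  by rewrite sumr_const ler_nat max_card.
have xd : delta * Sx <= x / 100.
  have h : delta * n%:R <= x / 100.
    have -> : delta * n%:R = x / 100 * (1 / K%:R) by rewrite /x /delta; field; rewrite !gt_eqF.
    have i1 : 1 / K%:R <= 1 :> R by rewrite ler_pdivrMr // mul1r.
    have i2 : 0 <= x / 100 by rewrite divr_ge0 // ltW.
    by have := ler_wpM2l i2 i1; rewrite mulr1.
  by apply: le_trans h; rewrite ler_wpM2l // ltW.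
rewrite xK in cover; rewrite xW in SxE; have final := le_trans cover cq'.
by rewrite -/x; move: final SxE xL4 xS xd x0; clear; lra.
Qed.
End AlmostSpanning.

Theorem lemma6p1 (R : realType) (c : R) (hc : 0 < c) :
  exists n0 : nat, forall n : nat, (n0 <= n)%N ->
  forall (eps d s : R),
    0 < eps -> eps <= 1 / (log2 (n%:R : R)) ^+ 4 ->
    (log2 (n%:R : R)) `^ (10 * c + 51) <= d ->
    d / (4 * (log2 (n%:R : R)) `^ c) <= s ->
  forall F : sgraph,
    (exists u v : F, sedge u v) ->
    #|F|%:R <= Num.sqrt d / (log2 (n%:R : R)) ^+ 2 ->
  forall H : sgraph,
    #|H| = n ->
    expander (1 / 8) c s H ->
    (max_deg H)%:R <= d ->
    d * (1 - eps) <= avg_deg H R ->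
    avg_deg H R / 2 <= (min_deg H)%:R ->
  exists (S : sgraph) (f : S -> H),
    [/\ is_subdivision F S,
        subgraph_embedding f
      & #|~: [set f x | x : S]|%:R <= n%:R / log2 (n%:R : R)].
Proof.
(* [x0] is [2 ^ 4000], so [L] is at least 4000. *)
pose x0 : R := expR (40 * 100 * ln 2).
exists (Num.trunc x0).+1 => n hn eps d s eps0 heps hd hs F hF cF H cH hexp hmax havg hmin.
set L := log2 (n%:R : R) in heps hd hs cF *.
have hL : 40 * 100 <= L.
  have h1 : x0 <= n%:R.
    have /andP[_ h] : (Num.trunc x0)%:R <= x0 < (Num.trunc x0).+1%:R.
      by apply: Num.Theory.truncn_itv; exact: expR_ge0.
    by apply: ltW; apply: lt_le_trans h _; rewrite ler_nat.
  have h2 : log2 x0 <= L by apply: log2_le h1; exact: expR_gt0.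
  apply: le_trans h2; rewrite /log2 /x0 expRK mulfK //.
  by rewrite lt0r_neq0 // ln2_gt0.
have L0 : 0 < L by apply: lt_le_trans hL; rewrite mulr_gt0.
have L1 : 1 <= L by apply: le_trans hL; rewrite -natrM ler1n.
pose Lc := L `^ c.
have hLc : 1 <= Lc.
  by rewrite -(powRr0 L) /Lc ler_powR // ltW.
have Lc0 : 0 < Lc by lra.
have hd' : Lc ^+ 10 * L ^+ 51 <= d.
  apply: le_trans hd; rewrite powRD; last by rewrite (gt_eqF L0) implybT.
  rewrite powR_mulrn ?(ltW L0) // [10 * c]mulrC powRrM powR_mulrn //.
  exact: powR_ge0.
have d0 : 0 < d by apply: lt_le_trans hd'; rewrite mulr_gt0 ?exprn_gt0.
have n0 : (0 < n)%N by apply: leq_trans hn.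
have nR0 : 0 < n%:R :> R by rewrite ltr0n.
have heps1 : eps <= 1 / 5.
  apply: le_trans heps _; rewrite ler_pdivrMr ?exprn_gt0 //.
  have : L <= L ^+ 4 by rewrite -[leLHS]expr1 ler_weXn2l.
  lra.
have hdeg (v : H) : #|nbr v|%:R <= d.
  apply: le_trans hmax; rewrite ler_nat -[#|nbr v|]/(deg v) /max_deg.
  by rewrite (bigD1 v) //= leq_maxl.
have havg' : d * (1 - eps) * n%:R <= (\sum_(v : H) #|nbr v|)%N%:R.
  by move: havg; rewrite /avg_deg cH ler_pdivlMr.
(* Half of the average degree is at least [d * (1 - 1 / 5) / 2]. *)
have hmin' (v : H) : 2 / 5 * d <= #|nbr v|%:R.
  have h : (min_deg H)%:R <= #|nbr v|%:R :> R.
    by rewrite ler_nat /min_deg bigminn_le // mem_index_enum.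
  apply: le_trans h; apply: le_trans hmin.
  have : d * eps <= d * (1 / 5) by rewrite ler_wpM2l // ltW.
  lra.
have hsum : #|H|%:R * d * (1 - 1 / L ^+ 4) <= (\sum_(v : H) #|nbr v|)%N%:R.
  apply: le_trans havg'; rewrite cH.
  have -> : d * (1 - eps) * n%:R = n%:R * d * (1 - eps) by ring.
  by rewrite ler_wpM2l ?mulr_ge0 ?(ltW d0) //; lra.
have hexp' (U : {set H}) : (1 <= #|U|)%N -> #|U|%:R <= 2 / 3 * #|H|%:R :> R ->
    d / (4 * Lc) * #|U|%:R <= (\sum_(u in U) #|nbr u :\: U|)%N%:R.
  move=> U1 U2; apply: le_trans (_ : s * #|U|%:R <= _); first by rewrite ler_wpM2r.
  apply: (@expander_edges R (1 / 8) c s H) => //.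
  - by rewrite divr_gt0.
  - by rewrite cH.
have F2 : (#|F| * #|F|)%N%:R <= d / L ^+ 4.
  have h : #|F|%:R * #|F|%:R <= Num.sqrt d / L ^+ 2 * (Num.sqrt d / L ^+ 2) by apply: ler_pM.
  rewrite natrM; apply: le_trans h _; rewrite le_eqVlt; apply/orP; left; apply/eqP.
  rewrite -[in RHS](sqr_sqrtr (ltW d0)); field; exact: lt0r_neq0.
have hLn : L = log2 #|H|%:R by rewrite cH.
have [S [f [h1 h2 h3]]] := almost_spanning_subdivision hL hLn hLc hd' hdeg hmin' hsum hexp' hF F2.
by exists S, f; split=> //; rewrite -[in leRHS]cH.
Qed.
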